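(* Let $\alpha>0$ and $1\le p<\infty$. Then, for each choice of sign $\pm$, $C_0^\infty(\mathbb{R})$ is dense in ${}^{\pm}W^{\alpha,p}(\mathbb{R})$. Hence ${}^{\pm}\overline{W}^{\alpha,p}(\mathbb{R})={}^{\pm}\overline{W}_0^{\alpha,p}(\mathbb{R})={}^{\pm}W^{\alpha,p}(\mathbb{R})$.
   Context: Fractional integrals on $\mathbb{R}$, for $\sigma>0$: ${}^{-}I^{\sigma}f(x)=\frac{1}{\Gamma(\sigma)}\int_{-\infty}^x\frac{f(y)}{(x-y)^{1-\sigma}}\,dy$ and ${}^{+}I^{\sigma}f(x)=\frac{1}{\Gamma(\sigma)}\int_x^\infty\frac{f(y)}{(y-x)^{1-\sigma}}\,dy$. For $n-1<\alpha<n$ ($n\in\mathbb{N}$): ${}^{-}D^{\alpha}\varphi=\frac{d^n}{dx^n}\,{}^{-}I^{n-\alpha}\varphi$ and ${}^{+}D^{\alpha}\varphi=(-1)^n\frac{d^n}{dx^n}\,{}^{+}I^{n-\alpha}\varphi$; for integer $\alpha$, ${}^{\pm}D^{\alpha}$ is the ordinary derivative of order $\alpha$. Weak fractional derivatives: let $[\alpha]$ be the integer part of $\alpha$. For $u\in L^p(\mathbb{R})$, $v\in L^1_{loc}(\mathbb{R})$ is the left (resp. right) weak fractional derivative of $u$, written ${}^{-}\mathcal{D}^{\alpha}u=v$ (resp. ${}^{+}\mathcal{D}^{\alpha}u=v$), if $\int_{\mathbb{R}} v\varphi\,dx=(-1)^{[\alpha]}\int_{\mathbb{R}} u\,{}^{+}D^{\alpha}\varphi\,dx$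 (resp. with ${}^{-}D^{\alpha}\varphi$ on the right-hand side) for all $\varphi\in C_0^\infty(\mathbb{R})$. With $m=[\alpha]$, ${}^{\pm}W^{\alpha,p}(\mathbb{R})=\{u\in W^{m,p}(\mathbb{R}):{}^{\pm}\mathcal{D}^{\alpha}u\in L^p(\mathbb{R})\}$ with norm $\big(\|u\|_{W^{m,p}(\mathbb{R})}^p+\|{}^{\pm}\mathcal{D}^{\alpha}u\|_{L^p(\mathbb{R})}^p\big)^{1/p}$ ($W^{0,p}=L^p$). One-side supported spaces: ${}^{-}C_0^\infty(\mathbb{R})=\{\varphi\in C^\infty(\mathbb{R}):\exists c\in\mathbb{R},\ \varphi(x)=0\ \forall x>c\}$, ${}^{+}C_0^\infty(\mathbb{R})=\{\varphi\in C^\infty(\mathbb{R}):\exists c\in\mathbb{R},\ \varphi(x)=0\ \forall x<c\}$. ${}^{\pm}\overline{W}^{\alpha,p}(\mathbb{R})$ and ${}^{\pm}\overline{W}_0^{\alpha,p}(\mathbb{R})$ are the completions, in the norm of ${}^{\pm}W^{\alpha,p}(\mathbb{R})$, of $C^\infty(\mathbb{R})$ and of ${}^{\pm}C_0^\infty(\mathbb{R})$ respectively (that is, of those functions in these spaces having finite norm). *)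

(* Defs.v *)
From HB Require Import structures.
From mathcomp Require Import all_boot all_order all_algebra.
From mathcomp Require Import all_classical all_reals all_analysis.

Set Implicit Arguments.
Unset Strict Implicit.
Unset Printing Implicit Defensive.

Import Order.TTheory GRing.Theory Num.Theory.
Import numFieldNormedType.Exports.

Local Open Scope classical_set_scope.
Local Open Scope ring_scope.

(* [Minus] stands for the left superscript "-", [Plus] for "+". *)
Inductive side := Minus | Plus.

Definition opp_side (s : side) : side :=
  match s with Minus => Plus | Plus => Minus end.

Section Functions.
Variable R : realType.
Implicit Types (f u v phi : R -> R) (s : side) (a p : R) (k n : nat).

Local Notation mu := (@lebesgue_measure R).

Definition smooth f : Prop := forall n x, derivable (derive1n n f) x 1.

Definition Cinfty : set (R -> R) := [set f | smooth f].

Definition Cinfty0 : set (R -> R) :=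
  [set f | smooth f /\ compact (closure [set x | f x != 0])].

Definition Cinfty0_side s : set (R -> R) :=
  match s with
  | Minus => [set f | smooth f /\ exists c, forall x, c < x -> f x = 0]
  | Plus => [set f | smooth f /\ exists c, forall x, x < c -> f x = 0]
  end.

Definition Gamma (sigma : R) : R :=
  \int[mu]_(t in `]0, +oo[) (t `^ (sigma - 1) * expR (- t)).

Definition frac_int s (sigma : R) f : R -> R :=
  match s with
  | Minus => fun x => (Gamma sigma)^-1 *
      \int[mu]_(y in `]-oo, x[) (f y / (x - y) `^ (1 - sigma))
  | Plus => fun x => (Gamma sigma)^-1 *
      \int[mu]_(y in `]x, +oo[) (f y / (y - x) `^ (1 - sigma))
  end.

(* For a non-integer order [a], the n with n - 1 < a < n is
   [(Num.truncn a).+1]. *)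
Definition frac_deriv s a phi : R -> R :=
  if a == (Num.truncn a)%:R then derive1n (Num.truncn a) phi
  else
    let n := (Num.truncn a).+1 in
    match s with
    | Minus => derive1n n (frac_int Minus (n%:R - a) phi)
    | Plus => fun x => (-1) ^+ n * derive1n n (frac_int Plus (n%:R - a) phi) x
    end.

Definition is_weak (k : nat) (D : (R -> R) -> R -> R) u v : Prop :=
  locally_integrable setT v /\
  forall phi, Cinfty0 phi ->
    \int[mu]_x (v x * phi x) = (-1) ^+ k * \int[mu]_x (u x * D phi x).

Definition is_weak_deriv k u v : Prop :=
  is_weak k (derive1n k) u v.

(* Integration by parts exchanges the sides. *)
Definition is_weak_frac_deriv s a u v : Prop :=
  is_weak (Num.truncn a) (frac_deriv (opp_side s) a) u v.

(* Weak derivatives are unique up to a.e. equality; these pick one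
   representative, and the zero function if there is none. *)
Definition weak_deriv k u : R -> R := xget (cst 0) (is_weak_deriv k u).

Definition weak_frac_deriv s a u : R -> R :=
  xget (cst 0) (is_weak_frac_deriv s a u).

Definition Lpnorm p u : \bar R := 'N[mu]_(p%:E)[EFin \o u].

Definition Sobolev k p : set (R -> R) :=
  [set u | u \in Lfun mu p%:E /\
    forall j, (1 <= j <= k)%N ->
      exists2 v, v \in Lfun mu p%:E & is_weak_deriv j u v].

Definition Sobolev_norm k p u : \bar R :=
  ((Lpnorm p u `^ p + \sum_(1 <= j < k.+1) Lpnorm p (weak_deriv j u) `^ p)
     `^ p^-1)%E.

Definition frac_Sobolev s a p : set (R -> R) :=
  [set u | Sobolev (Num.truncn a) p u /\
    exists2 v, v \in Lfun mu p%:E & is_weak_frac_deriv s a u v].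

(* Only meaningful on [frac_Sobolev s a p]. *)
Definition frac_Sobolev_norm s a p u : \bar R :=
  ((Sobolev_norm (Num.truncn a) p u `^ p +
    Lpnorm p (weak_frac_deriv s a u) `^ p) `^ p^-1)%E.

End Functions.

(* A normed space given by representatives: a set of vectors and a norm
   function, where two vectors of the set stand for the same element when
   their difference has norm zero (for the spaces of functions below, when
   they are a.e. equal).  The norm axioms are not part of the data. *)
Record nspace (R : realType) := NSpace {
  vec :> lmodType R;
  carrier : set vec;
  nrm : vec -> \bar R }.

Arguments carrier {R} n _.
Arguments nrm {R} n _.

Section NSpaces.
Variable R : realType.
Implicit Types S T : nspace R.

Definition dense_in S (A : set S) : Prop :=
  A `<=` carrier S /\
  forall x, carrier S x -> forall e : R, 0 < e ->
    exists2 y, A y & (nrm S (x - y) < e%:E)%E.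

Definition cauchy_seq S (x : nat -> S) : Prop :=
  (forall n, carrier S (x n)) /\
  forall e : R, 0 < e -> exists K, forall m n, (K <= m)%N -> (K <= n)%N ->
    (nrm S (x m - x n) < e%:E)%E.

(* Cauchy sequences, two of them being identified when their difference
   tends to zero. *)
Definition completion S : nspace R :=
  @NSpace R (nat -> S) [set x | @cauchy_seq S x]
    (fun x => limn (fun n => nrm S (x n))).

(* Equality of two spaces both containing (via [i] and [j]) the elements of
   [A]: a linear isometric bijection which is the identity on [A].
   Injectivity follows from linearity and the isometry property. *)
Definition same_space (V : Type) (A : set V) S T (i : V -> S) (j : V -> T) :
    Prop :=
  exists J : S -> T,
  [/\ forall x, carrier S x -> carrier T (J x),
      forall y, carrier T y -> exists2 x, carrier S x & nrm T (y - J x) = 0%E,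
      forall (c : R) x y, carrier S x -> carrier S y ->
        nrm T (J (c *: x + y) - (c *: J x + J y)) = 0%E,
      forall x, carrier S x -> nrm T (J x) = nrm S x &
      forall f, A f -> nrm T (J (i f) - j f) = 0%E].

End NSpaces.

Section FracSobolevSpaces.
Variable R : realType.
Implicit Types (s : side) (a p : R).

Definition frac_W s a p : nspace R :=
  @NSpace R (R -> R) (frac_Sobolev s a p) (frac_Sobolev_norm s a p).

(* The functions of A that have a finite norm, i.e. lie in [frac_Sobolev]. *)
Definition frac_W_of s a p (A : set (R -> R)) : nspace R :=
  @NSpace R (R -> R) (A `&` frac_Sobolev s a p) (frac_Sobolev_norm s a p).

Definition frac_Wbar s a p : nspace R :=
  completion (frac_W_of s a p (@Cinfty R)).

Definition frac_Wbar0 s a p : nspace R :=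
  completion (frac_W_of s a p (@Cinfty0_side R s)).

End FracSobolevSpaces.

(* Main.v *)
(* Let m be the integer part of a and n = m + 1.  Splitting the kernel t^(n-a-1)
   at t = 1 and integrating by parts on the tail, the fractional derivative of a
   test function phi is a combination of k1 * phi^(n), of a translate of phi^(m)
   and of k2 * phi^(m), with integrable kernels k1 and k2.  Convolution with an
   integrable kernel is bounded on L^p (Young) and transposes, so that a function
   with m-th and n-th weak derivatives in L^p has a weak fractional derivative,
   whose norm they control; moreover all the operators involved commute with
   translations and map test functions to bounded integrable ones, so that weak
   derivatives commute with mollification and pass to L^p limits.

   Density: mollifying u gives smooth functions, all of whose derivatives are in
   L^p, tending to u in norm; multiplying such a function f by cutoffs chi_k, the
   derivatives of (1 - chi_k) f tend to 0 in L^p by Leibniz' rule, hence so does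
   its weak fractional derivative.

   Equality of the completions: the space is complete by the Riesz-Fischer
   theorem, so a completion of any dense linear subspace is the space itself. *)
From mathcomp Require Import all_boot all_order all_algebra.
From mathcomp Require Import all_classical all_reals all_analysis measurable_realfun.
From mathcomp Require Import ring lra.
Require Import Defs.

Set Implicit Arguments.
Unset Strict Implicit.
Unset Printing Implicit Defensive.

Import Order.TTheory GRing.Theory Num.Theory.
Import numFieldNormedType.Exports.
Local Open Scope classical_set_scope.
Local Open Scope ring_scope.

(** For non-integer a the kernel t^(n-a-1) is not integrable at infinity, so Young's inequality does
    not apply to the fractional integral itself. Integrating the tail by parts lowers the exponent
    by one, below -1, while near 0 the original exponent exceeds -1. What results is a one-sided
    estimate: ordinary derivatives of orders m and m+1 control the fractional one, not conversely. A
    product chi u with u in the space cannot be estimated this way, since u need not have a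
    derivative of order m+1 and the nonlocal operator has no usable Leibniz rule. Mollifying before
    cutting off supplies that derivative, and the fractional derivative of a product is then reached
    through ordinary derivatives only. The representatives picked in the definition of the norm are
    linear only almost everywhere. Estimates are therefore carried out on arbitrary representatives,
    from which the norm is computed by uniqueness. *)

(** * Completions of dense subspaces of a complete seminormed space *)

Section SeminormSpace.
Variables (R : realType) (V : lmodType R) (C : set V) (N : V -> \bar R).
Hypothesis C0 : C 0.
Hypothesis CL : forall (c : R) x y, C x -> C y -> C (c *: x + y).
Hypothesis Nge0 : forall x, C x -> (0 <= N x)%E.
Hypothesis Nfin : forall x, C x -> N x \is a fin_num.
Hypothesis ND : forall x y, C x -> C y -> (N (x + y) <= N x + N y)%E.
Hypothesis NZ : forall c x, C x -> N (c *: x) = (`|c|%:E * N x)%E.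

Local Notation S := (@NSpace R V C N).
Local Notation onS A := (@NSpace R V A N).

Hypothesis Ncomplete : forall x : nat -> V, @cauchy_seq R S x ->
  exists2 y, C y & (fine (N (x n - y))) @[n --> \oo] --> 0.

Let n x := fine (N x).

Let nE x : C x -> N x = (n x)%:E.
Proof. by move=> Cx; rewrite fineK// Nfin. Qed.

Let CZ c x : C x -> C (c *: x).
Proof. by move=> Cx; rewrite -[X in C X]addr0; exact: CL. Qed.

Let CD x y : C x -> C y -> C (x + y).
Proof. by move=> Cx Cy; rewrite -[x]scale1r; exact: CL. Qed.

Let CB x y : C x -> C y -> C (x - y).
Proof. by move=> Cx Cy; rewrite addrC -scaleN1r; exact: CL. Qed.

Let n0 : n 0 = 0.
Proof.
by apply: EFin_inj; rewrite -nE// -(scale0r (0 : V)) NZ// normr0 mul0e.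
Qed.

Let n_ge0 x : C x -> 0 <= n x.
Proof. by move=> Cx; rewrite fine_ge0// Nge0. Qed.

Let nZ c x : C x -> n (c *: x) = `|c| * n x.
Proof. by move=> Cx; apply: EFin_inj; rewrite EFinM -!nE ?NZ//; exact: CZ. Qed.

Let nD x y : C x -> C y -> n (x + y) <= n x + n y.
Proof.
move=> Cx Cy; rewrite -lee_fin EFinD -!nE//; [exact: ND|exact: CD].
Qed.

Let nB x y : C x -> C y -> n (x - y) = n (y - x).
Proof.
by move=> Cx Cy; rewrite -[x - y]opprB -[- (y - x)]scaleN1r nZ ?normrN1 ?mul1r//; exact: CB.
Qed.

Let ntri x y z : C x -> C y -> C z -> n (x - z) <= n (x - y) + n (y - z).
Proof.
move=> Cx Cy Cz; rewrite (le_trans _ (nD (CB Cx Cy) (CB Cy Cz)))//.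
by rewrite addrA subrK.
Qed.

Let ndist x y : C x -> C y -> `|n x - n y| <= n (x - y).
Proof.
move=> Cx Cy; rewrite ler_norml.
have h1 := nD (CB Cx Cy) Cy; rewrite subrK in h1.
have h2 := nD (CB Cy Cx) Cx; rewrite subrK nB// in h2.
by apply/andP; split; lra.
Qed.

Let cauchyP A (x : nat -> V) : A `<=` C -> (forall k, A (x k)) ->
  (forall e : R, 0 < e -> exists K, forall i j, (K <= i)%N -> (K <= j)%N ->
     n (x i - x j) < e) -> @cauchy_seq R (onS A) x.
Proof.
move=> AC Ax h; split => // e e0; have [K hK] := h e e0; exists K => i j Ki Kj.
by rewrite /= nE ?lte_fin; [exact: hK|apply: CB; exact: AC].
Qed.

Let cauchyE A (x : nat -> V) : A `<=` C -> @cauchy_seq R (onS A) x ->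
  forall e : R, 0 < e -> exists K, forall i j, (K <= i)%N -> (K <= j)%N ->
     n (x i - x j) < e.
Proof.
move=> AC [Ax h] e e0; have [K hK] := h e e0; exists K => i j Ki Kj.
by have := hK i j Ki Kj; rewrite /= nE ?lte_fin//; apply: CB; exact: (AC _ (Ax _)).
Qed.

Let limnrm (x : nat -> V) (l : R) : (forall k, C (x k)) ->
  n (x k) @[k --> \oo] --> l -> limn (fun k => N (x k)) = l%:E.
Proof.
move=> Cx h; apply/cvg_lim => //.
rewrite (_ : (fun k => N (x k)) = (fun k => (n (x k))%:E)); last first.
  by apply/funext => k; rewrite nE.
by apply: cvg_EFin => //; exact: nearW.
Qed.

(** Three-epsilon argument: y i is close to x i, x i to x j, and x j to y j. *)
Let approx_cauchy A B (x y : nat -> V) : A `<=` C -> B `<=` C ->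
  @cauchy_seq R (onS A) x -> (forall k, B (y k)) ->
  n (x k - y k) @[k --> \oo] --> 0 -> @cauchy_seq R (onS B) y.
Proof.
move=> AC BC cx By xy; have Ax := proj1 cx; apply: cauchyP => // e e0.
have e3 : 0 < e / 3 by lra.
have [K hK] := cauchyE AC cx e3.
move/cvgr0_norm_lt: xy => /(_ _ e3)[M _ hM].
exists (maxn K M) => i j; rewrite !geq_max => /andP[Ki Mi] /andP[Kj Mj].
have Cx k : C (x k) by exact/AC/Ax.
have Cy k : C (y k) by exact: BC.
have h1 := ntri (Cy i) (Cx i) (Cy j).
have h2 := ntri (Cx i) (Cx j) (Cy j).
have h3 := hK _ _ Ki Kj.
have := hM _ Mi; have := hM _ Mj => /=.
rewrite !ger0_norm ?n_ge0//; [|exact: CB..].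
rewrite (nB (Cx i) (Cy i)) => ? ?; lra.
Qed.

(** Density is applied to each term with tolerance 1/(k+1). A constant x gives a sequence of A
    tending to a point; a Cauchy x gives an equivalent Cauchy sequence of A. *)
Let near_seq A : A `<=` C -> @dense_in R S A ->
  forall x : nat -> V, (forall k, C (x k)) ->
  exists2 y : nat -> V, (forall k, A (y k)) & n (x k - y k) @[k --> \oo] --> 0.
Proof.
move=> AC [_ dA] x Cx.
have /choice[y hy] : forall k, exists y, A y /\ n (x k - y) < k.+1%:R^-1.
  move=> k; have [//|y Ay h] := dA (x k) (Cx k) k.+1%:R^-1.
  exists y; split => //; move: h; rewrite /= nE ?lte_fin//.
  by apply: CB => //; exact: AC.
exists y => [k|]; first by case: (hy k).
apply: (@squeeze_cvgr _ _ _ _ (cst 0) (fun k : nat => k.+1%:R^-1)).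
- apply: nearW => k; rewrite n_ge0 /=; last by apply: CB => //; apply/AC/(hy k).1.
  by rewrite ltW//; case: (hy k).
- exact: cvg_cst.
- exact: cvg_harmonic.
Qed.

Let completion_ex A : A `<=` C -> forall x, @cauchy_seq R (onS A) x ->
  exists2 y, C y & n (x k - y) @[k --> \oo] --> 0.
Proof.
move=> AC x cx; apply: Ncomplete.
apply: cauchyP => //; last exact: cauchyE cx.
by move=> k; apply: AC; case: cx => + _; exact.
Qed.

Let cvg0D (u v : nat -> R) : u k @[k --> \oo] --> 0 -> v k @[k --> \oo] --> 0 ->
  u k + v k @[k --> \oo] --> 0.
Proof. by move=> hu hv; rewrite -[X in _ --> X](addr0 0); exact: cvgD. Qed.

Let cvg0_le (u v : nat -> R) : (forall k, 0 <= u k <= v k) ->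
  v k @[k --> \oo] --> 0 -> u k @[k --> \oo] --> 0.
Proof.
move=> h hv; apply: (@squeeze_cvgr _ _ _ _ (cst 0) v) => //.
  by apply: nearW => k; exact: h.
exact: cvg_cst.
Qed.

Let cvg0_abs (u v : nat -> R) : (forall k, `|u k| <= v k) ->
  v k @[k --> \oo] --> 0 -> u k @[k --> \oo] --> 0.
Proof.
move=> h hv; apply: norm_cvg0; apply: (cvg0_le _ hv) => k.
by rewrite normr_ge0 h.
Qed.

Let cst_le0 (r : R) (v : nat -> R) : (forall k, r <= v k) ->
  v k @[k --> \oo] --> 0 -> r <= 0.
Proof.
move=> h hv; rewrite -(cvg_lim _ hv)//; apply: limr_ge; first exact: cvgP hv.
by apply: nearW => k; exact: h.
Qed.

Let cvgZ0 c (u : nat -> R) : u k @[k --> \oo] --> 0 ->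
  c * u k @[k --> \oo] --> 0.
Proof. by move=> h; rewrite -[X in _ --> X](mulr0 c); exact: cvgMr. Qed.

Let cauchy_lin A (c : R) (x y : nat -> V) : A `<=` C ->
  (forall (c : R) x y, A x -> A y -> A (c *: x + y)) ->
  @cauchy_seq R (onS A) x -> @cauchy_seq R (onS A) y ->
  @cauchy_seq R (onS A) (fun k => c *: x k + y k).
Proof.
move=> AC AL cx cy; have [Ax _] := cx; have [Ay _] := cy.
apply: cauchyP => // [k|e e0]; first exact: (AL _ _ _ (Ax k) (Ay k)).
(* The added 1 keeps the divisor of [e / 2] positive when c = 0. *)
have c1 : 0 < `|c| + 1 by rewrite ltr_wpDl.
have e2 : 0 < e / 2 / (`|c| + 1) by apply: divr_gt0 => //; lra.
have e2' : 0 < e / 2 by lra.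
have [K hK] := cauchyE AC cx e2.
have [M hM] := cauchyE AC cy e2'.
exists (maxn K M) => i j; rewrite !geq_max => /andP[Ki Mi] /andP[Kj Mj].
have Cx k : C (x k) by exact/AC/Ax.
have Cy k : C (y k) by exact/AC/Ay.
rewrite opprD addrACA -scalerBr.
have := nD (CZ c (CB (Cx i) (Cx j))) (CB (Cy i) (Cy j)).
move=> /le_lt_trans; apply; rewrite nZ; last exact: CB.
have := hM _ _ Mi Mj; have := hK _ _ Ki Kj.
rewrite ltr_pdivlMr// => h1 h2.
have : 0 <= n (x i - x j) by apply/n_ge0/CB.
nra.
Qed.

Let nlin_dist c x y x' y' : C x -> C y -> C x' -> C y' ->
  n ((c *: x + y) - (c *: x' + y')) <= `|c| * n (x - x') + n (y - y').
Proof.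
move=> Cx Cy Cx' Cy'; rewrite opprD addrACA -scalerBr.
by rewrite (le_trans (nD _ _))//; [exact/CZ/CB|exact: CB|rewrite nZ//; exact: CB].
Qed.

Let nE0 x : C x -> n x <= 0 -> N x = 0%E.
Proof.
by move=> Cx nx; rewrite nE//; congr EFin; apply/le_anti; rewrite nx n_ge0.
Qed.

(** A Cauchy sequence is sent to a limit of it in C. Limits are unique only up to seminorm zero,
    which is all that [same_space] asks for. In the clauses stating an equality, a constant is
    bounded by a sequence tending to 0. *)
Lemma completion_dense_same_space (A : set V) : A `<=` C ->
  (forall (c : R) x y, A x -> A y -> A (c *: x + y)) -> @dense_in R S A ->
  @same_space R V A (completion (onS A)) S (fun f => cst f) id.
Proof.
move=> AC AL dA.
(* The default 0 is taken only where no limit exists in C. *)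
pose J (x : nat -> V) : V := xget 0 [set y | C y /\ n (x k - y) @[k --> \oo] --> 0].
have Jp x : @cauchy_seq R (onS A) x -> C (J x) /\ n (x k - J x) @[k --> \oo] --> 0.
  move=> cx; have [y Cy hy] := completion_ex AC cx.
  by rewrite /J; case: xgetP => [z -> []//|/(_ y) []].
have CJ x : @cauchy_seq R (onS A) x -> C (J x) by move=> /Jp[].
exists J; split => /=.
- exact: CJ.
- move=> y Cy; have [//|x Ax hx] := near_seq AC dA (x := cst y).
  have cx : @cauchy_seq R (onS A) x.
    apply: (@approx_cauchy C A (cst y) x) => //.
    by apply: cauchyP => // e e0; exists 0%N => *; rewrite subrr n0.
  exists x => //; have [CJx hJ] := Jp _ cx.
  apply: nE0; first exact: CB.
  apply: (cst_le0 _ (cvg0D hx hJ)) => k; apply: ntri => //.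
  by apply: AC.
- move=> c x y cx cy; have [CJx hx] := Jp _ cx; have [CJy hy] := Jp _ cy.
  have cxy := cauchy_lin c AC AL cx cy.
  have [CJxy hxy] := Jp _ cxy.
  apply: nE0; first by apply: CB => //; exact: CL.
  apply: (cst_le0 _ (cvg0D hxy (cvg0D (cvgZ0 `|c| hx) hy))) => k.
  have Cx i : C (x i) by exact: (AC _ (proj1 cx _)).
  have Cy i : C (y i) by exact: (AC _ (proj1 cy _)).
  have Cl := CL c (Cx k) (Cy k).
  apply: le_trans (ntri CJxy Cl (CL c CJx CJy)) _.
  by rewrite (nB CJxy Cl) lerD2l; exact: nlin_dist.
- move=> x cx; have [CJx hx] := Jp _ cx.
  have Cx i : C (x i) by exact: (AC _ (proj1 cx _)).
  rewrite (@limnrm x (n (J x))) ?nE//.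
  by apply/subr_cvg0/(cvg0_abs _ hx) => k; rewrite ndist.
- move=> f Af; have cf : @cauchy_seq R (onS A) (cst f).
    by apply: cauchyP => // e e0; exists 0%N => *; rewrite subrr n0.
  have [CJf hf] := Jp _ cf.
  have Cf := AC _ Af.
  apply: nE0; first exact: CB.
  by apply: (cst_le0 _ hf) => k; rewrite nB.
Qed.

(** The map goes directly from one completion to the other: a sequence of A is replaced by a
    sequence of B at distance tending to 0. *)
Lemma completions_dense_same_space (A B : set V) : A `<=` C -> B `<=` C ->
  (forall (c : R) x y, A x -> A y -> A (c *: x + y)) ->
  (forall (c : R) x y, B x -> B y -> B (c *: x + y)) ->
  @dense_in R S A -> @dense_in R S B ->
  @same_space R V (A `&` B) (completion (onS A)) (completion (onS B))
    (fun f => cst f) (fun f => cst f).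
Proof.
move=> AC BC AL BL dA dB.
pose J (x : nat -> V) : nat -> V :=
  xget 0 [set y | (forall k, B (y k)) /\ n (x k - y k) @[k --> \oo] --> 0].
have Jp x : @cauchy_seq R (onS A) x ->
    (forall k, B (J x k)) /\ n (x k - J x k) @[k --> \oo] --> 0.
  move=> cx; have Cx k : C (x k) by exact: (AC _ (proj1 cx _)).
  have [y By hy] := near_seq BC dB Cx.
  by rewrite /J; case: xgetP => [z -> []//|/(_ y) []].
have CJ x k : @cauchy_seq R (onS A) x -> C (J x k).
  by move=> /Jp[+ _] => h; exact: BC.
have CA x k : @cauchy_seq R (onS A) x -> C (x k).
  by move=> [Ax _]; exact: (AC _ (Ax k)).
have cJ x : @cauchy_seq R (onS A) x -> @cauchy_seq R (onS B) (J x).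
  by move=> cx; have [? ?] := Jp _ cx; exact: (approx_cauchy AC BC cx).
have limn0 z : (forall k, C (z k)) -> n (z k) @[k --> \oo] --> 0 ->
    limn (fun k => N (z k)) = 0%E.
  by move=> ? ?; exact: limnrm.
exists J; split => /=.
- exact: cJ.
- move=> y cy; have Cy k : C (y k) by exact: (BC _ (proj1 cy _)).
  have [x Ax hx] := near_seq AC dA Cy.
  have cx := approx_cauchy BC AC cy Ax hx.
  exists x => //; have [BJ hJ] := Jp _ cx.
  apply: limn0 => [k|]; first exact: (CB (Cy k) (CJ _ k cx)).
  apply: (cvg0_le _ (cvg0D hx hJ)) => k.
  rewrite n_ge0; last exact: (CB (Cy k) (CJ _ k cx)).
  by apply: ntri => //; [exact: AC|exact: BC].
- move=> c x y cx cy; have [BJx hx] := Jp _ cx; have [BJy hy] := Jp _ cy.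
  have cxy := cauchy_lin c AC AL cx cy.
  have [BJxy hxy] := Jp _ cxy.
  have Cl k := CL c (CA _ k cx) (CA _ k cy).
  have ClJ k := CL c (CJ _ k cx) (CJ _ k cy).
  apply: limn0 => [k|]; first exact: (CB (CJ _ k cxy) (ClJ k)).
  apply: (cvg0_le _ (cvg0D hxy (cvg0D (cvgZ0 `|c| hx) hy))) => k.
  apply/andP; split; first exact/n_ge0/(CB (CJ _ k cxy) (ClJ k)).
  apply: le_trans (ntri (CJ _ k cxy) (Cl k) (ClJ k)) _.
  rewrite (nB (CJ _ k cxy) (Cl k)) lerD2l.
  by apply: nlin_dist; [exact: CA|exact: CA|exact: CJ|exact: CJ].
- move=> x cx; have [BJx hx] := Jp _ cx.
  (* By the reverse triangle inequality the norms form a Cauchy sequence of reals, so their limit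
     exists; the norms of [J x] share it. *)
  have cvx : cvgn (n \o x).
    apply: cauchy_cvg; apply: cauchy_exP => e e0.
    have [K hK] := cauchyE AC cx e0.
    exists (n (x K)); exists K => // i Ki; rewrite /ball/=.
    by apply: le_lt_trans (ndist (CA _ K cx) (CA _ i cx)) _; exact: hK.
  rewrite (@limnrm x (limn (n \o x)))//; last by move=> k; exact: CA.
  rewrite (@limnrm (J x) (limn (n \o x)))//; first by move=> k; exact: CJ.
  have -> : (fun k => n (J x k)) = (fun k => n (x k) + (n (J x k) - n (x k))).
    by apply/funext => k; rewrite addrC subrK.
  rewrite -[X in _ --> X]addr0; apply: cvgD; first exact: cvx.
  apply: (cvg0_abs _ hx) => k.
  rewrite (nB (CA _ k cx) (CJ _ k cx)).
  by apply: ndist; [exact: CJ|exact: CA].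
- move=> f [Af Bf]; have cf : @cauchy_seq R (onS A) (cst f).
    by apply: cauchyP => // e e0; exists 0%N => *; rewrite subrr n0.
  have [BJf hf] := Jp _ cf.
  have CJB k := CB (CJ _ k cf) (AC _ Af).
  apply: limn0 => [//|]; apply: (cvg0_le _ hf) => k.
  by rewrite (n_ge0 (CJB k)) (nB (CJ _ k cf) (AC _ Af)) lexx.
Qed.

End SeminormSpace.

(** * The spaces L^p, with Fatou's lemma and completeness *)

Section Lp.
Variable R : realType.
Implicit Types (f g h : R -> R) (p : R).

Local Notation mu := (@lebesgue_measure R).

Definition ipow p f : \bar R := (\int[mu]_x (`|f x| `^ p)%:E)%E.

Definition nm p f : R := fine (Lpnorm p f).

Lemma ae_imp (P Q : R -> Prop) : (forall x, P x -> Q x) ->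
  {ae mu, forall x, P x} -> {ae mu, forall x, Q x}.
Proof.
by move=> PQ; apply: filterS => //; exact: (ae_filter_ringOfSetsType mu).
Qed.

(** Differentiability gives continuity at a positive limit. It may fail at 0, since p is also used
    in the form of an inverse exponent; there the threshold e^(1/p) works. *)
Lemma cvg_powR (u : nat -> R) (l : R) p : 0 < p -> (forall n, 0 <= u n) ->
  u n @[n --> \oo] --> l -> u n `^ p @[n --> \oo] --> l `^ p.
Proof.
move=> p0 u0 ul.
have : 0 <= l.
  rewrite -(cvg_lim _ ul)//; apply: limr_ge; first exact: cvgP ul.
  exact: nearW.
rewrite le_eqVlt => /predU1P[l0|l0]; last first.
  have dl : derivable (@powR R ^~ p) l 1 by apply: derivable_powR; rewrite in_itv/= l0.
  have := differentiable_continuous ((derivable1_diffP _ _).1 dl).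
  by move=> cl; apply: (cvg_comp _ (@powR R ^~ p) ul cl).
rewrite -l0 powR0 ?gt_eqF//; rewrite -l0 in ul.
apply/cvgr0Pnorm_lt => e e0.
have e'0 : 0 < e `^ p^-1 by rewrite powR_gt0.
move/cvgr0_norm_lt: ul => /(_ _ e'0)[N _ hN]; exists N => // n /hN /=.
rewrite !ger0_norm ?powR_ge0// => h.
have := @gt0_ltr_powR _ p p0 (u n) (e `^ p^-1).
by rewrite !nnegrE u0 powR_ge0 => /(_ isT isT h); rewrite -powRrM mulVf ?gt_eqF// powRr1// ltW.
Qed.

Lemma measurable_norm_powR f p : measurable_fun setT f ->
  measurable_fun setT (fun x => `|f x| `^ p).
Proof.
move=> mf; apply: (measurableT_comp (measurable_powR p)).
exact: measurableT_comp.
Qed.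

Lemma measurable_ipow f p : measurable_fun setT f ->
  measurable_fun setT (fun x => (`|f x| `^ p)%:E).
Proof. by move=> mf; apply/measurable_EFinP; exact: measurable_norm_powR. Qed.

Lemma ipow_ge0 p f : (0 <= ipow p f)%E.
Proof. by apply: integral_ge0 => x _; rewrite lee_fin powR_ge0. Qed.

Lemma LpnormE p f : Lpnorm p f = (ipow p f `^ p^-1)%E.
Proof. by rewrite /Lpnorm unlock. Qed.

Lemma Lpnorm_powR p f : 0 < p -> (Lpnorm p f `^ p)%E = ipow p f.
Proof.
by move=> p0; rewrite LpnormE -poweRrM mulVf ?gt_eqF// poweRe1// ipow_ge0.
Qed.

Lemma mem_LfunP p f : 0 < p -> f \in Lfun mu p%:E <->
  measurable_fun setT f /\ (ipow p f < +oo)%E.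
Proof.
move=> p0; rewrite inE; split=> [/andP[]|[mf fp]].
  rewrite !inE /= => mf; rewrite /finite_norm -/(Lpnorm p f) LpnormE => fp.
  by split => //; apply: (lty_poweRy _ fp); rewrite invr_eq0 gt_eqF.
apply/andP; split; rewrite inE//= /finite_norm -/(Lpnorm p f) LpnormE.
exact: poweR_lty.
Qed.

Section FixedExponent.
Variable p : R.
Hypothesis p1 : 1 <= p.

Let p0 : 0 < p. Proof. exact: lt_le_trans p1. Qed.

Local Notation Lp := (Lfun mu p%:E).

Lemma Lp_measurable f : f \in Lp -> measurable_fun setT f.
Proof. by move=> /(mem_LfunP _ p0)[]. Qed.

Lemma Lp_ipow f : f \in Lp -> (ipow p f < +oo)%E.
Proof. by move=> /(mem_LfunP _ p0)[]. Qed.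

Lemma Lp_lin c f g : f \in Lp -> g \in Lp -> (c *: f + g) \in Lp.
Proof.
by move=> fp gp; apply: (Lfun_submod_closed mu (p1 : (1 <= p%:E)%E)).2.
Qed.

Lemma Lp0 : (0 : R -> R) \in Lp.
Proof. by apply: (Lfun_submod_closed mu (p1 : (1 <= p%:E)%E)).1. Qed.

Lemma LpZ c f : f \in Lp -> (c *: f) \in Lp.
Proof. by move=> fp; rewrite -[_ *: _]addr0 Lp_lin// Lp0. Qed.

Lemma LpD f g : f \in Lp -> g \in Lp -> (f + g) \in Lp.
Proof. by move=> fp gp; rewrite -[f]scale1r Lp_lin. Qed.

Lemma LpB f g : f \in Lp -> g \in Lp -> (f - g) \in Lp.
Proof. by move=> fp gp; rewrite addrC -scaleN1r Lp_lin. Qed.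

Lemma LpnormEnm f : f \in Lp -> Lpnorm p f = (nm p f)%:E.
Proof.
move=> /Lp_ipow fp; rewrite /nm fineK// LpnormE fin_num_poweR//.
by rewrite ge0_fin_numE// ipow_ge0.
Qed.

Lemma nm_ge0 f : 0 <= nm p f.
Proof. by rewrite /nm fine_ge0// LpnormE poweR_ge0. Qed.

Lemma nm_powR f : f \in Lp -> (nm p f `^ p)%:E = ipow p f.
Proof. by move=> fp; rewrite -poweR_EFin -LpnormEnm// Lpnorm_powR. Qed.

Lemma nmZ c f : f \in Lp -> nm p (c *: f) = `|c| * nm p f.
Proof.
move=> fp; apply: EFin_inj; rewrite EFinM -!LpnormEnm//; last exact: LpZ.
exact: (LnormZ (Lfun_Sub (p1 : (1 <= p%:E)%E) fp) c).
Qed.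

Lemma nmD f g : f \in Lp -> g \in Lp -> nm p (f + g) <= nm p f + nm p g.
Proof.
move=> fp gp; rewrite -lee_fin EFinD -!LpnormEnm//; last exact: LpD.
by apply: minkowski_EFin => //; exact: Lp_measurable.
Qed.

Lemma le_ipow f g : measurable_fun setT f -> measurable_fun setT g ->
  (forall x, `|f x| <= `|g x|) -> (ipow p f <= ipow p g)%E.
Proof.
move=> mf mg fg; apply: ge0_le_integral => //.
- exact: measurable_ipow.
- exact: measurable_ipow.
- by move=> x _; rewrite lee_fin ge0_ler_powR ?nnegrE// ltW.
Qed.

Lemma le_Lp f g : measurable_fun setT f -> g \in Lp ->
  (forall x, `|f x| <= `|g x|) -> f \in Lp /\ nm p f <= nm p g.
Proof.
move=> mf gp fg; have mg := Lp_measurable gp.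
have fp : f \in Lp.
  by apply/(mem_LfunP _ p0); split=> //; rewrite (le_lt_trans (le_ipow mf mg fg))// Lp_ipow.
split=> //; rewrite -lee_fin -!LpnormEnm// !LpnormE; apply: gt0_ler_poweR => //.
- by rewrite invr_ge0 ltW.
- by rewrite in_itv/= ipow_ge0 leey.
- by rewrite in_itv/= ipow_ge0 leey.
- exact: le_ipow.
Qed.

Lemma nm_le_powR f (c : R) : f \in Lp -> 0 <= c ->
  (ipow p f <= (c `^ p)%:E)%E -> nm p f <= c.
Proof.
move=> fp c0; rewrite -nm_powR// lee_fin => h.
rewrite -(powRr1 (nm_ge0 f)) -(powRr1 c0) -(mulfV (lt0r_neq0 p0)) !powRrM.
by rewrite ge0_ler_powR ?nnegrE ?powR_ge0// invr_ge0 ltW.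
Qed.

Lemma ae_ipow f g : measurable_fun setT f -> measurable_fun setT g ->
  {ae mu, forall x, f x = g x} -> ipow p f = ipow p g.
Proof.
move=> mf mg fg; apply: ge0_ae_eq_integral => //; try exact: measurable_ipow.
- by apply: (ae_imp _ fg) => x /= -> _.
Qed.

Lemma ae_nm f g : measurable_fun setT f -> measurable_fun setT g ->
  {ae mu, forall x, f x = g x} -> nm p f = nm p g.
Proof. by move=> mf mg fg; rewrite /nm !LpnormE (ae_ipow mf mg fg). Qed.

Lemma ae_Lp f g : measurable_fun setT f -> g \in Lp ->
  {ae mu, forall x, f x = g x} -> f \in Lp.
Proof.
move=> mf gp fg; apply/(mem_LfunP _ p0); split => //.
by rewrite (ae_ipow mf (Lp_measurable gp) fg) Lp_ipow.
Qed.

Lemma limn_einf_le (u : nat -> \bar R) (c : \bar R) J :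
  (forall j, (J <= j)%N -> (u j <= c)%E) -> (limn_einf u <= c)%E.
Proof.
move=> uc; rewrite limn_einf_lim; apply: lime_le; first exact: is_cvg_einfs.
exists J => // j /= Jj; apply: (le_trans _ (uc _ Jj)).
by apply: ereal_inf_lbound; exists j => /=.
Qed.

(** The limit f is not assumed to be in L^p: a bound holding from some index on passes to it, and
    this is how membership of a limit is obtained. *)
Lemma fatou_ipow (F : nat -> R -> R) f (c : \bar R) J :
  (forall j, measurable_fun setT (F j)) -> measurable_fun setT f ->
  {ae mu, forall x, F j x @[j --> \oo] --> f x} ->
  (forall j, (J <= j)%N -> (ipow p (F j) <= c)%E) -> (ipow p f <= c)%E.
Proof.
move=> mF mf cF hF; apply: (@le_trans _ _
    (\int[mu]_x limn_einf (fun j => (`|F j x| `^ p)%:E))%E); last first.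
  apply: (le_trans (fatou _ _ _ _)) => //.
  - by move=> j; exact: measurable_ipow.
  exact: limn_einf_le hF.
apply: ae_ge0_le_integral => //.
- exact: measurable_ipow.
- move=> x _; rewrite limn_einf_lim; apply: lime_ge; first exact: is_cvg_einfs.
  apply: nearW => j; apply: le_ereal_inf_tmp => _ [i _ <-].
  by rewrite lee_fin powR_ge0.
- apply: (@emeasurable_fun_cvg _ _ _ _ (fun n x => einfs (fun j => (`|F j x| `^ p)%:E) n)).
    by move=> n; apply: measurable_fun_einfs => j; exact: measurable_ipow.
  move=> x _; rewrite limn_einf_lim; exact: is_cvg_einfs.
- apply: (ae_imp _ cF) => x cx _.
  rewrite (cvg_limn_einf_sup (l := (`|f x| `^ p)%:E))//.
  apply: cvg_EFin; first exact: nearW.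
  apply: cvg_powR => //; exact: cvg_norm.
Qed.

Lemma cvg_of_summable_steps (u : nat -> R) (C : R) :
  (forall k, `|u k.+1 - u k| <= C * 2^-1 ^+ k) -> cvgn u.
Proof.
move=> hu.
have ct : cvgn (series (telescope u)).
  apply: normed_cvg; apply: (@series_le_cvg _ _ (geometric C 2^-1)).
  - by move=> n; rewrite normr_ge0.
  - move=> n; rewrite /geometric/= (le_trans _ (hu n))//.
  - exact: hu.
  - apply: is_cvg_geometric_series; rewrite ger0_norm ?invr_ge0// invf_lt1//; lra.
have -> : u = (fun k => u 0%N + series (telescope u) k).
  by apply/funext => k; rewrite seriesEnat/= telescope_sumr// addrC subrK.
by apply: is_cvgD => //; exact: is_cvg_cst.
Qed.

(** Along a subsequence with steps of norm below 4^-k, the steps times 2^k have norm at most 2^-k,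
    so the sum S of their p-th powers is integrable. Where S is finite, the steps are at most
    S^(1/p) 2^-k, and the subsequence converges there. *)
Lemma Lp_complete (F : nat -> R -> R) : (forall k, F k \in Lp) ->
  (forall e : R, 0 < e -> exists K, forall i j, (K <= i)%N -> (K <= j)%N ->
     nm p (F i - F j) < e) ->
  exists2 f, f \in Lp & nm p (F k - f) @[k --> \oo] --> 0.
Proof.
move=> Fp cF.
have mF k := Lp_measurable (Fp k).
have /choice[K hK] : forall k : nat, exists K, forall i j, (K <= i)%N -> (K <= j)%N ->
    nm p (F i - F j) < 4^-1 ^+ k.
  by move=> k; apply: cF; rewrite exprn_gt0// invr_gt0.
(* Summing the thresholds gives [phi j >= K k] for all j >= k. *)
pose phi k := (\sum_(i < k.+1) K i)%N.
have Kphi i k : (i <= k)%N -> (K i <= phi k)%N.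
  move=> ik; rewrite /phi (bigD1 (Ordinal (ik : (i < k.+1)%N)))//=.
  exact: leq_addr.
pose e k : R -> R := 2 ^+ k *: (F (phi k.+1) - F (phi k)).
have ep k : e k \in Lp by apply/LpZ/LpB.
have ipe k : (ipow p (e k) <= (2^-1 ^+ k)%:E)%E.
  rewrite -nm_powR// lee_fin nmZ; last exact: LpB.
  have h : `|2 ^+ k : R| * nm p (F (phi k.+1) - F (phi k)) <= 2^-1 ^+ k.
    have h1 : nm p (F (phi k.+1) - F (phi k)) <= 4^-1 ^+ k.
      by apply/ltW/hK; apply: Kphi.
    have -> : (2^-1 ^+ k : R) = 2 ^+ k * 4^-1 ^+ k.
      by rewrite -exprMn; congr (_ ^+ _); lra.
    by rewrite ger0_norm ?exprn_ge0// ler_pM2l ?exprn_gt0.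
  have : 0 <= `|2 ^+ k : R| * nm p (F (phi k.+1) - F (phi k)).
    by rewrite mulr_ge0// nm_ge0.
  move: h; set t := `|_| * _ => h; rewrite le_eqVlt => /predU1P[<-|t0].
    by rewrite powR0 ?gt_eqF// exprn_ge0// invr_ge0.
  apply: (le_trans _ h); apply: ge1r_powR => //; rewrite t0/= (le_trans h)//.
  by rewrite exprn_ile1// ?invr_ge0// invf_le1// ler1n.
have mip k := measurable_ipow p (Lp_measurable (ep k)).
pose S x := (\sum_(0 <= k <oo) (`|e k x| `^ p)%:E)%E.
have mS : measurable_fun setT S.
  apply: (ge0_emeasurable_sum (P := xpredT)) => [k x _ _|k _]; last exact: mip.
  by rewrite lee_fin powR_ge0.
have S0 x : (0 <= S x)%E by apply: nneseries_ge0.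
have iS : mu.-integrable setT S.
  apply/integrableP; split => //.
  under eq_integral do rewrite gee0_abs//.
  rewrite integral_nneseries//.
  rewrite (@le_lt_trans _ _ 2%:E) ?ltry//.
  apply: lime_le; first by apply: is_cvg_nneseries => k _ _; exact: ipow_ge0.
  apply: nearW => n; rewrite (@le_trans _ _ (\sum_(0 <= k < n) (2^-1 ^+ k)%:E)%E)//.
    by apply: lee_sum => k _; exact: ipe.
  rewrite sumEFin lee_fin.
  have -> : \sum_(0 <= k < n) (2^-1 : R) ^+ k = 2 - 2 * 2^-1 ^+ n.
    elim: n => [|n IHn]; first by rewrite big_nil expr0; lra.
    by rewrite big_nat_recr//= IHn exprS; lra.
  by rewrite lerBlDr lerDl mulr_ge0// exprn_ge0// invr_ge0.
have cvF : {ae mu, forall x, cvgn (fun k => F (phi k) x)}.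
  apply: (ae_imp _ (integrable_ae measurableT iS)) => x /(_ I) Sfin.
  apply: (@cvg_of_summable_steps _ ((fine (S x)) `^ p^-1)) => k.
  have h1 : `|e k x| `^ p <= fine (S x).
    rewrite -lee_fin fineK// /S.
    apply: le_trans (nneseries_lim_ge k.+1 _) => //.
    by rewrite big_nat_recr//= leeDr// sume_ge0.
  have h2 : `|e k x| <= (fine (S x)) `^ p^-1.
    have e0 : `|e k x| = (`|e k x| `^ p) `^ p^-1.
      by rewrite -powRrM mulfV ?gt_eqF// powRr1.
    by rewrite e0 ge0_ler_powR ?invr_ge0 ?nnegrE ?powR_ge0 ?fine_ge0// ltW.
  have -> : F (phi k.+1) x - F (phi k) x = 2^-1 ^+ k * e k x.
    by rewrite /e /= exprVn mulrA mulVf ?mul1r// expf_neq0.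
  rewrite normrM mulrC (@ger0_norm _ (2^-1 ^+ k)) ?exprn_ge0 ?invr_ge0//.
  by rewrite ler_wpM2r// exprn_ge0// invr_ge0.
(* The upper limit is measurable everywhere and equals the limit wherever the latter exists. *)
pose f x := fine (limn_esup (fun k => (F (phi k) x)%:E)).
have mf : measurable_fun setT f.
  apply: measurableT_comp; first exact: (fine_measurable measurableT).
  apply: measurable_fun_limn_esup => k.
  by apply/measurable_EFinP.
have cf : {ae mu, forall x, F (phi k) x @[k --> \oo] --> f x}.
  apply: (ae_imp _ cvF) => x cx; rewrite /f.
  rewrite (cvg_limn_einf_sup (l := (limn (fun k => F (phi k) x))%:E))//.
  by apply: cvg_EFin => //; exact: nearW.
(* Fatou in j applied to [F i - F (phi j)]: this yields both f in L^p and the convergence of the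
   whole sequence. *)
have bound k i : (K k <= i)%N -> (ipow p (F i - f)%R <= ((4^-1 ^+ k) `^ p)%:E)%E.
  move=> Ki; apply: (@fatou_ipow (fun j => F i - F (phi j)) _ _ k).
  - by move=> j; apply: Lp_measurable; exact: LpB.
  - by apply: measurable_funB.
  - by apply: (ae_imp _ cf) => x cx; apply: cvgB => //; exact: cvg_cst.
  - move=> j kj; rewrite -nm_powR; last exact: LpB.
    rewrite lee_fin ge0_ler_powR ?nnegrE ?nm_ge0 ?exprn_ge0 ?invr_ge0// ?ltW//.
    by apply: hK => //; exact: Kphi.
have fp : f \in Lp.
  have -> : f = F (K 0%N) - (F (K 0%N) - f) by rewrite opprB addrC subrK.
  apply: LpB => //; apply/(mem_LfunP _ p0); split; first exact: measurable_funB.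
  by rewrite (le_lt_trans (bound 0%N _ _))// ltry.
exists f => //; apply/cvgr0Pnorm_lt => d d0.
have [k hk] : exists k : nat, (4^-1 : R) ^+ k < d.
  have c4 : (4^-1 : R) ^+ k @[k --> \oo] --> 0.
    by apply: cvg_expr; rewrite ger0_norm ?invr_ge0// invf_lt1// ltr1n.
  move/cvgr0_norm_lt: c4 => /(_ _ d0)[N _ /(_ N (leqnn N))] /= h.
  by exists N; rewrite (le_lt_trans (ler_norm _)).
exists (K k) => // i /= Ki; rewrite ger0_norm ?nm_ge0// (le_lt_trans _ hk)//.
by apply: nm_le_powR; [exact: LpB|rewrite exprn_ge0// invr_ge0|exact: bound].
Qed.

End FixedExponent.
End Lp.

(** * Pairing L^p with bounded integrable functions *)

Section Pairing.
Variable R : realType.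
Implicit Types (f g h k : R -> R) (p : R).

Local Notation mu := (@lebesgue_measure R).

(* Being in L^1 and bounded, such functions can be paired with any function of
   L^p, whatever the exponent. *)
Definition good g := [/\ measurable_fun setT g, mu.-integrable setT (EFin \o g) &
  exists M, forall x, `|g x| <= M].

Lemma le1D_powR p (a : R) : 1 <= p -> 0 <= a -> a <= 1 + a `^ p.
Proof.
move=> p1 a0; have [a1|a1] := leP a 1; first by rewrite (le_trans a1)// lerDl powR_ge0.
by rewrite (le_trans (le1r_powR (ltW a1) p1))// lerDr.
Qed.

Section FixedExponent.
Variable p : R.
Hypothesis p1 : 1 <= p.

Let p0 : 0 < p. Proof. exact: lt_le_trans p1. Qed.

Local Notation Lp := (Lfun mu p%:E).

Lemma Lp_locally_integrable f : f \in Lp -> locally_integrable setT f.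
Proof.
move=> fp; have mf := Lp_measurable p1 fp.
split => //; first exact: openT.
move=> K _ cK; have mK := compact_measurable cK.
rewrite (@le_lt_trans _ _ (\int[mu]_(x in K) (1 + (`|f x| `^ p)%:E))%E)//.
  apply: ge0_le_integral => //.
  - by apply/measurable_EFinP/measurable_funTS; exact: measurableT_comp.
  - apply: emeasurable_funD => //; apply: measurable_funTS; exact: measurable_ipow.
  - by move=> x _; rewrite -EFinD lee_fin le1D_powR.
rewrite ge0_integralD//; last by apply: measurable_funTS; exact: measurable_ipow.
rewrite lte_add_pinfty//.
  by rewrite integral_cst// mul1e compact_finite_measure.
apply: le_lt_trans (Lp_ipow p1 fp).
by apply: ge0_subset_integral => //; exact: measurable_ipow.
Qed.

(** Since |f| <= 1 + |f|^p, pointwise |f g| <= |g| + M |f|^p. This stands in for Hoelder's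
    inequality and treats p = 1 like the other exponents. *)
Lemma pairing_le f g (G M : R) : f \in Lp -> measurable_fun setT g ->
  (\int[mu]_x `|g x|%:E = G%:E)%E -> (forall x, `|g x| <= M) ->
  (\int[mu]_x `|f x * g x|%:E <= G%:E + M%:E * ipow p f)%E.
Proof.
move=> fp mg gG gM; have mf := Lp_measurable p1 fp.
have M0 : 0 <= M by apply: le_trans (gM 0).
rewrite -gG /ipow -ge0_integralZl//; last exact: measurable_ipow.
rewrite -ge0_integralD//; first last.
- by apply: measurable_funeM; exact: measurable_ipow.
- by move=> x _; rewrite mule_ge0// lee_fin powR_ge0.
- by apply/measurable_EFinP; exact: measurableT_comp.
apply: ge0_le_integral => //.
- by apply/measurable_EFinP; apply: measurableT_comp => //; exact: measurable_funM.
- apply: emeasurable_funD; first by apply/measurable_EFinP; exact: measurableT_comp.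
  by apply: measurable_funeM; exact: measurable_ipow.
- move=> x _; rewrite -EFinM -EFinD lee_fin normrM.
  have := le1D_powR p1 (normr_ge0 (f x)).
  have := gM x; have := normr_ge0 (g x); have := powR_ge0 (`|f x|) p.
  have := normr_ge0 (f x); nra.
Qed.

Lemma good_norm g : good g -> exists2 G : R, 0 <= G & (\int[mu]_x `|g x|%:E = G%:E)%E.
Proof.
move=> [mg /integrableP[_ ig] _]; exists (fine (\int[mu]_x `|g x|%:E)%E).
  by rewrite fine_ge0// integral_ge0.
by rewrite fineK// ge0_fin_numE ?integral_ge0.
Qed.

Lemma pairing_integrable f g : f \in Lp -> good g ->
  mu.-integrable setT (EFin \o (fun x => f x * g x)).
Proof.
move=> fp gg; have mf := Lp_measurable p1 fp.
have [G G0 hG] := good_norm gg; have [mg _ [M hM]] := gg.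
apply/integrableP; split; first by apply/measurable_EFinP; exact: measurable_funM.
rewrite (le_lt_trans (pairing_le fp mg hG hM))// lte_add_pinfty ?ltry//.
rewrite lte_mul_pinfty ?lee_fin ?(Lp_ipow p1)//.
exact: le_trans (hM 0).
Qed.

(** The bound of [pairing_le] is not homogeneous in f. It gives G + M on the unit ball, and scaling
    does the rest. *)
Lemma pairing_bound g : good g -> exists2 K : R, 0 <= K &
  forall f, f \in Lp -> `|\int[mu]_x (f x * g x)| <= K * nm p f.
Proof.
move=> gg; have [G G0 hG] := good_norm gg; have [mg _ [M hM]] := gg.
have M0 : 0 <= M by apply: le_trans (hM 0).
exists (G + M) => [|f fp]; first exact: addr_ge0.
have unit_ball h : h \in Lp -> nm p h <= 1 ->
    `|\int[mu]_x (h x * g x)| <= G + M.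
  move=> hp h1; have ih := pairing_integrable hp gg.
  rewrite -lee_fin EFin_normr_Rintegral//.
  apply: (@le_trans _ _ (\int[mu]_x `|h x * g x|%:E)%E).
    by apply: le_abse_integral => //; case/integrableP: ih.
  rewrite (le_trans (pairing_le hp mg hG hM))// EFinD leeD2l//.
  rewrite -[leRHS]mule1 lee_wpmul2l ?lee_fin// -(nm_powR p1 hp) lee_fin.
  have := @ge0_ler_powR _ p (ltW p0) (nm p h) 1.
  by rewrite !nnegrE nm_ge0 powR1; apply.
have scale (c : R) : \int[mu]_x ((c *: f) x * g x) = c * \int[mu]_x (f x * g x).
  rewrite -RintegralZl//; last exact: pairing_integrable.
  by apply: eq_Rintegral => x _; rewrite mulrA.
have := nm_ge0 p f; rewrite le_eqVlt => /predU1P[f0|f0]; last first.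
  have f1 : nm p ((nm p f)^-1 *: f) <= 1.
    by rewrite (nmZ p1)// ger0_norm ?invr_ge0 ?(ltW f0)// mulVf ?gt_eqF.
  have := unit_ball _ (LpZ p1 _ fp) f1.
  by rewrite scale normrM ger0_norm ?invr_ge0 ?(ltW f0)// mulrC ler_pdivrMr.
rewrite -f0 mulr0; set I := `|_|; have I0 : 0 <= I by rewrite normr_ge0.
rewrite leNgt; apply/negP => Ipos.
(* When f has norm 0 all its multiples lie in the unit ball; this one would have a pairing of size G
   + M + 1. *)
have := unit_ball (((G + M + 1) / I) *: f) (LpZ p1 _ fp).
rewrite (nmZ p1)// -f0 mulr0 ler01 => /(_ isT).
rewrite scale normrM -/I ger0_norm; last by rewrite divr_ge0// !addr_ge0.
by rewrite divfK ?gt_eqF//; lra.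
Qed.

Lemma pairing_cvg (F : nat -> R -> R) f g : (forall i, F i \in Lp) -> f \in Lp ->
  good g -> nm p (F i - f) @[i --> \oo] --> 0 ->
  \int[mu]_x (F i x * g x) @[i --> \oo] --> \int[mu]_x (f x * g x).
Proof.
move=> Fp fp gg hF; have [K K0 hK] := pairing_bound gg.
apply/subr_cvg0; apply: norm_cvg0.
apply: (@squeeze_cvgr _ _ _ _ (cst 0) (fun i => K * nm p (F i - f))).
- apply: nearW => i; rewrite normr_ge0/= (le_trans _ (hK _ (LpB p1 (Fp i) fp)))//.
  rewrite -RintegralB//; [|exact: pairing_integrable..].
  rewrite le_eqVlt; apply/orP; left; apply/eqP; congr `|_|.
  by apply: eq_Rintegral => x _; rewrite -mulrBl.
- exact: cvg_cst.
- by rewrite -[X in _ --> X](mulr0 K); apply: cvgMr.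
Qed.

End FixedExponent.

Lemma good_Lp1 g : good g -> g \in Lfun mu 1%:E.
Proof. by move=> [_ ig _]; apply/Lfun1_integrable. Qed.

Lemma good_lin (c : R) f g : good f -> good g -> good (c *: f + g).
Proof.
move=> [mf jf [M hM]] [mg jg [N hN]]; split.
- by apply: measurable_funD => //; exact: measurable_funM.
- have := integrableD measurableT (integrableZl measurableT c jf) jg.
  by apply: eq_integrable.
- exists (`|c| * M + N) => x.
  rewrite (le_trans (ler_normD _ _))// lerD// normrM ler_wpM2l//.
Qed.

Lemma good0 : good (0 : R -> R).
Proof.
split; first exact: measurable_cst.
- exact: (@integrable0 _ _ _ mu).
- by exists 0 => x; rewrite normr0.
Qed.

Lemma goodZ (c : R) f : good f -> good (c *: f).
Proof. by move=> gf; rewrite -[_ *: _]addr0; apply: good_lin => //; exact: good0. Qed.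

Lemma goodD f g : good f -> good g -> good (f + g).
Proof. by move=> gf gg; rewrite -[f]scale1r; exact: good_lin. Qed.

End Pairing.

(** * Changes of variable by translations and reflections *)

Section Affine.
Variable R : realType.
Implicit Types (f : R -> \bar R).

Local Notation mu := (@lebesgue_measure R).

Lemma measurable_affine (e c : R) :
  measurable_fun setT (fun x : R => c + e * x).
Proof. by apply: measurable_funD => //; exact: measurable_funM. Qed.

(** By uniqueness of Lebesgue measure, intervals ]a, b] suffice. For e = -1 the preimage is closed
    on the left and open on the right, with the same length. *)
Lemma lebesgue_measure_affine (e c : R) (A : set R) : `|e| = 1 -> measurable A ->
  pushforward mu ((fun x => c + e * x) : _ -> measurableTypeR R) A = mu A.
Proof.
move=> e1 mA; have mphi := measurable_affine e c.
apply/esym/lebesgue_measure_unique => //= _ [[a b]] _ <-.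
rewrite /pushforward.
have := e1; rewrite -[in `|e|](mulr1 e); case: (leP 0 e) => e0.
  rewrite mulr1 ger0_norm// => ->.
  rewrite (_ : _ @^-1` _ = `]a - c, b - c]%classic); last first.
    by apply/seteqP; split => x /=; rewrite !in_itv/= => /andP[? ?]; apply/andP; split; lra.
  rewrite !lebesgue_measure_itv/= !lte_fin ltrD2r; case: ifPn => // _.
  by rewrite -!EFinD; congr EFin; lra.
rewrite mulr1 ltr0_norm// => e1'; have -> : e = -1 by lra.
rewrite (_ : _ @^-1` _ = `[c - b, c - a[%classic); last first.
  by apply/seteqP; split => x /=; rewrite !in_itv/= => /andP[? ?]; apply/andP; split; lra.
rewrite !lebesgue_measure_itv/= !lte_fin ltrD2l ltrN2; case: ifPn => // _.
by rewrite -!EFinD; congr EFin; lra.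
Qed.

Lemma ge0_integral_affine (e c : R) f : `|e| = 1 -> measurable_fun setT f ->
  (forall x, (0 <= f x)%E) -> (\int[mu]_x f (c + e * x)%R = \int[mu]_x f x)%E.
Proof.
move=> e1 mf f0; have mphi := measurable_affine e c.
transitivity (\int[pushforward mu ((fun x => c + e * x)%R : _ -> measurableTypeR R)]_y f y)%E.
  by rewrite ge0_integral_pushforward//= => *; rewrite ?preimage_setT.
by apply: eq_measure_integral => A mA _; exact: lebesgue_measure_affine.
Qed.

Lemma integral_affine (e c : R) f : `|e| = 1 -> measurable_fun setT f ->
  (\int[mu]_x f (c + e * x)%R = \int[mu]_x f x)%E.
Proof.
move=> e1 mf; rewrite integralE [RHS]integralE; congr (_ - _)%E.
- have <- := ge0_integral_affine c e1 (measurable_funepos mf) (funepos_ge0 f).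
  by apply: eq_integral => x _; rewrite !funeposE.
- have <- := ge0_integral_affine c e1 (measurable_funeneg mf) (funeneg_ge0 f).
  by apply: eq_integral => x _; rewrite !funenegE.
Qed.

Lemma Rintegral_affine (e c : R) (f : R -> R) : `|e| = 1 -> measurable_fun setT f ->
  \int[mu]_x f (c + e * x) = \int[mu]_x f x.
Proof.
move=> e1 mf; rewrite /Rintegral; congr fine.
by apply: (@integral_affine e c (EFin \o f)) => //; exact/measurable_EFinP.
Qed.

Lemma integrable_affine (e c : R) f : `|e| = 1 -> mu.-integrable setT f ->
  mu.-integrable setT (fun x => f (c + e * x)).
Proof.
move=> e1 /integrableP[mf fi]; apply/integrableP; split.
  apply: (measurableT_comp mf); exact: measurable_affine.
rewrite (@ge0_integral_affine e c (fun x => `|f x|%E))//.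
exact: measurableT_comp.
Qed.

End Affine.

(** * Fubini's theorem for real-valued integrals *)

Section RFubini.
Variable R : realType.

Local Notation mu := (@lebesgue_measure R).

Variable F : R -> R -> R.
Hypothesis mF : measurable_fun setT (fun z : R * R => F z.1 z.2).
Hypothesis iF : (\int[mu]_y \int[mu]_x `|F x y|%:E < +oo)%E.

Let G := fun z : R * R => (F z.1 z.2)%:E.
Let mG : measurable_fun setT G. Proof. exact/measurable_EFinP. Qed.
Let iG : (mu \x mu)%E.-integrable setT G.
Proof. by apply/(integrable21ltyP mu mu mG). Qed.

Lemma Rintegral_sectionE : {ae mu, forall x,
  (\int[mu]_y F x y)%:E = (\int[mu]_y (F x y)%:E)%E}.
Proof.
apply: ae_imp (ae_integrable1 iG) => x ix.
by rewrite /Rintegral fineK//; exact: (integrable_fin_num measurableT).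
Qed.

Lemma measurable_Rintegral_section : measurable_fun setT (fun x => \int[mu]_y F x y).
Proof.
apply: (measurableT_comp (fine_measurable measurableT)).
exact: (measurable_fubini_F iG).
Qed.

End RFubini.

(** The inner real integral agrees with the extended one only where the section is integrable,
    [fine] being arbitrary at infinite values. This is almost everywhere, so the outer integrals
    agree. *)
Lemma RFubini (R : realType) (F : R -> R -> R) :
  let mu := @lebesgue_measure R in
  measurable_fun setT (fun z : R * R => F z.1 z.2) ->
  (\int[mu]_y \int[mu]_x `|F x y|%:E < +oo)%E ->
  \int[mu]_x \int[mu]_y F x y = \int[mu]_y \int[mu]_x F x y.
Proof.
move=> mu mF iF.
have mG : measurable_fun setT (fun z : R * R => (F z.1 z.2)%:E) by exact/measurable_EFinP.
have iG : (mu \x mu)%E.-integrable setT (fun z : R * R => (F z.1 z.2)%:E).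
  by apply/(integrable21ltyP mu mu mG).
have mF' : measurable_fun setT (fun z : R * R => F z.2 z.1).
  rewrite [X in measurable_fun _ X](_ : _ = (fun z => F z.1 z.2) \o (fun z : R * R => (z.2, z.1)))//.
  apply: (measurableT_comp mF).
  by apply: measurable_fun_pair; [exact: measurable_snd|exact: measurable_fst].
have iF' : (\int[mu]_y \int[mu]_x `|F y x|%:E < +oo)%E.
  by apply/(integrable12ltyP mu mu mG).
change (fine (\int[mu]_x (\int[mu]_y F x y)%R%:E)%E =
  fine (\int[mu]_y (\int[mu]_x F x y)%R%:E)%E); congr fine.
transitivity (\int[mu]_x \int[mu]_y (F x y)%:E)%E.
  apply: ae_eq_integral => //.
  - by apply/measurable_EFinP; exact: (measurable_Rintegral_section mF iF).
  - exact: (measurable_fubini_F iG).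
  - by apply: ae_imp (Rintegral_sectionE mF iF) => x h _.
transitivity (\int[mu]_y \int[mu]_x (F x y)%:E)%E; last first.
  apply: ae_eq_integral => //.
  - exact: (measurable_fubini_G iG).
  - by apply/measurable_EFinP; exact: (measurable_Rintegral_section mF' iF').
  - by apply: ae_imp (Rintegral_sectionE mF' iF') => x h _; rewrite h.
exact: (Fubini iG).
Qed.

(** * Convolution with an integrable kernel and Young's inequality *)

Section Convolution.
Variable R : realType.
Implicit Types (f g h k : R -> R) (p e : R).

Local Notation mu := (@lebesgue_measure R).

(* [e = -1] is the convolution, [e = 1] its mirror image. *)
Definition conv e k f : R -> R := fun x => \int[mu]_t (k t * f (x + e * t)).

Lemma measurable_translate2 e f : measurable_fun setT f ->
  measurable_fun setT (fun z : R * R => f (z.1 + e * z.2)).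
Proof.
move=> mf; apply: (measurableT_comp mf).
by apply: measurable_funD => //; apply: measurable_funM.
Qed.

Lemma measurable_kernel e k f : measurable_fun setT k -> measurable_fun setT f ->
  measurable_fun setT (fun z : R * R => k z.2 * f (z.1 + e * z.2)).
Proof.
move=> mk mf; apply: measurable_funM; last exact: measurable_translate2.
exact: (measurableT_comp mk).
Qed.

(** The positive and negative parts of the integrand have measurable partial integrals by Tonelli,
    whether finite or not. *)
Lemma measurable_conv e k f : measurable_fun setT k -> measurable_fun setT f ->
  measurable_fun setT (conv e k f).
Proof.
move=> mk mf; apply: (measurableT_comp (fine_measurable measurableT)).
pose F := fun z : R * R => (k z.2 * f (z.1 + e * z.2))%:E.
have mF : measurable_fun setT F.
  by apply/measurable_EFinP; exact: measurable_kernel.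
rewrite (_ : (fun _ => _) = (fun x => fubini_F mu F^\+ x - fubini_F mu F^\- x)%E).
  apply: emeasurable_funB; apply: measurable_fun_fubini_tonelli_F => //.
  - exact: measurable_funepos.
  - exact: measurable_funeneg.
apply/funext => x; rewrite integralE /fubini_F /=; congr (_ - _)%E.
  by apply: eq_integral => t _; rewrite !funeposE.
by apply: eq_integral => t _; rewrite !funenegE.
Qed.

(** When the extended integral is infinite the real one is 0, so the bound holds at every x. *)
Lemma le_conv e k f x : measurable_fun setT k -> measurable_fun setT f ->
  (`|conv e k f x|%:E <= \int[mu]_t (`|k t| * `|f (x + e * t)|)%:E)%E.
Proof.
move=> mk mf; apply: (@le_trans _ _ `|\int[mu]_t (k t * f (x + e * t))%:E|%E).
  rewrite /conv /Rintegral; case: (\int[mu]_t _)%E => //=; by rewrite leey.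
apply: (le_trans (le_abse_integral _ _ _)) => //.
  apply/measurable_EFinP; apply: measurable_funM => //.
  by apply: (measurableT_comp mf); exact: measurable_affine.
by under eq_integral do rewrite abse_EFin normrM.
Qed.

Lemma ipow_shift p (c : R) f : measurable_fun setT f ->
  ipow p (fun x => f (x + c)) = ipow p f.
Proof.
move=> mf.
have := @ge0_integral_affine R 1 c (fun x => (`|f x| `^ p)%:E) (normr1 _)
  (measurable_ipow p mf).
rewrite /ipow => <-; last by move=> x; rewrite lee_fin powR_ge0.
by apply: eq_integral => x _; rewrite mul1r addrC.
Qed.

Section Young.
Variables (p e : R) (k : R -> R).
Hypothesis p1 : 1 <= p.
Hypothesis ik : mu.-integrable setT (EFin \o k).

Let p0 : 0 < p. Proof. exact: lt_le_trans p1. Qed.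

Let mk : measurable_fun setT k.
Proof. by case/integrableP: ik => /measurable_EFinP. Qed.

Let K := fine (\int[mu]_t `|k t|%:E)%E.

Let KE : (\int[mu]_t `|k t|%:E = K%:E)%E.
Proof.
case/integrableP: ik => _ ik'; rewrite /K fineK// ge0_fin_numE//.
by apply: integral_ge0.
Qed.

Let K0 : 0 <= K. Proof. by rewrite fine_ge0// integral_ge0. Qed.

Let mk' : measurable_fun setT (fun t => `|k t|).
Proof. exact: measurableT_comp. Qed.

(* Jensen's inequality for the measure [`|k t| dt], by Hoelder with the weights
   [`|k| `^ q^-1] and [`|k| `^ p^-1]. *)
Let jensen f : measurable_fun setT f -> (forall x, 0 <= f x) ->
  ((\int[mu]_t (`|k t| * f t)%:E) `^ p <=
   (K `^ (p - 1))%:E * \int[mu]_t (`|k t| * f t `^ p)%:E)%E.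
Proof.
move=> mf f0; move: (p1); rewrite le_eqVlt => /predU1P[<-|p1'].
  rewrite poweRe1; last by apply: integral_ge0 => x _; rewrite lee_fin mulr_ge0.
  rewrite subrr powRr0 mul1e le_eqVlt; apply/orP; left; apply/eqP.
  by apply: eq_integral => x _; rewrite powRr1.
pose q := p / (p - 1).
have q0 : 0 < q by rewrite divr_gt0// subr_gt0.
have pq : p^-1 + q^-1 = 1.
  by rewrite /q invf_div; field; rewrite gt_eqF// subr_gt0.
have qV : q^-1 = 1 - p^-1 by rewrite -pq; lra.
pose f1 t := `|k t| `^ p^-1 * f t; pose f2 t := `|k t| `^ q^-1.
have mf1 : measurable_fun setT f1.
  apply: measurable_funM => //; exact: (measurableT_comp (measurable_powR p^-1)).
have mf2 : measurable_fun setT f2 by exact: (measurableT_comp (measurable_powR q^-1)).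
have f12 t : f1 t * f2 t = `|k t| * f t.
  rewrite /f1 /f2 mulrAC -powRD ?pq ?powRr1//.
  by rewrite oner_eq0.
have := hoelder mu mf1 mf2 p0 q0 pq.
rewrite Lnorm1; under eq_integral => t _.
  rewrite /= f12 ger0_norm ?mulr_ge0//.
  over.
move=> H.
have N1 : 'N[mu]_p%:E[EFin \o f1]%E = ((\int[mu]_t (`|k t| * f t `^ p)%:E) `^ p^-1)%E.
  rewrite unlock; congr (_ `^ _)%E; apply: eq_integral => t _ /=.
  rewrite /f1 ger0_norm ?mulr_ge0 ?powR_ge0// powRM ?powR_ge0//.
  by rewrite -powRrM mulVf ?gt_eqF// powRr1.
have N2 : 'N[mu]_q%:E[EFin \o f2]%E = (K `^ q^-1)%:E.
  rewrite unlock -poweR_EFin -KE; congr (_ `^ _)%E; apply: eq_integral => t _ /=.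
  by rewrite /f2 ger0_norm ?powR_ge0// -powRrM mulVf ?gt_eqF// powRr1.
rewrite N1 N2 in H.
have I1 : (0 <= \int[mu]_t (`|k t| * f t `^ p)%:E)%E.
  by apply: integral_ge0 => x _; rewrite lee_fin mulr_ge0// powR_ge0.
apply: (@le_trans _ _ (((\int[mu]_t (`|k t| * f t `^ p)%:E) `^ p^-1 *
    (K `^ q^-1)%:E) `^ p)%E).
  apply: gt0_ler_poweR => //; first exact: ltW.
  - rewrite in_itv/= leey andbT; apply: integral_ge0 => x _.
    by rewrite lee_fin mulr_ge0.
  - by rewrite in_itv/= leey andbT mule_ge0// ?poweR_ge0// lee_fin powR_ge0.
rewrite poweRM ?poweR_ge0 ?lee_fin ?powR_ge0// -poweRrM mulVf ?gt_eqF//.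
rewrite poweRe1// muleC poweR_EFin -powRrM qV.
by rewrite mulrBl mul1r mulVf ?gt_eqF.
Qed.

(** Jensen at each x gives K^(p-1) times the integral of |k(t)| |f(x + e t)|^p dt. Integrating in x,
    Tonelli and translation invariance contribute the remaining factor K. *)
Lemma young_ipow f : measurable_fun setT f ->
  (ipow p (conv e k f) <= (K `^ p)%:E * ipow p f)%E.
Proof.
move=> mf.
have mf' : measurable_fun setT (fun x => `|f x| `^ p) by exact: measurable_norm_powR.
have step x : ((`|conv e k f x| `^ p)%:E <=
    (K `^ (p - 1))%:E * \int[mu]_t (`|k t| * `|f (x + e * t)| `^ p)%:E)%E.
  rewrite -poweR_EFin; apply: (le_trans _ (jensen _ _)) => //; last first.
    apply: measurableT_comp => //; apply: (measurableT_comp mf).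
    exact: measurable_affine.
  apply: gt0_ler_poweR; first exact: ltW.
  - by rewrite in_itv/= leey andbT.
  - by rewrite in_itv/= leey andbT; apply: integral_ge0 => t _; rewrite lee_fin mulr_ge0.
  - exact: le_conv.
pose G := fun z : R * R => (`|k z.2| * `|f (z.1 + e * z.2)| `^ p)%:E.
have mG : measurable_fun setT G.
  apply/measurable_EFinP; apply: measurable_funM; first exact: (measurableT_comp mk').
  by apply: (@measurable_translate2 e (fun x => `|f x| `^ p)).
have G0 z : (0 <= G z)%E by rewrite lee_fin mulr_ge0// powR_ge0.
apply: (@le_trans _ _ (\int[mu]_x ((K `^ (p - 1))%:E * fubini_F mu G x))%E).
  apply: ge0_le_integral => //.
  - by apply: measurable_ipow; exact: measurable_conv.
  - by apply: measurable_funeM; exact: measurable_fun_fubini_tonelli_F.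
rewrite ge0_integralZl ?lee_fin ?powR_ge0//; last 2 first.
- exact: measurable_fun_fubini_tonelli_F.
- by move=> x _; apply: integral_ge0.
have -> : (\int[mu]_x fubini_F mu G x = \int[mu]_y \int[mu]_x G (x, y))%E.
  exact: fubini_tonelli.
have inner y : (\int[mu]_x G (x, y) = `|k y|%:E * ipow p f)%E.
  rewrite /G/=; under eq_integral do rewrite EFinM.
  have ms : measurable_fun setT (fun x : R => (`|f (x + e * y)| `^ p)%:E).
    by apply: measurable_ipow; apply: (measurableT_comp mf); exact: measurable_funD.
  have s0 x : setT x -> (0 <= (`|f (x + e * y)| `^ p)%:E)%E.
    by rewrite lee_fin powR_ge0.
  rewrite -(ipow_shift p (e * y) mf).
  exact: (ge0_integralZl mu measurableT ms s0 (normr_ge0 (k y) : (0 <= `|k y|%:E)%E)).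
under eq_integral do rewrite inner.
rewrite ge0_integralZr//; last 2 first.
- exact/measurable_EFinP.
- exact: ipow_ge0.
rewrite KE muleA -EFinM lee_wpmul2r ?ipow_ge0// lee_fin.
by rewrite mulrC mulr_powRB1.
Qed.

Lemma young f : f \in Lfun mu p%:E ->
  conv e k f \in Lfun mu p%:E /\ nm p (conv e k f) <= K * nm p f.
Proof.
move=> fp; have mf := Lp_measurable p1 fp.
have cp : conv e k f \in Lfun mu p%:E.
  apply/(mem_LfunP _ p0); split; first exact: measurable_conv.
  rewrite (le_lt_trans (young_ipow mf))// lte_mul_pinfty ?lee_fin ?powR_ge0//.
  exact: Lp_ipow fp.
split=> //; apply: nm_le_powR => //; first by rewrite mulr_ge0// nm_ge0.
by rewrite powRM// ?nm_ge0// EFinM nm_powR//; exact: young_ipow.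
Qed.

End Young.

End Convolution.

(** * Transposition of convolutions *)

Section Duality.
Variable R : realType.
Implicit Types (f g h k : R -> R) (p e : R).

Local Notation mu := (@lebesgue_measure R).

Section Duality_fixed.
Variables (p e : R) (k : R -> R).
Hypothesis p1 : 1 <= p.
Hypothesis ik : mu.-integrable setT (EFin \o k).

Let mk : measurable_fun setT k.
Proof. by case/integrableP: ik => /measurable_EFinP. Qed.

Lemma good_shift (c : R) g : good g -> good (fun x => g (x + c)).
Proof.
move=> [mg ig [M hM]].
have shE : (fun x => g (x + c)) = (fun x => g (c + 1 * x)).
  by apply/funext => x; rewrite mul1r addrC.
split; last by exists M => x; exact: hM.
- by rewrite shE; apply: (measurableT_comp mg); exact: measurable_affine.
- by rewrite shE; apply: (@integrable_affine _ 1 c (EFin \o g)); rewrite ?normr1.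
Qed.

Lemma Lp_shift (c : R) f : f \in Lfun mu p%:E ->
  (fun x => f (x + c)) \in Lfun mu p%:E /\ nm p (fun x => f (x + c)) = nm p f.
Proof.
move=> fp; have mf := Lp_measurable p1 fp.
have ms : measurable_fun setT (fun x : R => f (x + c)).
  by apply: (measurableT_comp mf); exact: measurable_funD.
have E := ipow_shift p c mf.
split; last by rewrite /nm !LpnormE E.
apply/(mem_LfunP _ (lt_le_trans ltr01 p1)); split => //.
by rewrite E (Lp_ipow p1).
Qed.

(** Fubini applies because a bound C uniform in t makes the double integral at most C times the L^1
    norm of k. The bound is left abstract so that either f or g may be the L^p function. *)
Lemma conv_pairing_gen (C : R) f g : measurable_fun setT f -> measurable_fun setT g ->
  (forall t, \int[mu]_x `|f (x + e * t) * g x|%:E <= C%:E)%E ->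
  \int[mu]_x (conv e k f x * g x) =
  \int[mu]_t (k t * \int[mu]_x (f (x + e * t) * g x)).
Proof.
move=> mf mg hC.
have C0 : 0 <= C.
  by rewrite -lee_fin (le_trans _ (hC 0))//; apply: integral_ge0.
have msh t : measurable_fun setT (fun x : R => f (x + e * t)).
  apply: (measurableT_comp mf); exact: measurable_funD.
have mF : measurable_fun setT (fun z : R * R => k z.2 * f (z.1 + e * z.2) * g z.1).
  by apply: measurable_funM; [exact: measurable_kernel|exact: (measurableT_comp mg)].
have iF : (\int[mu]_t \int[mu]_x `|k t * f (x + e * t) * g x|%:E < +oo)%E.
  have m2 : measurable_fun setT (fun z : R * R => (`|k z.2 * f (z.1 + e * z.2) * g z.1|)%:E).
    by apply/measurable_EFinP; exact: measurableT_comp.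
  apply: (@le_lt_trans _ _ (\int[mu]_t (`|k t|%:E * C%:E))%E).
    apply: ge0_le_integral => //.
    - by move=> t _; apply: integral_ge0.
    - exact: (@measurable_fun_fubini_tonelli_G _ _ _ _ _ mu _ m2).
    - apply: emeasurable_funM => //; apply/measurable_EFinP; exact: measurableT_comp.
    - move=> t _.
      have -> : (\int[mu]_x `|k t * f (x + e * t) * g x|%:E =
          `|k t|%:E * \int[mu]_x `|f (x + e * t) * g x|%:E)%E.
        rewrite -ge0_integralZl//.
          by apply: eq_integral => x _; rewrite -mulrA normrM.
        apply/measurable_EFinP; apply: measurableT_comp => //.
        by apply: measurable_funM => //; exact: msh.
      by rewrite lee_wpmul2l.
  rewrite ge0_integralZr//; last by apply/measurable_EFinP; exact: measurableT_comp.
  case/integrableP: ik => _ ik'; rewrite lte_mul_pinfty//.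
  - by apply: integral_ge0.
  - by rewrite ge0_fin_numE//; apply: integral_ge0.
  - by rewrite ltry.
have RF := @RFubini R (fun x t => k t * f (x + e * t) * g x) mF iF.
transitivity (\int[mu]_x \int[mu]_t (k t * f (x + e * t) * g x)).
  change (fine (\int[mu]_x (conv e k f x * g x)%:E)%E =
    fine (\int[mu]_x (\int[mu]_t (k t * f (x + e * t) * g x))%R%:E)%E).
  congr fine; apply: ae_eq_integral => //.
  - by apply/measurable_EFinP; apply: measurable_funM => //; exact: measurable_conv.
  - by apply/measurable_EFinP; exact: (measurable_Rintegral_section mF iF).
  - have iG : (mu \x mu)%E.-integrable setT
        (fun z : R * R => (k z.2 * f (z.1 + e * z.2) * g z.1)%:E).
      by apply/(integrable21ltyP mu mu) => //; exact/measurable_EFinP.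
    apply: ae_imp (ae_integrable1 iG) => x ix _; congr EFin.
    (* Only the section multiplied by [g x] is known to be integrable. Where [g x] vanishes both
       sides are 0; elsewhere one divides by it. *)
    have [g0|g0] := eqVneq (g x) 0.
      rewrite g0 mulr0; apply/esym.
      by under eq_Rintegral do rewrite mulr0; rewrite Rintegral_cst// mul0r.
    rewrite /conv -RintegralZr//.
    have := integrableZr measurableT (g x)^-1 ix; apply: eq_integrable => // t _ /=.
    by rewrite -EFinM mulfK.
rewrite RF; apply: eq_Rintegral => t _.
rewrite -RintegralZl//; first by apply: eq_Rintegral => x _; rewrite mulrA.
apply/integrableP; split.
  by apply/measurable_EFinP; apply: measurable_funM => //; exact: msh.
by rewrite (le_lt_trans (hC t))// ltry.
Qed.

Lemma conv_pairing f g : f \in Lfun mu p%:E -> good g ->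
  \int[mu]_x (conv e k f x * g x) =
  \int[mu]_t (k t * \int[mu]_x (f (x + e * t) * g x)).
Proof.
move=> fp gg; have [G G0 hG] := good_norm gg; have [mg _ [M hM]] := gg.
have mf := Lp_measurable p1 fp.
apply: (@conv_pairing_gen (G + M * nm p f `^ p)) => // t.
have [fsp E] := Lp_shift (e * t) fp.
rewrite (le_trans (pairing_le p1 fsp mg hG hM))//.
by rewrite -(nm_powR p1 fsp) E.
Qed.

(** The roles of f and g in [conv_pairing_gen] are exchanged. The bound is uniform in t because
    translating g changes neither its L^1 norm nor its pointwise bound. *)
Lemma pairing_conv f g : f \in Lfun mu p%:E -> good g ->
  \int[mu]_x (f x * conv e k g x) =
  \int[mu]_t (k t * \int[mu]_x (f x * g (x + e * t))).
Proof.
move=> fp gg; have [mg _ [M hM]] := gg; have mf := Lp_measurable p1 fp.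
have [G G0 hG] := good_norm gg.
transitivity (\int[mu]_x (conv e k g x * f x)).
  by apply: eq_Rintegral => x _; rewrite mulrC.
rewrite (@conv_pairing_gen (G + M * nm p f `^ p))// => [|t].
  by apply: eq_Rintegral => t _; congr (_ * _); apply: eq_Rintegral => x _; rewrite mulrC.
have [msg _ _] := good_shift (e * t) gg.
have hG' : (\int[mu]_x `|g (x + e * t)|%:E = G%:E)%E.
  have := @ge0_integral_affine R 1 (e * t) (fun x => `|g x|%:E) (normr1 _).
  rewrite hG => <- //; last by apply/measurable_EFinP; exact: measurableT_comp.
  by apply: eq_integral => x _; rewrite mul1r addrC.
under eq_integral do rewrite mulrC.
rewrite (le_trans (pairing_le p1 fp msg hG' (fun x => hM _)))//.
by rewrite -(nm_powR p1 fp).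
Qed.

Lemma good_conv g : good g -> good (conv e k g).
Proof.
move=> gg; have [mg _ [M hM]] := gg; have M0 : 0 <= M by apply: le_trans (hM 0).
split; first exact: measurable_conv.
- by apply/Lfun1_integrable; have [] := young e (lexx 1) ik (good_Lp1 gg).
- exists (fine (\int[mu]_t `|k t|%:E)%E * M) => x.
  have iI : (\int[mu]_t `|k t|%:E = (fine (\int[mu]_t `|k t|%:E))%:E)%E.
    case/integrableP: ik => _ ik'; rewrite fineK// ge0_fin_numE//.
    by apply: integral_ge0.
  rewrite -lee_fin (le_trans (le_conv _ _ _ _))// EFinM -iI.
  rewrite -ge0_integralZr//; last by apply/measurable_EFinP; exact: measurableT_comp.
  apply: ge0_le_integral => //.
  - apply/measurable_EFinP; apply: measurable_funM; first exact: measurableT_comp.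
    apply: measurableT_comp => //; apply: (measurableT_comp mg); exact: measurable_affine.
  - apply: emeasurable_funM => //; apply/measurable_EFinP; exact: measurableT_comp.
  - by move=> t _; rewrite -EFinM lee_fin ler_wpM2l.
Qed.

End Duality_fixed.

(** Translating the inner integral by e t moves the shift from f to g with the opposite sign; hence
    left and right are exchanged under duality. *)
Lemma conv_adjoint p e k f g : 1 <= p -> mu.-integrable setT (EFin \o k) ->
  f \in Lfun mu p%:E -> good g ->
  \int[mu]_x (conv e k f x * g x) = \int[mu]_x (f x * conv (- e) k g x).
Proof.
move=> p1 ik fp gg; rewrite (conv_pairing _ p1 ik fp gg) (pairing_conv _ p1 ik fp gg).
apply: eq_Rintegral => t _; congr (_ * _).
have mf := Lp_measurable p1 fp; have [mg _ _] := gg.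
have := @Rintegral_affine R 1 (e * t) (fun x => f x * g (x + - e * t)) (normr1 _).
move=> <-; last first.
  by apply: measurable_funM => //; apply: (measurableT_comp mg); exact: measurable_funD.
by apply: eq_Rintegral => x _; rewrite mul1r addrC; congr (_ * g _); ring.
Qed.


End Duality.

(** * Smooth functions, cutoffs and test functions *)

Section Smooth.
Variable R : realType.
Implicit Types (f g : R -> R) (x : R).

Local Notation isd x f d := (is_derive (x : R) (1 : R) (f : R -> R) (d : R)).

Lemma derive1_of f x (d : R) : isd x f d -> derivable f x 1 /\ derive1 f x = d.
Proof. by move=> df; rewrite derive1E derive_val. Qed.

Lemma is_derive_of f x : derivable f x 1 -> isd x f (derive1 f x).
Proof. by move=> df; apply: DeriveDef; [exact: df|rewrite derive1E]. Qed.

Lemma smooth_derivable f : smooth f -> forall x : R, derivable f x 1.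
Proof. by move=> sf x; have := sf 0%N x. Qed.

Arguments smooth_derivable {f} sf x.

Lemma smooth_derive1 f : smooth f -> smooth (derive1 f).
Proof. by move=> sf n x; have := sf n.+1 x; rewrite derive1Sn. Qed.

Lemma smooth_derive1n n f : smooth f -> smooth (derive1n n f).
Proof. by move=> sf; elim: n => [|n IHn]; [exact: sf|exact (smooth_derive1 IHn)]. Qed.

Arguments smooth_derive1n n {f} sf _ _.

(** A coinduction principle: smoothness of f follows from any class containing f, made of derivable
    functions and stable under derivation. *)
Lemma smooth_closed (P : (R -> R) -> Prop) :
  (forall f, P f -> (forall x : R, derivable f x 1) /\ P (derive1 f)) ->
  forall f, P f -> smooth f.
Proof.
move=> HP f Pf n; have : P (derive1n n f).
  by elim: n => // n IHn; rewrite derive1nS; have [] := HP _ IHn.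
by move=> /HP[].
Qed.

Lemma smooth_continuous f : smooth f -> continuous f.
Proof.
move=> sf x; apply: differentiable_continuous.
exact/derivable1_diffP/smooth_derivable.
Qed.

Arguments smooth_continuous {f} sf x.

Lemma smooth_measurable f : smooth f -> measurable_fun setT f.
Proof. by move=> sf; apply: continuous_measurable_fun; exact: smooth_continuous. Qed.

(** Derivatives of products and inverses are neither products nor inverses, but they stay in this
    algebra, to which [smooth_closed] can be applied. *)
Inductive smooth_alg : (R -> R) -> Prop :=
| alg_smooth f : smooth f -> smooth_alg f
| alg_add f g : smooth_alg f -> smooth_alg g -> smooth_alg (fun x => f x + g x)
| alg_mul f g : smooth_alg f -> smooth_alg g -> smooth_alg (fun x => f x * g x)
| alg_inv f : smooth_alg f -> (forall x, f x != 0) -> smooth_alg (fun x => (f x)^-1).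

Lemma smooth_cst (c : R) : smooth (cst c : R -> R).
Proof.
apply: (smooth_closed (P := fun f => exists c, f = cst c)); last by exists c.
move=> _ [d ->]; split=> [x|]; first exact: derivable_cst.
by exists 0; apply/funext => x; rewrite derive1_cst.
Qed.

Arguments smooth_cst c : clear implicits.

Lemma smooth_algP f : smooth_alg f -> smooth f.
Proof.
apply: smooth_closed => {}f; elim=> {f} [f sf|f g _ [df af] _ [dg ag]|
  f g af' [df af] ag' [dg ag]|f af' [df af] f0].
- by split; [exact: smooth_derivable|exact/alg_smooth/smooth_derive1].
- have H (x : R) : isd x (fun x => f x + g x) (derive1 f x + derive1 g x).
    by apply: is_deriveD; exact: is_derive_of.
  split=> [x|]; first by have [] := derive1_of (H x).
  rewrite (_ : derive1 _ = fun x => derive1 f x + derive1 g x); first exact: alg_add.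
  by apply/funext => x; have [] := derive1_of (H x).
- have H (x : R) : isd x (fun x => f x * g x)
      (f x *: derive1 g x + g x *: derive1 f x).
    by apply: is_deriveM; exact: is_derive_of.
  split=> [x|]; first by have [] := derive1_of (H x).
  rewrite (_ : derive1 _ = fun x => f x * derive1 g x + g x * derive1 f x).
    by apply: alg_add; apply: alg_mul.
  by apply/funext => x; have [] := derive1_of (H x).
- have H (x : R) : isd x (fun x => (f x)^-1) (- (f x) ^- 2 *: derive1 f x).
    by apply: is_deriveV; [exact: f0|exact: is_derive_of].
  split=> [x|]; first by have [] := derive1_of (H x).
  rewrite (_ : derive1 _ =
      fun x => (cst (-1) : R -> R) x * ((f x)^-1 * ((f x)^-1 * derive1 f x))).
    apply: alg_mul; first exact/alg_smooth/smooth_cst.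
    by apply: alg_mul; [exact: alg_inv|apply: alg_mul => //; exact: alg_inv].
  apply/funext => x; have [_ ->] := derive1_of (H x).
  by rewrite /GRing.scale/= /cst expr2 invfM; ring.
Qed.

Lemma smoothM f g : smooth f -> smooth g -> smooth (fun x => f x * g x).
Proof. by move=> sf sg; apply/smooth_algP/alg_mul; exact: alg_smooth. Qed.

Lemma smoothD f g : smooth f -> smooth g -> smooth (fun x => f x + g x).
Proof. by move=> sf sg; apply/smooth_algP/alg_add; exact: alg_smooth. Qed.


Lemma smooth_lin (c : R) f g : smooth f -> smooth g -> smooth (c *: f + g).
Proof.
move=> sf sg.
have h : smooth (fun x => c * f x) by exact (smoothM (smooth_cst c) sf).
exact (smoothD h sg).
Qed.

Arguments smooth_lin c {f g} sf sg _ _.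

Lemma derive1_lin (c : R) f g : smooth f -> smooth g ->
  derive1 (c *: f + g) = c *: derive1 f + derive1 g.
Proof.
move=> sf sg; apply/funext => x.
have df := is_derive_of (smooth_derivable sf x).
have dg := is_derive_of (smooth_derivable sg x).
have dcf : isd x (c *: f) (c *: derive1 f x) by exact: is_deriveZ.
by have [_ ->] := derive1_of (is_deriveD dcf dg).
Qed.

Lemma derive1n_lin n (c : R) f g : smooth f -> smooth g ->
  derive1n n (c *: f + g) = c *: derive1n n f + derive1n n g.
Proof.
move=> sf sg; elim: n => [//|n IHn].
have := derive1_lin c (smooth_derive1n n sf) (smooth_derive1n n sg).
by rewrite -IHn.
Qed.
Lemma derive1M f g : smooth f -> smooth g ->
  derive1 (fun x => f x * g x) = (fun x => derive1 f x * g x + f x * derive1 g x).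
Proof.
move=> sf sg; apply/funext => x.
have H : isd x (fun x => f x * g x) (f x *: derive1 g x + g x *: derive1 f x).
  by apply: is_deriveM; apply: is_derive_of; apply: smooth_derivable.
by have [_ ->] := derive1_of H; rewrite /GRing.scale/=; ring.
Qed.

Lemma is_derive_affine f (c e : R) x : smooth f ->
  isd x (fun x => f (c + e * x)) (e * derive1 f (c + e * x)).
Proof.
move=> sf; rewrite mulrC.
have dg : isd x (fun x => c + e * x) e.
  rewrite -[X in is_derive _ _ _ X]add0r; apply: is_deriveD.
  by rewrite -[X in is_derive _ _ _ X]mulr1; apply: is_deriveZ.
exact (@is_derive1_comp R f (fun x => c + e * x) x _ _
  (is_derive_of (smooth_derivable sf (c + e * x))) dg).
Qed.

Lemma smooth_affine f (c e : R) : smooth f -> smooth (fun x => f (c + e * x)).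
Proof.
move=> sf.
apply: (smooth_closed (P := fun g => exists2 h, smooth h &
   exists d, g = fun x => d * h (c + e * x))); last first.
  by exists f => //; exists 1; apply/funext => x; rewrite mul1r.
move=> _ [h sh [d ->]].
have H (x : R) : isd x (fun x => d * h (c + e * x)) (d *: (e * derive1 h (c + e * x))).
  by apply: is_deriveZ; exact (is_derive_affine c e x sh).
split=> [x|]; first by have [] := derive1_of (H x).
exists (derive1 h); first exact (smooth_derive1 sh).
by exists (d * e); apply/funext => x; have [_ ->] := derive1_of (H x); rewrite /GRing.scale/= mulrA.
Qed.

Arguments smooth_affine {f} c e sf _ _.

Lemma derive1n_affine n f (c e : R) : smooth f ->
  derive1n n (fun x => f (c + e * x)) = (fun x => e ^+ n * derive1n n f (c + e * x)).
Proof.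
move=> sf; elim: n => [|n IHn]; first by apply/funext => x; rewrite expr0 mul1r.
apply/funext => x.
have H : isd x (fun x => e ^+ n * derive1n n f (c + e * x))
    (e ^+ n *: (e * derive1 (derive1n n f) (c + e * x))).
  by apply: is_deriveZ; exact (is_derive_affine c e x (smooth_derive1n n sf)).
have [_ HE] := derive1_of H.
by rewrite -[LHS]/(derive1 (derive1n n _) x) IHn HE /GRing.scale/= mulrA exprSr.
Qed.

(* The linear span of these functions is stable under derivation. *)
Definition flat n : R -> R := fun x => if 0 < x then x ^- n * expR (- x^-1) else 0.

(** For y = 1/x > 0, the exponential series gives exp(y) >= y^(n+2) / (n+2)!. The exponent 2 leaves
    a factor x in the difference quotient at 0. *)
Lemma flat_bound n (x : R) : `|flat n x| <= (n.+2)`!%:R * x ^+ 2.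
Proof.
rewrite /flat; case: ifPn => x0; last first.
  by rewrite normr0 mulr_ge0 ?sqr_ge0.
rewrite ger0_norm ?mulr_ge0 ?expR_ge0 ?invr_ge0 ?exprn_ge0 ?(ltW x0)// expRN.
have h := @expR_ge1Dxn R x^-1 n.+1 _.
have {}h : (x^-1) ^+ n.+2 / n.+2`!%:R <= expR x^-1.
  by rewrite (le_trans _ (h _)) ?lerDr ?invr_ge0// ltW.
rewrite ler_pdivrMr ?expR_gt0//.
have f0 : (0 : R) < n.+2`!%:R by rewrite ltr0n fact_gt0.
rewrite (le_trans _ (ler_wpM2l _ h))//; last by rewrite mulr_ge0 ?sqr_ge0// ltW.
rewrite le_eqVlt; apply/orP; left; apply/eqP.
rewrite exprVn -[in RHS]addn2 exprD; field.
by rewrite !gt_eqF ?exprn_gt0.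
Qed.

Lemma is_derive_flat n x : isd x (flat n) (- n%:R * flat n.+1 x + flat n.+2 x).
Proof.
case: (ltgtP x 0) => [x0|x0|->].
- have -> : - n%:R * flat n.+1 x + flat n.+2 x = 0.
    by rewrite /flat (lt_gtF x0) mulr0 addr0.
  apply: (@near_eq_is_derive _ _ _ (cst 0)).
  near=> y; rewrite /flat ifF//; apply/negbTE; rewrite -leNgt ltW//.
  by near: y; exact: lt_nbhsl.
- apply: (@near_eq_is_derive _ _ _ (fun x => x ^- n * expR (- x^-1))).
    near=> y; rewrite /flat ifT//.
    by near: y; exact: lt_nbhsr.
  have x0' : x != 0 by rewrite gt_eqF.
  have dV : isd x (fun x => x^-1) (- x ^- 2 *: 1) by apply: is_deriveV.
  have dVn : isd x ((fun x => x^-1) ^+ n) ((n%:R * x^-1 ^+ n.-1) *: (- x ^- 2 *: 1)).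
    exact: is_deriveX.
  have dVn' : isd x (fun x => x ^- n) ((n%:R * x^-1 ^+ n.-1) *: (- x ^- 2 *: 1)).
    rewrite (_ : (fun x => x ^- n) = (fun x => x^-1) ^+ n)//.
    by apply/funext => y; rewrite fctE/= exprVn.
  have dN : isd x (fun x => - x^-1) (- (- x ^- 2 *: 1)) by apply: is_deriveN.
  have dE := @is_derive1_comp R expR (fun x => - x^-1) x _ _ (is_derive_expR _) dN.
  apply: (is_derive_eq (is_deriveM dVn' dE)).
  rewrite /flat x0 /GRing.scale/= !mulr1 opprK.
  rewrite -!exprVn; set y := x^-1; set E := expR _.
  case: n {dVn dVn'} => [|n] /=; first by rewrite !expr0; ring.
  by rewrite !exprS expr0; ring.
- have flat0 k : flat k 0 = 0 by rewrite /flat ltxx.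
  rewrite !flat0 mulr0 addr0.
  (* By [flat_bound] the quotient is at most (n+2)! |h|. *)
  have H : (h^-1 *: ((flat n \o shift 0) (h *: 1) - flat n 0)) @[h --> 0^'] --> (0 : R).
    apply/cvgr0Pnorm_lt => d d0; near=> h.
    have h0 : h != 0 by near: h; exact: nbhs_dnbhs_neq.
    have f0 : (0 : R) < n.+2`!%:R by rewrite ltr0n fact_gt0.
    have hd : `|h| < d / n.+2`!%:R.
      by near: h; apply: dnbhs0_lt; rewrite divr_gt0.
    rewrite /= flat0 subr0 addr0 /GRing.scale/= mulr1 normrM normfV.
    rewrite (le_lt_trans (ler_wpM2l _ (flat_bound n h)))// ?invr_ge0//.
    rewrite ltr_pdivlMr// in hd.
    by rewrite -[h ^+ 2]real_normK ?num_real// expr2 mulrCA mulKf ?normr_eq0// mulrC.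
  by apply: DeriveDef; [exact: cvgP H|exact: cvg_lim H].
Unshelve. all: by end_near.
Qed.

Lemma smooth_flat n : smooth (flat n).
Proof.
apply: (smooth_closed (P := fun f => exists s : seq (R * nat),
  f = fun x => \sum_(i <- s) i.1 * flat i.2 x)); last first.
  by exists [:: (1, n)]; apply/funext => x; rewrite big_seq1 mul1r.
move=> f [s sE].
have [t Ht] : exists t : seq (R * nat), forall x, isd x f (\sum_(i <- t) i.1 * flat i.2 x).
  rewrite {f}sE; elim: s => [|[c k] s [t IHt]].
    exists [::] => x; rewrite big_nil.
    rewrite (_ : (fun _ => _) = cst 0); first exact: is_derive_cst.
    by apply/funext => y; rewrite big_nil.
  exists [:: (- c * k%:R, k.+1), (c, k.+2) & t] => x; rewrite !big_cons/=.
  rewrite (_ : (fun _ => _) = c *: flat k + fun x => \sum_(i <- s) i.1 * flat i.2 x); last first.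
    by apply/funext => y; rewrite big_cons.
  apply: (is_derive_eq (is_deriveD (is_deriveZ c (is_derive_flat k x)) (IHt x))).
  by rewrite /GRing.scale/=; ring.
split=> [x|]; first by have [] := derive1_of (Ht x).
by exists t; apply/funext => x; have [_ ->] := derive1_of (Ht x).
Qed.

Lemma flat0_ge0 x : 0 <= flat 0 x.
Proof. by rewrite /flat; case: ifP => // _; rewrite expr0 invr1 mul1r expR_ge0. Qed.

Lemma flat0_gt0 x : 0 < x -> 0 < flat 0 x.
Proof. by rewrite /flat => ->; rewrite expr0 invr1 mul1r expR_gt0. Qed.

Lemma flat0_eq0 x : x <= 0 -> flat 0 x = 0.
Proof. by rewrite /flat leNgt => /negbTE ->. Qed.

(** With F = [flat 0], the function h(x) = F(x) / (F(x) + F(1 - x)) is a smooth step from 0 on x <=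
    0 to 1 on x >= 1; its denominator never vanishes. The cutoff is h(2 + x) h(2 - x). *)
Lemma cutoff_exists : exists chi : R -> R, [/\ smooth chi, forall x, 0 <= chi x <= 1,
  forall x, `|x| <= 1 -> chi x = 1 & forall x, 2 <= `|x| -> chi x = 0].
Proof.
pose d x := flat 0 x + flat 0 (1 + -1 * x).
have d0 x : 0 < d x.
  have [x0|x0] := leP x 0.
    by rewrite ltr_wpDl ?flat0_ge0// flat0_gt0//; lra.
  by rewrite ltr_pwDl ?flat0_ge0// flat0_gt0.
pose h x := flat 0 x * (d x)^-1.
have sh : smooth h.
  apply: smooth_algP; apply: alg_mul; first by apply: alg_smooth; exact: smooth_flat.
  apply: alg_inv => [|x]; last by rewrite gt_eqF.
  apply: alg_add; apply: alg_smooth; first exact: smooth_flat.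
  by apply: smooth_affine; exact: smooth_flat.
have h0 x : x <= 0 -> h x = 0 by move=> x0; rewrite /h flat0_eq0// mul0r.
have h1 x : 1 <= x -> h x = 1.
  move=> x1; have := d0 x; rewrite /h /d [X in _ + X]flat0_eq0 ?addr0; last lra.
  by move=> ?; rewrite mulfV// gt_eqF.
have h01 x : 0 <= h x <= 1.
  rewrite /h divr_ge0 ?flat0_ge0 ?(ltW (d0 x))//= ler_pdivrMr// mul1r lerDl.
  exact: flat0_ge0.
exists (fun x => h (2 + 1 * x) * h (2 + -1 * x)); split.
- by apply: smoothM; exact: smooth_affine.
- move=> x; have /andP[a b] := h01 (2 + 1 * x); have /andP[a' b'] := h01 (2 + -1 * x).
  by rewrite mulr_ge0//= mulr_ile1.
- by move=> x; rewrite ler_norml => /andP[? ?]; rewrite !h1 ?mulr1//; lra.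
- move=> x; rewrite ler_normr => /orP[x2|x2].
    by rewrite [X in _ * X]h0 ?mulr0//; lra.
  by rewrite h0 ?mul0r//; lra.
Qed.

Lemma Cinfty0P f : Cinfty0 f <-> smooth f /\
  exists M : R, forall x, M <= `|x| -> f x = 0.
Proof.
split=> [[sf cf]|[sf [M hM]]]; split => //.
  have [M [_ hM]] := compact_bounded cf.
  exists (`|M| + 2) => x xM; apply/eqP/negPn/negP => fx0.
  have := hM (`|M| + 1) _ x; rewrite ltr_pwDr ?ler_norm// => /(_ isT) /=.
  have cx : closure [set x | f x != 0] x by apply: subset_closure.
  by move=> /(_ cx); rewrite leNgt => /negP; apply; lra.
apply: (subclosed_compact _ (@segment_compact _ (- M) M)); first exact: closed_closure.
have cl : closed (`[- M, M]%classic : set R) by exact: interval_closed.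
rewrite ((closure_id _).1 cl).
apply: closure_subset => x /= fx0; rewrite in_itv/= -ler_norml leNgt.
by apply/negP => /ltW/hM fx; rewrite fx eqxx in fx0.
Qed.

(** The strict inequality describes an open set, so f vanishes near each of its points. *)
Lemma derive1n_supp n f (M : R) : (forall x, M <= `|x| -> f x = 0) ->
  forall x, M < `|x| -> derive1n n f x = 0.
Proof.
move=> hM; elim: n => [x /ltW/hM//|n IHn] x xM.
rewrite derive1nS derive1E (near_eq_derive (g := cst 0)) ?derive_cst//.
near=> y; apply: IHn.
by near: y; apply: (cvgr_gt `|x|) => //; exact: norm_continuous.
Unshelve. all: by end_near.
Qed.

Lemma Cinfty0_smooth f : Cinfty0 f -> smooth f.
Proof. by case. Qed.

Lemma Cinfty0_derive1n n f : Cinfty0 f -> Cinfty0 (derive1n n f).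
Proof.
move=> /Cinfty0P[sf [M hM]]; apply/Cinfty0P; split; first exact (smooth_derive1n n sf).
exists (M + 1) => x xM; apply: (derive1n_supp n hM).
by rewrite (lt_le_trans _ xM)// ltrDl.
Qed.

Lemma Cinfty0_affine f (c e : R) : `|e| = 1 -> Cinfty0 f ->
  Cinfty0 (fun x => f (c + e * x)).
Proof.
move=> e1 /Cinfty0P[sf [M hM]]; apply/Cinfty0P; split; first exact (smooth_affine c e sf).
exists (M + `|c|) => x xM; apply: hM.
have : `|e * x| <= `|c + e * x| + `|c|.
  by rewrite -[X in `|X| <= _](addKr c) (le_trans (ler_normD _ _))// normrN addrC.
by rewrite normrM e1 mul1r; lra.
Qed.

Lemma Cinfty0_lin (c : R) f g : Cinfty0 f -> Cinfty0 g -> Cinfty0 (c *: f + g).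
Proof.
move=> /Cinfty0P[sf [M hM]] /Cinfty0P[sg [N hN]]; apply/Cinfty0P; split.
  exact (smooth_lin c sf sg).
exists (Num.max M N) => x; rewrite ge_max => /andP[xM xN].
by rewrite -[LHS]/(c * f x + g x) hM// hN// addr0 mulr0.
Qed.

Lemma Cinfty0M f g : smooth f -> Cinfty0 g -> Cinfty0 (fun x => f x * g x).
Proof.
move=> sf /Cinfty0P[sg [M hM]]; apply/Cinfty0P; split; first exact (smoothM sf sg).
by exists M => x xM; rewrite hM// mulr0.
Qed.

Lemma Cinfty0_side_of s f : Cinfty0 f -> Cinfty0_side s f.
Proof.
move=> /Cinfty0P[sf [M hM]]; case: s; split => //.
  by exists M => x xM; apply: hM; rewrite (le_trans (ltW xM))// ler_norm.
by exists (- M) => x xM; apply: hM; rewrite ler_normr; apply/orP; right; lra.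
Qed.

Lemma Cinfty0_bounded f : Cinfty0 f -> exists2 C : R, 0 <= C & forall x, `|f x| <= C.
Proof.
move=> /Cinfty0P[sf [M hM]].
pose N := `|M|.
have cf : {within `[- N, N], continuous (fun x => `|f x|)}.
  apply: continuous_subspaceT => x; apply: continuous_comp; last exact: norm_continuous.
  exact (smooth_continuous sf x).
have [|c _ hc] := EVT_max _ cf; first by rewrite /N; have := normr_ge0 M; lra.
exists `|f c| => // x; have [xM|xM] := leP M `|x|; first by rewrite hM ?normr0.
by apply: hc; rewrite in_itv/= -ler_norml (le_trans (ltW xM))// ler_norm.
Qed.

End Smooth.

Arguments smooth_derivable {R f} sf x.
Arguments smooth_derive1n {R} n {f} sf _ _.
Arguments smooth_continuous {R f} sf x.
Arguments smooth_affine {R f} c e sf _ _.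
Arguments smooth_lin {R} c {f g} sf sg _ _.
Arguments smooth_cst {R} c _ _.

(** * Convolution with test functions and integration by parts *)

Section SmoothConvolution.
Variable R : realType.
Implicit Types (f g F K phi : R -> R) (e : R).

Local Notation mu := (@lebesgue_measure R).
Local Notation isd x f d := (is_derive (x : R) (1 : R) (f : R -> R) (d : R)).

Lemma integrable_itv_patch (f : R -> R) (N : R) :
  mu.-integrable `[- N, N] (EFin \o f) ->
  mu.-integrable setT (EFin \o (f \_ `[- N, N])).
Proof.
by move=> h; rewrite -restrict_EFin; apply/integrable_restrict => //=; rewrite setTI.
Qed.

Lemma good_Cinfty0 phi : Cinfty0 phi -> good phi.
Proof.
move=> cphi; have sphi := Cinfty0_smooth cphi; split.
- exact (smooth_measurable sphi).
- have [_ [M hM]] := (Cinfty0P phi).1 cphi.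
  have := @integrable_itv_patch phi `|M|.
  have -> : phi \_ `[- `|M|, `|M|] = phi.
    apply/funext => x; rewrite patchE; case: ifPn => //.
    rewrite notin_setE /= in_itv/= -ler_norml => /negP; rewrite -ltNge => h.
    by rewrite hM// (le_trans (ler_norm _))// ltW.
  apply; apply: continuous_compact_integrable; first exact: segment_compact.
  by apply: continuous_subspaceT => x; exact: smooth_continuous.
- by have [C _ hC] := Cinfty0_bounded cphi; exists C.
Qed.

Lemma locally_integrable_abs_patch F (N : R) : locally_integrable setT F ->
  mu.-integrable setT (EFin \o ((fun t => `|F t|) \_ `[- N, N])).
Proof.
move=> [mF _ lF]; apply: integrable_itv_patch; apply/integrableP; split.
  by apply/measurable_EFinP/measurable_funTS; exact: measurableT_comp.
under eq_integral do rewrite /= normr_id.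
by apply: lF => //; exact: segment_compact.
Qed.

Section DeriveConv.
Variables (e : R) (F : R -> R).
Hypothesis e1 : `|e| = 1.
Hypothesis lF : locally_integrable setT F.

(** If |y - x| <= 1 and [K (y + e * t)] is nonzero, then |t| <= M + |x| + 1. One integrable majorant
    thus serves a whole neighbourhood of x. *)
Let dominated K (x : R) : Cinfty0 K -> exists C N : R, [/\ 0 <= C &
  forall y t, `|y - x| <= 1 ->
  `|F t * K (y + e * t)| <= C * ((fun t => `|F t|) \_ `[- N, N]) t].
Proof.
move=> cK; have [C C0 hC] := Cinfty0_bounded cK.
have [_ [M hM]] := (Cinfty0P K).1 cK.
exists C, (M + `|x| + 1); split=> // y t yx; rewrite patchE.
case: ifPn => [_|]; first by rewrite normrM mulrC ler_wpM2r.
rewrite notin_setE /= in_itv/= -ler_norml => /negP; rewrite -ltNge => h.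
rewrite hM ?mulr0 ?normr0//.
have : `|e * t| <= `|y + e * t| + `|y|.
  by rewrite -[X in `|X| <= _](addKr y) (le_trans (ler_normD _ _))// normrN addrC.
have : `|y| <= `|y - x| + `|x| by rewrite -[X in `|X| <= _](subrK x) ler_normD.
by rewrite normrM e1 mul1r; lra.
Qed.

Lemma integrable_conv_kernel K (x : R) : Cinfty0 K ->
  mu.-integrable setT (EFin \o (fun t => F t * K (x + e * t))).
Proof.
move=> cK; have [C [N [C0 hCN]]] := dominated x cK.
have [mF _ _] := lF.
apply: (le_integrable measurableT _ _
    (integrableZl measurableT C (locally_integrable_abs_patch N lF))).
  apply/measurable_EFinP; apply: measurable_funM => //.
  apply: (measurableT_comp (smooth_measurable (Cinfty0_smooth cK))).
  exact: measurable_affine.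
move=> t _ /=; rewrite lee_fin [leRHS]ger0_norm.
  by apply: hCN; rewrite subrr normr0.
by rewrite mulr_ge0// patchE; case: ifP.
Qed.

(** Differentiation under the integral on ]x - 1, x + 1[. Only local integrability of F is required,
    so that F may be a function of L^p to be mollified or the kernel of the fractional integral. *)
Lemma is_derive_conv K x : Cinfty0 K ->
  isd x (conv e F K) (conv e F (derive1 K) x).
Proof.
move=> cK; have cK' := Cinfty0_derive1n 1 cK.
have sK := Cinfty0_smooth cK.
have [C [N [C0 hCN]]] := dominated x cK'.
pose G t := C * ((fun t => `|F t|) \_ `[- N, N]) t.
pose f (x t : R) := F t * K (x + e * t).
have df (y t : R) : isd y (f ^~ t) (F t * derive1 K (y + e * t)).
  have -> : f ^~ t = F t *: (fun y => K (e * t + 1 * y)).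
    by apply/funext => z; rewrite /f -[RHS]/(F t * K (e * t + 1 * z)) mul1r addrC.
  apply: (is_derive_eq (is_deriveZ (F t) (is_derive_affine (e * t) 1 y sK))).
  by rewrite !mul1r addrC.
have Ix : `](x - 1), (x + 1)[%classic x by rewrite /= in_itv/=; apply/andP; split; lra.
have intf y : `](x - 1), (x + 1)[%classic y -> mu.-integrable setT (EFin \o f y).
  by move=> _; exact: integrable_conv_kernel.
have der y t : `](x - 1), (x + 1)[%classic y -> setT t -> derivable (f ^~ t) y 1.
  by move=> _ _; have [] := derive1_of (df y t).
have G0 t : 0 <= G t by rewrite mulr_ge0// patchE; case: ifP.
have iG : mu.-integrable setT (EFin \o G).
  exact: (integrableZl measurableT C (locally_integrable_abs_patch N lF)).
have bG y t : `](x - 1), (x + 1)[%classic y -> setT t -> `|partial1of2 f y t| <= G t.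
  rewrite /= in_itv/= => /andP[y1 y2] _; rewrite /partial1of2.
  have [_ ->] := derive1_of (df y t); apply: hCN.
  by rewrite ler_norml; apply/andP; split; lra.
apply: DeriveDef.
  exact: (derivable_under_integral measurableT Ix intf der G0 iG bG).
rewrite -derive1E (differentiation_under_integral measurableT Ix intf der G0 iG bG).
by apply: eq_Rintegral => t _; rewrite /partial1of2; have [_ ->] := derive1_of (df x t).
Qed.

Lemma derive1_conv K : Cinfty0 K -> derive1 (conv e F K) = conv e F (derive1 K).
Proof.
by move=> cK; apply/funext => x; have [_ ->] := derive1_of (is_derive_conv x cK).
Qed.

Lemma derive1n_conv n K : Cinfty0 K -> derive1n n (conv e F K) = conv e F (derive1n n K).
Proof.
move=> cK; elim: n => [//|n IHn].
rewrite -[LHS]/(derive1 (derive1n n _)) IHn derive1_conv//.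
exact: Cinfty0_derive1n.
Qed.

Lemma smooth_conv K : Cinfty0 K -> smooth (conv e F K).
Proof.
move=> cK.
apply: (smooth_closed (P := fun f => exists2 K, Cinfty0 K & f = conv e F K)); last first.
  by exists K.
move=> _ [J cJ ->]; split=> [x|]; first by have [] := derive1_of (is_derive_conv x cJ).
by exists (derive1 J); [exact: (Cinfty0_derive1n 1 cJ)|exact: derive1_conv].
Qed.

End DeriveConv.

Lemma Rintegral_derive1_eq0 f : Cinfty0 f -> \int[mu]_x derive1 f x = 0.
Proof.
move=> cf; have [sf [M hM]] := (Cinfty0P f).1 cf.
have cf' := Cinfty0_derive1n 1 cf; have sf' := Cinfty0_smooth cf'.
(* The added 1 gives the strict inequality under which [derive1 f] is known to vanish. *)
pose N := `|M| + 1.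
have N0 : - N < N by rewrite /N; have := normr_ge0 M; lra.
have MN x : N <= `|x| -> M < `|x|.
  by rewrite /N; have := ler_norm M; lra.
rewrite (_ : \int[mu]_x _ = \int[mu]_(x in `[- N, N]) derive1 f x); last first.
  rewrite [RHS]Rintegral_mkcond; apply: eq_Rintegral => x _; rewrite patchE.
  case: ifPn => //; rewrite notin_setE /= in_itv/= -ler_norml => /negP; rewrite -ltNge => /ltW/MN.
  exact: (derive1n_supp 1 hM).
rewrite /Rintegral (@continuous_FTC2 _ (derive1 f) f)//.
- have NN : `|N| = N by rewrite ger0_norm// addr_ge0.
  have fN : f N = 0 by apply: hM; apply/ltW/MN; rewrite NN.
  have fN' : f (- N) = 0 by apply: hM; apply/ltW/MN; rewrite normrN NN.
  by rewrite fN fN' -EFinB subrr.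
- by apply: continuous_subspaceT => x; exact: smooth_continuous.
- split.
  + by move=> x _; exact: smooth_derivable.
  + by apply: cvg_at_right_filter; exact: smooth_continuous.
  + by apply: cvg_at_left_filter; exact: smooth_continuous.
Qed.

Lemma by_parts f phi : smooth f -> Cinfty0 phi ->
  \int[mu]_x (derive1 f x * phi x) = - \int[mu]_x (f x * derive1 phi x).
Proof.
move=> sf cphi; have sphi := Cinfty0_smooth cphi.
have sf' := smooth_derive1 sf.
have cphi' := Cinfty0_derive1n 1 cphi.
have [_ i1 _] := good_Cinfty0 (Cinfty0M sf' cphi).
have [_ i2 _] := good_Cinfty0 (Cinfty0M sf cphi').
apply/eqP; rewrite -addr_eq0 -RintegralD//; apply/eqP.
rewrite -(Rintegral_derive1_eq0 (Cinfty0M sf cphi)).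
by rewrite derive1M.
Qed.

Lemma by_partsn n f phi : smooth f -> Cinfty0 phi ->
  \int[mu]_x (derive1n n f x * phi x) = (-1) ^+ n * \int[mu]_x (f x * derive1n n phi x).
Proof.
elim: n f phi => [|n IHn] f phi sf cphi; first by rewrite expr0 mul1r.
have cphi' := Cinfty0_derive1n 1 cphi.
transitivity (- \int[mu]_x (derive1n n f x * derive1 phi x)).
  exact (by_parts (smooth_derive1n n sf) cphi).
rewrite IHn// exprS mulN1r mulNr; congr (- (_ * _)).
by rewrite derive1Sn.
Qed.

End SmoothConvolution.

(** * Weak derivatives for an abstract operator on test functions; mollifiers *)

Section WeakDerivatives.
Variable R : realType.
Implicit Types (u v w f g phi : R -> R) (T : (R -> R) -> R -> R) (e p : R).

Local Notation mu := (@lebesgue_measure R).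

Lemma conv_comm f g : measurable_fun setT f -> measurable_fun setT g ->
  conv (-1) f g = conv (-1) g f.
Proof.
move=> mf mg; apply/funext => x; rewrite /conv.
have := @Rintegral_affine R (-1) x (fun t => f t * g (x + -1 * t)).
rewrite normrN1 => <- //; last first.
  by apply: measurable_funM => //; apply: (measurableT_comp mg); exact: measurable_affine.
by apply: eq_Rintegral => t _; rewrite mulrC; congr (g _ * _); ring.
Qed.

(** One notion for the ordinary derivatives and for the fractional ones, whose values on test
    functions need not have compact support. *)
Definition admissible T :=
  (forall phi, Cinfty0 phi -> good (T phi)) /\
  (forall phi (c : R), Cinfty0 phi ->
     T (fun y => phi (c + 1 * y)) = fun x => T phi (c + 1 * x)).

Lemma admissible_derive1n n : admissible (@derive1n R R n).
Proof.
split=> [phi cphi|phi c cphi]; first by apply: good_Cinfty0; exact: Cinfty0_derive1n.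
rewrite derive1n_affine; last exact: Cinfty0_smooth.
by apply/funext => x; rewrite expr1n mul1r.
Qed.

Section FixedExponent.
Variable p : R.
Hypothesis p1 : 1 <= p.

Local Notation Lp := (Lfun mu p%:E).

Lemma pairing_lin (c : R) u v g : u \in Lp -> v \in Lp -> good g ->
  \int[mu]_x ((c *: u + v) x * g x) =
  c * \int[mu]_x (u x * g x) + \int[mu]_x (v x * g x).
Proof.
move=> up vp gg.
have iu := pairing_integrable p1 up gg; have iv := pairing_integrable p1 vp gg.
have icu := integrableZl measurableT c iu.
rewrite -(RintegralZl _ measurableT iu) -RintegralD//.
by apply: eq_Rintegral => x _; rewrite -[X in X * _]/(c * u x + v x) mulrDl mulrA.
Qed.

Lemma is_weak_lin T k (c : R) u v u' v' : admissible T ->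
  u \in Lp -> v \in Lp -> u' \in Lp -> v' \in Lp ->
  is_weak k T u v -> is_weak k T u' v' -> is_weak k T (c *: u + u') (c *: v + v').
Proof.
move=> [gT _] up vp up' vp' [_ H] [_ H']; split.
  by apply: (Lp_locally_integrable p1); exact: Lp_lin.
move=> phi cphi; have gphi := good_Cinfty0 cphi; have gTphi := gT _ cphi.
by rewrite !pairing_lin// H// H'//; ring.
Qed.

Lemma is_weak_lim T k (U V : nat -> R -> R) u v : admissible T ->
  (forall i, U i \in Lp) -> (forall i, V i \in Lp) -> u \in Lp -> v \in Lp ->
  nm p (U i - u) @[i --> \oo] --> 0 -> nm p (V i - v) @[i --> \oo] --> 0 ->
  (forall i, is_weak k T (U i) (V i)) -> is_weak k T u v.
Proof.
move=> [gT _] Up Vp up vp cU cV H; split; first exact: Lp_locally_integrable vp.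
move=> phi cphi; have gphi := good_Cinfty0 cphi; have gTphi := gT _ cphi.
have c1 := pairing_cvg p1 Vp vp gphi cV.
have c2 := pairing_cvg p1 Up up gTphi cU.
rewrite -(cvg_lim _ c1)//; apply/cvg_lim => //.
under eq_fun do rewrite (proj2 (H _) phi cphi).
exact: cvgMr.
Qed.

(** For fixed t, pairing the translate v(x + e t) with phi is pairing v with a translate of phi,
    again a test function. The hypothesis applies to it, T commutes with the translation, and
    undoing the shift puts it on u. *)
Lemma is_weak_conv T k e (ker : R -> R) u v : admissible T ->
  mu.-integrable setT (EFin \o ker) -> u \in Lp -> v \in Lp ->
  is_weak k T u v -> is_weak k T (conv e ker u) (conv e ker v).
Proof.
move=> [gT shT] iker up vp [_ H].
have [cup _] := young e p1 iker up; have [cvp _] := young e p1 iker vp.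
split; first exact: Lp_locally_integrable cvp.
move=> phi cphi; have gphi := good_Cinfty0 cphi; have gTphi := gT _ cphi.
have gTphi' := goodZ ((-1) ^+ k) gTphi.
(* With the sign absorbed into the function paired with u, both sides become integrals against
   [ker t] and are compared for each t. *)
transitivity (\int[mu]_x (conv e ker u x * ((-1) ^+ k *: T phi) x)); last first.
  rewrite -(RintegralZl _ measurableT (pairing_integrable p1 cup gTphi)).
  apply: eq_Rintegral => x _; rewrite -[X in _ * X]/((-1) ^+ k * T phi x).
  by rewrite mulrCA.
rewrite (conv_pairing e p1 iker vp gphi) (conv_pairing e p1 iker up gTphi').
apply: eq_Rintegral => t _; congr (_ * _).
have mu_ := Lp_measurable p1 up; have mv := Lp_measurable p1 vp.
have [mphi _ _] := gphi; have [mTphi _ _] := gTphi.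
have shift f g : measurable_fun setT f -> measurable_fun setT g ->
    \int[mu]_x (f (x + e * t) * g x) = \int[mu]_x (f x * g (- (e * t) + 1 * x)).
  move=> mf mg.
  have := @Rintegral_affine R 1 (e * t) (fun x => f x * g (- (e * t) + 1 * x)) (normr1 _).
  move=> <-; last first.
    by apply: measurable_funM => //; apply: (measurableT_comp mg); exact: measurable_affine.
  by apply: eq_Rintegral => x _; rewrite mul1r addrC; congr (_ * g _); ring.
rewrite (shift _ _ mv mphi).
have cs : Cinfty0 (fun x => phi (- (e * t) + 1 * x)).
  by apply: Cinfty0_affine => //; exact: normr1.
rewrite (H _ cs) (shT _ _ cphi).
have [gs _ _] := gT _ cs.
rewrite shift//; last by apply: measurable_funM.
have iu : mu.-integrable setT (EFin \o (fun x => u x * T phi (- (e * t) + 1 * x))).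
  by apply: (pairing_integrable p1 up); rewrite -shT//; exact: gT.
rewrite -(RintegralZl _ measurableT iu); apply: eq_Rintegral => x _.
by rewrite -[X in _ = _ * X]/((-1) ^+ k * T phi (- (e * t) + 1 * x)) mulrCA.
Qed.

End FixedExponent.

(* From the cutoff [chi], rescaled and normalized; since [chi >= 1] on [-1, 1],
   the total mass before normalization is at least [2 r]. *)
Lemma mollifier_exists (r : R) : 0 < r -> exists eta : R -> R,
  [/\ Cinfty0 eta, forall x, 0 <= eta x <= (r *+ 2)^-1,
      \int[mu]_x eta x = 1 & forall x, r *+ 2 <= `|x| -> eta x = 0].
Proof.
move=> r0; have [chi [schi chi01 chi1 chi0]] := cutoff_exists R.
pose b x := chi (0 + r^-1 * x).
have rV : 0 < r^-1 by rewrite invr_gt0.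
have absb x : `|0 + r^-1 * x| = r^-1 * `|x| by rewrite add0r normrM gtr0_norm.
have b0 x : r *+ 2 <= `|x| -> b x = 0.
  move=> h; apply: chi0; rewrite absb -(@ler_pM2l _ r)// mulrA mulfV ?gt_eqF//.
  by rewrite mul1r mulr_natr.
have b1 x : `|x| <= r -> b x = 1.
  move=> h; apply: chi1; rewrite absb -(@ler_pM2l _ r)// mulrA mulfV ?gt_eqF//.
  by rewrite mul1r mulr1.
have cb : Cinfty0 b.
  by apply/Cinfty0P; split; [exact (smooth_affine 0 r^-1 schi)|exists (r *+ 2)].
have [mb ib _] := good_Cinfty0 cb.
pose c := \int[mu]_x b x.
have rc : r *+ 2 <= c.
  pose D := `[- r, r]%classic : set R.
  have ii : mu.-integrable setT (EFin \o ((cst 1 : R -> R) \_ D)).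
    apply: integrable_itv_patch; apply: continuous_compact_integrable.
      exact: segment_compact.
    by apply: continuous_subspaceT => x; exact: cvg_cst.
  apply: (@le_trans _ _ (\int[mu]_x ((cst 1 : R -> R) \_ D) x)).
    rewrite -Rintegral_mkcond Rintegral_cst//; last exact: measurable_itv.
    have muD : lebesgue_measure D = (r *+ 2)%:E.
      rewrite /D lebesgue_measure_itv/= lte_fin ifT; last lra.
      by rewrite -EFinB opprK mulr2n.
    by rewrite -[X in fine X]/(lebesgue_measure D) muD mul1r.
  apply: le_Rintegral => // x _; rewrite patchE.
  case: (boolP (x \in _)) => [|_].
    by rewrite inE /D/= in_itv/= -ler_norml => h; rewrite b1.
  by have /andP[] := chi01 (0 + r^-1 * x).
have c0 : 0 < c by rewrite (lt_le_trans _ rc)// pmulrn_lgt0.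
exists (c^-1 *: b); split.
- rewrite -[_ *: _]addr0; apply: Cinfty0_lin => //.
  apply/Cinfty0P; split; first exact (@smooth_cst R 0).
  by exists 0.
- move=> x; rewrite -[(c^-1 *: b) x]/(c^-1 * b x).
  have /andP[h0 h1] := chi01 (0 + r^-1 * x).
  rewrite mulr_ge0 ?invr_ge0 ?(ltW c0)//=.
  rewrite (@le_trans _ _ (c^-1 * 1))//; first by rewrite ler_wpM2l// invr_ge0 ltW.
  by rewrite mulr1 lef_pV2// posrE// pmulrn_lgt0.
- by rewrite -/(c) (RintegralZl c^-1 measurableT ib) -/c mulVf// gt_eqF.
- by move=> x h; rewrite -[LHS]/(c^-1 * b x) b0// mulr0.
Qed.

(** As eta has mass 1, the difference is the integral of (u(t) - u(x)) eta(x - t). The bound 1/(2r)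
    on the ball of radius 2r, whose measure is 4r, gives twice the average. *)
Lemma mollifier_davg (r : R) (eta u : R -> R) (x : R) : 0 < r ->
  Cinfty0 eta -> (forall x, 0 <= eta x <= (r *+ 2)^-1) ->
  \int[mu]_x eta x = 1 -> (forall x, r *+ 2 <= `|x| -> eta x = 0) ->
  locally_integrable setT u ->
  (`|conv (-1) u eta x - u x|%:E <= 2%:E * davg u x (r *+ 2))%E.
Proof.
move=> r0 ceta eta01 eta1 eta0 lu; have [mu_ _ _] := lu.
have [meta ieta _] := good_Cinfty0 ceta.
have N1 : `|-1 : R| = 1 by rewrite normrN1.
have i1 := integrable_conv_kernel N1 lu x ceta.
have i2 : mu.-integrable setT (EFin \o (fun t => eta (x + -1 * t))).
  exact: (integrable_affine x N1 ieta).
have i3 := integrableZl measurableT (u x) i2.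
have E : conv (-1) u eta x - u x = \int[mu]_t ((u t - u x) * eta (x + -1 * t)).
  have ux : u x = \int[mu]_t (u x * eta (x + -1 * t)).
    by rewrite (RintegralZl _ measurableT i2) (Rintegral_affine x N1 meta) eta1 mulr1.
  rewrite [in LHS]ux /conv -RintegralB//.
  by apply: eq_Rintegral => t _; rewrite mulrBl.
have i4 : mu.-integrable setT (EFin \o (fun t => (u t - u x) * eta (x + -1 * t))).
  have := integrableB measurableT i1 i3; apply: eq_integrable => // t _ /=.
  by rewrite -EFinB mulrBl.
rewrite E EFin_normr_Rintegral//.
have r2 : 0 < r *+ 2 by rewrite pmulrn_lgt0.
have mball : measurable (ball x (r *+ 2) : set R) by exact: measurable_ball.
have mux : measurable_fun setT (fun t => `|u t - u x|).
  by apply: measurableT_comp => //; exact: measurable_funB.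
apply: (@le_trans _ _ (\int[mu]_(t in ball x (r *+ 2)) ((r *+ 2)^-1%:E * `|u t - u x|%:E))%E).
  apply: (le_trans (le_abse_integral _ _ _)) => //; first by case/integrableP: i4.
  rewrite [leRHS]integral_mkcond; apply: ge0_le_integral => //.
  - by apply: measurableT_comp => //; case/integrableP: i4.
  - apply/(measurable_restrictT _ mball); apply: measurable_funTS.
    by apply: measurable_funeM; exact/measurable_EFinP.
  move=> t _; rewrite patchE; case: ifPn => [_|].
    rewrite /= lee_fin normrM mulrC ler_wpM2r//.
    by have /andP[h0 h1] := eta01 (x + -1 * t); rewrite ger0_norm.
  rewrite notin_setE /ball/= => /negP; rewrite -leNgt => h.
  by rewrite eta0 ?mulr0 ?normr0//; rewrite mulN1r.
rewrite ge0_integralZl//; last 2 first.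
- by apply: measurable_funTS; exact/measurable_EFinP.
- by rewrite lee_fin invr_ge0 ltW.
rewrite /davg /iavg lebesgue_measure_ball ?(ltW r2)//.
rewrite inver gt_eqF ?pmulrn_lgt0// muleA -EFinM.
rewrite le_eqVlt; apply/orP; left; apply/eqP; congr (_ * _)%E.
by congr EFin; rewrite -[r *+ 2 *+ 2]mulr_natr; field; rewrite gt_eqF.
Qed.

End WeakDerivatives.

(** * Convergence of mollifications and uniqueness of weak derivatives *)

Section LpConvergence.
Variable R : realType.
Implicit Types (u v w f g phi : R -> R) (T : (R -> R) -> R -> R) (p : R).

Local Notation mu := (@lebesgue_measure R).

Lemma limn_einf_gt (a : nat -> \bar R) (c : \bar R) : (c < limn_einf a)%E ->
  exists N, forall n, (N <= n)%N -> (c < a n)%E.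
Proof.
rewrite limn_einf_lim (cvg_lim _ (@cvg_einfs_sup _ a))// => /ereal_sup_gt[_ [N _ <-]] cN.
exists N => n Nn; apply: (lt_le_trans cN).
by apply: ereal_inf_lbound; exists n.
Qed.

(** Convexity of the p-th power at the midpoint of |a| and |b|, multiplied by 2^p. *)
Lemma powR_convex2 p (a b : R) : 1 <= p ->
  `|a - b| `^ p <= 2 `^ (p - 1) * (`|a| `^ p + `|b| `^ p).
Proof.
move=> p1; have p0 : 0 < p by rewrite (lt_le_trans _ p1).
have h2 : 0 <= (2^-1 : R) by lra.
have h2' : (2^-1 : R) <= 1 by lra.
have := @convex_powR R p p1 (Itv01 h2 h2') `|a| `|b|.
rewrite !inE/= !in_itv/= !andbT !normr_ge0 => /(_ isT isT).
rewrite convRE [X in X `^ _]convRE /= /unstable.onem.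
have -> : 1 - 2^-1 = 2^-1 :> R by lra.
move=> h.
have ab0 : 0 <= 2^-1 * `|a| + 2^-1 * `|b|.
  by rewrite addr_ge0// mulr_ge0// invr_ge0.
have h' : `|a - b| `^ p <= (2 * (2^-1 * `|a| + 2^-1 * `|b|)) `^ p.
  apply: ge0_ler_powR; rewrite ?nnegrE ?(ltW p0) ?mulr_ge0//.
  by have := ler_normB a b; lra.
rewrite (le_trans h')// powRM// -(@mulr_powRB1 _ 2 p)//.
apply: (le_trans (ler_wpM2l _ h)); first by rewrite mulr_ge0// powR_ge0.
rewrite le_eqVlt; apply/orP; left; apply/eqP.
by rewrite -mulrDr mulrA; congr (_ * _); field.
Qed.

(* Fatou's lemma applied to [2^(p-1) (|F_n|^p + |f|^p) - |F_n - f|^p]. *)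
Lemma cvg_Lp_of_ae p (F : nat -> R -> R) f : 1 <= p ->
  (forall n, F n \in Lfun mu p%:E) -> f \in Lfun mu p%:E ->
  {ae mu, forall x, F n x @[n --> \oo] --> f x} ->
  (forall n, nm p (F n) <= nm p f) -> nm p (F n - f) @[n --> \oo] --> 0.
Proof.
move=> p1 Fp fp cF leF; have p0 : 0 < p by rewrite (lt_le_trans _ p1).
have mF n := Lp_measurable p1 (Fp n); have mf := Lp_measurable p1 fp.
pose c : R := 2 `^ (p - 1).
have c0 : 0 <= c by rewrite powR_ge0.
pose G n x := c * (`|F n x| `^ p + `|f x| `^ p) - `|F n x - f x| `^ p.
have G0 n x : 0 <= G n x by rewrite subr_ge0 powR_convex2.
have mD n : measurable_fun setT (F n - f) by exact: measurable_funB.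
have mG n : measurable_fun setT (G n).
  apply: measurable_funB; last exact: (measurable_norm_powR p (mD n)).
  apply: measurable_funM => //; apply: measurable_funD; exact: measurable_norm_powR.
have iF n := Lfun_integrable p1 (Fp n); have i_f := Lfun_integrable p1 fp.
have iD n := Lfun_integrable p1 (LpB p1 (Fp n) fp).
have intG n : (\int[mu]_x (G n x)%:E =
    (c * (nm p (F n) `^ p + nm p f `^ p) - nm p (F n - f) `^ p)%:E)%E.
  rewrite EFinB EFinM EFinD !(nm_powR p1)//; last exact: LpB.
  rewrite /ipow -(integralD measurableT (iF n) i_f) -integralZl//; last first.
    exact: integrableD.
  have iS := integrableZl measurableT c (integrableD measurableT (iF n) i_f).
  by rewrite -(integralB measurableT iS (iD n)); exact: eq_integral.
have fat : ((c * (nm p f `^ p + nm p f `^ p))%:E <=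
    limn_einf (fun n => \int[mu]_x (G n x)%:E))%E.
  apply: (@le_trans _ _ (\int[mu]_x limn_einf (fun n => (G n x)%:E))%E); last first.
    apply: (fatou mu measurableT) => [n|n x _]; last by rewrite lee_fin.
    by apply/measurable_EFinP; exact: mG.
  rewrite EFinM EFinD !(nm_powR p1)// /ipow -(integralD measurableT i_f i_f).
  rewrite -integralZl//; last exact: integrableD.
  apply: ae_ge0_le_integral => //.
  - by move=> x _; rewrite -EFinD -EFinM lee_fin mulr_ge0// addr_ge0// powR_ge0.
  - apply: measurable_funeM; apply: emeasurable_funD; exact: measurable_ipow.
  - move=> x _; rewrite limn_einf_lim; apply: lime_ge; first exact: is_cvg_einfs.
    apply: nearW => j; apply: le_ereal_inf_tmp => _ [i _ <-].
    by rewrite lee_fin.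
  - apply: (@emeasurable_fun_cvg _ _ _ _ (fun n x => einfs (fun j => (G j x)%:E) n)).
      by move=> n; apply: measurable_fun_einfs => j; exact/measurable_EFinP.
    by move=> x _; rewrite limn_einf_lim; exact: is_cvg_einfs.
  - apply: ae_imp cF => x cx _.
    have cG : G n x @[n --> \oo] --> c * (`|f x| `^ p + `|f x| `^ p).
      rewrite -[X in _ --> X]subr0; apply: cvgB.
        apply: cvgMr; apply: cvgD; last exact: cvg_cst.
        by apply: cvg_powR => //; exact: cvg_norm.
      have -> : 0 = `|f x - f x| `^ p by rewrite subrr normr0 powR0 ?gt_eqF.
      apply: cvg_powR => //; apply: cvg_norm; apply: cvgB => //; exact: cvg_cst.
    rewrite (cvg_limn_einf_sup (l := (c * (`|f x| `^ p + `|f x| `^ p))%:E)) -?EFinD -?EFinM//.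
    by apply: cvg_EFin => //; exact: nearW.
apply/cvgr0Pnorm_lt => d d0.
have dp0 : 0 < d `^ p by rewrite powR_gt0.
have hlt : ((c * (nm p f `^ p + nm p f `^ p) - d `^ p)%:E <
    (c * (nm p f `^ p + nm p f `^ p))%:E)%E.
  by rewrite lte_fin; lra.
have [N hN] := limn_einf_gt (lt_le_trans hlt fat).
exists N => // n /= /hN; rewrite intG lte_fin ger0_norm ?nm_ge0// => h.
(* Here the norm bound enters: it replaces the norm of [F n] by that of f in the integral of G_n, so
   only the norm of [F n - f] remains to be compared with d. *)
have h1 : nm p (F n) `^ p <= nm p f `^ p.
  by rewrite ge0_ler_powR ?nnegrE ?nm_ge0 ?(ltW p0).
have h2 : nm p (F n - f) `^ p < d `^ p by nra.
rewrite ltNge; apply/negP => h3; move: h2; apply/negP; rewrite -leNgt.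
by rewrite ge0_ler_powR ?nnegrE ?nm_ge0 ?(ltW p0) ?(ltW d0).
Qed.

Definition mollifiers (eta : nat -> R -> R) := forall n, [/\ Cinfty0 (eta n),
  forall x, 0 <= eta n x <= ((n.+1%:R^-1) *+ 2)^-1, \int[mu]_x eta n x = 1 &
  forall x, (n.+1%:R^-1) *+ 2 <= `|x| -> eta n x = 0].

Lemma mollifiers_exist : exists eta, mollifiers eta.
Proof.
have /choice[eta h] : forall n : nat, exists eta : R -> R, [/\ Cinfty0 eta,
  forall x, 0 <= eta x <= ((n.+1%:R^-1) *+ 2)^-1, \int[mu]_x eta x = 1 &
  forall x, (n.+1%:R^-1) *+ 2 <= `|x| -> eta x = 0].
  by move=> n; apply: mollifier_exists; rewrite invr_gt0.
by exists eta.
Qed.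

(** Convergence holds at each Lebesgue point of u, by [mollifier_davg]. *)
Lemma mollify_ae eta u : mollifiers eta -> locally_integrable setT u ->
  {ae mu, forall x, conv (-1) u (eta n) x @[n --> \oo] --> u x}.
Proof.
move=> Heta lu; apply: ae_imp (lebesgue_differentiation lu) => x lx.
have r0 n : 0 < (n.+1%:R^-1 : R) by rewrite invr_gt0.
have /fine_cvgP[finx cx] := lx.
apply/cvgrPdistC_lt => d d0.
have d20 : 0 < d / 2 by rewrite divr_gt0.
have [del1 /= del10 H1] := finx.
have [del2 /= del20 H2] := (cvgr0Pnorm_lt _).1 cx _ d20.
(* Below [del1] the averages are finite, below [del2] they are less than d/2. The radius is 2/(n+1),
   whence the halved threshold. *)
have mdel : 0 < Num.min del1 del2 / 2 by rewrite divr_gt0// lt_min del10.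
have /cvgr0Pnorm_lt/(_ _ mdel)[N _ HN] := @cvg_harmonic R.
exists N => // n /= /HN /=; rewrite ger0_norm ?(ltW (r0 n))// => hn.
have r2 : 0 < (n.+1%:R^-1 : R) *+ 2 by rewrite pmulrn_lgt0.
have hmin : (n.+1%:R^-1 : R) *+ 2 < Num.min del1 del2.
  by rewrite mulr2n [ltRHS]splitr ltrD.
move: hmin; rewrite lt_min => /andP[hd1 hd2].
have b1 : ball_ Num.norm 0 del1 (n.+1%:R^-1 *+ 2).
  by rewrite /ball_/= sub0r normrN gtr0_norm.
have b2 : ball_ Num.norm 0 del2 (n.+1%:R^-1 *+ 2).
  by rewrite /ball_/= sub0r normrN gtr0_norm.
have fin := H1 _ b1 r2; have := H2 _ b2 r2 => /= lt2.
have [ceta eta01 eta1 eta0] := Heta n.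
have := mollifier_davg x (r0 n) ceta eta01 eta1 eta0 lu.
rewrite -(fineK fin) -EFinM lee_fin => /le_lt_trans; apply.
have := ler_norm (fine (davg u x (n.+1%:R^-1 *+ 2))); lra.
Qed.

(** The value at x of a mollification of u is a pairing of u with the test function eta_n(x - t),
    hence 0, and it tends to u(x) almost everywhere. *)
Lemma ae_eq0_of_pairing u : locally_integrable setT u ->
  (forall phi, Cinfty0 phi -> \int[mu]_x (u x * phi x) = 0) ->
  {ae mu, forall x, u x = 0}.
Proof.
move=> lu H; have [eta Heta] := mollifiers_exist.
apply: ae_imp (mollify_ae Heta lu) => x cx.
have z n : conv (-1) u (eta n) x = 0.
  have [ceta _ _ _] := Heta n.
  by apply: H; apply: Cinfty0_affine => //; rewrite normrN1.
move: cx; under eq_fun do rewrite z; move=> /cvg_lim <- //.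
exact: lim_cst.
Qed.

Lemma is_weak_unique T k u v w : is_weak k T u v -> is_weak k T u w ->
  {ae mu, forall x, v x = w x}.
Proof.
move=> [lv Hv] [lw Hw].
have lvw : locally_integrable setT (v \- w) by exact: locally_integrableB.
have : {ae mu, forall x, (v \- w) x = 0}.
  apply: ae_eq0_of_pairing => // phi cphi.
  have N1 : `|1 : R| = 1 by exact: normr1.
  have iv := integrable_conv_kernel N1 lv 0 cphi.
  have iw := integrable_conv_kernel N1 lw 0 cphi.
  have E f : \int[mu]_x (f x * phi x) = \int[mu]_x (f x * phi (0 + 1 * x)).
    by apply: eq_Rintegral => x _; rewrite mul1r add0r.
  transitivity (\int[mu]_x (v x * phi (0 + 1 * x)) - \int[mu]_x (w x * phi (0 + 1 * x))).
    rewrite -(RintegralB measurableT iv iw).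
    by apply: eq_Rintegral => x _; rewrite mul1r add0r mulrBl.
  by rewrite -!E Hv// Hw// subrr.
by apply: ae_imp => x /eqP; rewrite subr_eq0 => /eqP.
Qed.

Section Mollify.
Variables (p : R) (eta : nat -> R -> R).
Hypothesis p1 : 1 <= p.
Hypothesis Heta : mollifiers eta.

Let moll n u := conv (-1) u (eta n).

Let ceta n : Cinfty0 (eta n). Proof. by have [] := Heta n. Qed.

Let iCinfty0 phi : Cinfty0 phi -> mu.-integrable setT (EFin \o phi).
Proof. by move=> cphi; have [] := good_Cinfty0 cphi. Qed.

(** Both readings serve: with u as kernel, derivatives fall on phi and pointwise limits are
    available; with phi as kernel, Young's inequality and [is_weak_conv] apply. *)
Let convE u phi : u \in Lfun mu p%:E -> Cinfty0 phi -> conv (-1) u phi = conv (-1) phi u.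
Proof.
move=> up cphi; apply: conv_comm; first exact: Lp_measurable up.
exact (smooth_measurable (Cinfty0_smooth cphi)).
Qed.

Let N1 : `|-1 : R| = 1. Proof. by rewrite normrN1. Qed.

Lemma mollify_Lp n u : u \in Lfun mu p%:E ->
  moll n u \in Lfun mu p%:E /\ nm p (moll n u) <= nm p u.
Proof.
move=> up; rewrite /moll convE//.
have [-> h] := young (-1) p1 (iCinfty0 (ceta n)) up.
split => //; apply: (le_trans h).
have [_ eta01 eta1 _] := Heta n.
rewrite (_ : fine _ = 1) ?mul1r// -eta1 /Rintegral; congr fine.
by apply: eq_integral => x _; rewrite ger0_norm//; have /andP[] := eta01 x.
Qed.

Lemma mollify_smooth n u : u \in Lfun mu p%:E -> smooth (moll n u).
Proof.
move=> up; exact (smooth_conv N1 (Lp_locally_integrable p1 up) (ceta n)).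
Qed.

Lemma mollify_derive1n_Lp n j u : u \in Lfun mu p%:E ->
  derive1n j (moll n u) \in Lfun mu p%:E.
Proof.
move=> up; have cj := Cinfty0_derive1n j (ceta n).
rewrite /moll (derive1n_conv N1 (Lp_locally_integrable p1 up))// convE//.
by have [] := young (-1) p1 (iCinfty0 cj) up.
Qed.

(** Mollification does not increase the L^p norm, which is the norm condition of [cvg_Lp_of_ae]. *)
Lemma mollify_cvg u : u \in Lfun mu p%:E -> nm p (moll n u - u) @[n --> \oo] --> 0.
Proof.
move=> up; apply: cvg_Lp_of_ae => //.
- by move=> n; have [] := mollify_Lp n up.
- exact: mollify_ae (Lp_locally_integrable p1 up).
- by move=> n; have [] := mollify_Lp n up.
Qed.

Lemma mollify_weak T k n u v : admissible T -> u \in Lfun mu p%:E ->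
  v \in Lfun mu p%:E -> is_weak k T u v -> is_weak k T (moll n u) (moll n v).
Proof.
move=> aT up vp H; rewrite /moll (convE up (ceta n)) (convE vp (ceta n)).
exact (@is_weak_conv R p p1 T k (-1) (eta n) u v aT (iCinfty0 (ceta n)) up vp H).
Qed.

End Mollify.
End LpConvergence.

(** * The integrable pieces of the kernel of the fractional integral *)

Section FracKernels.
Variable R : realType.
Implicit Types (f phi psi : R -> R).

Local Notation mu := (@lebesgue_measure R).
Local Notation isd x f d := (is_derive (x : R) (1 : R) (f : R -> R) (d : R)).

Definition pw (r : R) : R -> R := fun t => t `^ r.

Lemma measurable_pw (r : R) : measurable_fun setT (pw r).
Proof. exact: measurable_powR. Qed.

Lemma is_derive_pw (r x : R) : 0 < x -> isd x (pw r) (r * pw (r - 1) x).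
Proof. by move=> x0; exact: is_derive1_powR. Qed.

Lemma continuous_pw (r x : R) : 0 < x -> {for x, continuous (pw r)}.
Proof.
move=> x0; apply: differentiable_continuous; apply/derivable1_diffP.
by have [] := derive1_of (is_derive_pw r x0).
Qed.

Lemma within_continuous_pos (f : R -> R) (a b : R) : 0 < a ->
  (forall x, 0 < x -> {for x, continuous f}) -> {within `[a, b], continuous f}.
Proof.
move=> a0 H; apply/continuous_in_subspaceT => x; rewrite inE/= in_itv/= => /andP[ax _].
by apply: H; exact: lt_le_trans ax.
Qed.

Lemma FTC_pos (f df : R -> R) (a b : R) : 0 < a -> a < b ->
  (forall x, 0 < x -> isd x f (df x)) -> (forall x, 0 < x -> {for x, continuous df}) ->
  (\int[mu]_(x in `[a, b]) (df x)%:E = (f b - f a)%:E)%E.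
Proof.
move=> a0 ab Hf Hdf.
have cf x : 0 < x -> {for x, continuous f}.
  move=> x0; apply: differentiable_continuous; apply/derivable1_diffP.
  by have [] := derive1_of (Hf x x0).
rewrite (@continuous_FTC2 _ df f)//.
- exact: within_continuous_pos.
- split.
  + move=> x; rewrite in_itv/= => /andP[ax _].
    by have [] := derive1_of (Hf x (lt_trans a0 ax)).
  + by apply: cvg_at_right_filter; exact: cf.
  + by apply: cvg_at_left_filter; apply: cf; exact: lt_trans ab.
- move=> x; rewrite in_itv/= => /andP[ax _].
  by have [] := derive1_of (Hf x (lt_trans a0 ax)).
Qed.

Lemma integral_pw (r a b : R) : r + 1 != 0 -> 0 < a -> a < b ->
  (\int[mu]_(x in `[a, b]) (pw r x)%:E =
   ((r + 1)^-1 * (b `^ (r + 1) - a `^ (r + 1)))%:E)%E.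
Proof.
move=> r1 a0 ab.
have Hd (x : R) : 0 < x -> isd x (fun x => (r + 1)^-1 * pw (r + 1) x) (pw r x).
  move=> x0; apply: (is_derive_eq (is_deriveZ (r + 1)^-1 (is_derive_pw (r + 1) x0))).
  by rewrite /GRing.scale/= mulKf// addrK.
by rewrite (FTC_pos a0 ab Hd (fun x => @continuous_pw r x)) mulrBr.
Qed.

(** Improper integrals by monotone convergence: powers are integrated on segments away from 0 and
    infinity, with a uniform bound. *)
Lemma integrable_bigcup_itv (f : R -> R) (a b : nat -> R) (C : R) :
  measurable_fun setT f -> (forall x, 0 <= f x) ->
  {homo (fun n => `[a n, b n]%classic : set R) : n m / (n <= m)%N >-> (n <= m)%O} ->
  (forall n, \int[mu]_(x in `[a n, b n]) (f x)%:E <= C%:E)%E ->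
  mu.-integrable (\bigcup_n `[a n, b n]%classic) (EFin \o f).
Proof.
move=> mf f0 mono H; apply/integrableP; split.
  by apply: measurable_funTS; exact/measurable_EFinP.
under eq_integral do rewrite /= ger0_norm//.
have cv : (\int[mu]_(x in `[a i, b i]) (f x)%:E)%E @[i --> \oo] -->
    (\int[mu]_(x in \bigcup_i `[a i, b i]%classic) (f x)%:E)%E.
  apply: ge0_nondecreasing_set_cvg_integral => //.
  - by move=> i; apply: measurable_funTS; exact/measurable_EFinP.
  - by move=> i x _; rewrite lee_fin.
rewrite -(cvg_lim _ cv)// (@le_lt_trans _ _ C%:E) ?ltry//.
by apply: lime_le; [exact: cvgP cv|exact: nearW].
Qed.

Section Sigma.
Variable sigma : R.
Hypothesis sigma01 : 0 < sigma < 1.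

Let s0 : 0 < sigma. Proof. by case/andP: sigma01. Qed.
Let s1 : sigma < 1. Proof. by case/andP: sigma01. Qed.

(* The kernel t^(sigma-1) of the fractional integral is [k1 + k3]; [k3] is not
   integrable, but its derivative [(sigma - 1) k2] is. *)
Definition k1 := pw (sigma - 1) \_ (`]0, 1] : set R).
Definition k2 := pw (sigma - 2) \_ (`]1, +oo[ : set R).
Definition k3 := pw (sigma - 1) \_ (`]1, +oo[ : set R).

Lemma integrable_k1 : mu.-integrable setT (EFin \o k1).
Proof.
rewrite -restrict_EFin; apply/integrable_restrict => //=; rewrite setTI.
(* The bound 1/sigma is the integral of t^(sigma-1) over ]0, 1]. The index n+2 keeps the left end
   strictly below 1. *)
have h := @integrable_bigcup_itv (pw (sigma - 1)) (fun n => n.+2%:R^-1) (fun=> 1) sigma^-1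
  (measurable_pw _) (fun x => powR_ge0 _ _).
have E : \bigcup_n `[(n.+2%:R^-1 : R), 1]%classic = `]0, 1]%classic.
  apply/seteqP; split=> x /=.
    move=> [n _] /=; rewrite !in_itv/= => /andP[nx ->]; rewrite andbT.
    by apply: lt_le_trans nx; rewrite invr_gt0.
  rewrite in_itv/= => /andP[x0 x1].
  have /cvgr0Pnorm_lt/(_ _ x0)[N _ HN] := @cvg_harmonic R.
  exists N => //=; rewrite in_itv/= x1 andbT.
  have := HN N (leqnn N) => /=; rewrite ger0_norm ?invr_ge0// => /ltW.
  by apply: le_trans; rewrite lef_pV2 ?posrE// ler_nat.
rewrite -E; apply: h.
- move=> n m nm; apply/subsetPset => x /=; rewrite !in_itv/= => /andP[nx ->]; rewrite andbT.
  by apply: le_trans nx; rewrite lef_pV2 ?posrE// ler_nat.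
- move=> n; rewrite integral_pw; last 3 first.
  + by rewrite subrK gt_eqF.
  + by rewrite invr_gt0.
  + by rewrite invf_lt1// ltr1n.
  by rewrite subrK lee_fin powR1 ler_piMr ?invr_ge0 ?(ltW s0)// lerBlDr lerDl powR_ge0.
Qed.

Lemma integrable_k2 : mu.-integrable setT (EFin \o k2).
Proof.
rewrite -restrict_EFin; apply/integrable_restrict => //=; rewrite setTI.
(* The bound 1/(1 - sigma) is the integral of t^(sigma-2) over ]1, +oo[. *)
have h := @integrable_bigcup_itv (pw (sigma - 2)) (fun=> 1) (fun n => n.+2%:R) (1 - sigma)^-1
  (measurable_pw _) (fun x => powR_ge0 _ _).
apply: (integrableS _ _ _ (h _ _)).
- by apply: bigcup_measurable => n _; exact: measurable_itv.
- exact: measurable_itv.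
- move=> x /=; rewrite in_itv/= andbT => x1.
  exists (Num.truncn x) => //=; rewrite in_itv/= (ltW x1)/=.
  have /andP[_ h1] := truncn_itv (le_trans ler01 (ltW x1)).
  by rewrite (le_trans (ltW h1))// ler_nat.
- move=> n m nm; apply/subsetPset => x /=; rewrite !in_itv/= => /andP[-> xn]/=.
  by rewrite (le_trans xn)// ler_nat.
- move=> n; have E : sigma - 2 + 1 = - (1 - sigma) by ring.
  rewrite integral_pw//.
  + rewrite lee_fin powR1 E invrN mulNr -mulrN opprB -[leRHS]mulr1.
    by rewrite ler_wpM2l ?invr_ge0 ?subr_ge0 ?(ltW s1)// lerBlDr lerDl powR_ge0.
  + by rewrite E oppr_eq0 subr_eq0 gt_eqF.
  + by rewrite ltr1n.
Qed.

Lemma locally_integrable_k3 : locally_integrable setT k3.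
Proof.
have mk3 : measurable_fun setT k3.
  apply/(measurable_restrictT _ _).1 => //; apply: measurable_funTS; exact: measurable_pw.
split=> //; first exact: openT.
move=> K _ cK; have mK := compact_measurable cK.
apply: (@le_lt_trans _ _ (\int[mu]_(x in K) cst 1%E x)%E).
  apply: ge0_le_integral => //.
    by apply/measurable_EFinP/measurable_funTS; exact: measurableT_comp.
  move=> x _; rewrite lee_fin /k3 patchE; case: ifPn => [|_]; last by rewrite normr0.
  rewrite inE/= in_itv/= andbT => x1; rewrite ger0_norm ?powR_ge0//.
  rewrite -[leRHS](powRr0 x); apply: ler_powR; first exact: ltW.
  by rewrite subr_le0 ltW.
by rewrite integral_cst// mul1e compact_finite_measure.
Qed.

Lemma locally_integrable_k1 : locally_integrable setT k1.
Proof. by apply: open_integrable_locally; [exact: openT|exact: integrable_k1]. Qed.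

(* Integration by parts on [1, +oo[, with boundary term at 1. *)
Lemma conv_k3 (e : R) psi : `|e| = 1 -> Cinfty0 psi ->
  conv e k3 (derive1 psi) =
  (fun x => - e * psi (x + e) + e * (1 - sigma) * conv e k2 psi x).
Proof.
move=> e1 cpsi; apply/funext => x.
have ee : e * e = 1 by rewrite -expr2 -[LHS]real_normK ?num_real// e1 expr1n.
have [spsi [M hM]] := (Cinfty0P psi).1 cpsi.
have spsi' := smooth_derive1 spsi.
(* Past B the point x + e t has left the support of psi, so the improper integrals reduce to [1, B]
   and the boundary term at B is 0. *)
pose B := `|M| + `|x| + 2.
have B1 : 1 < B by rewrite /B; have := normr_ge0 M; have := normr_ge0 x; lra.
have big t : B < t -> M < `|x + e * t|.
  move=> Bt; have t0 : 0 < t by rewrite (lt_trans _ Bt)// (lt_trans _ B1).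
  have : `|e * t| <= `|x + e * t| + `|x|.
    by rewrite -[X in `|X| <= _](addKr x) (le_trans (ler_normD _ _))// normrN addrC.
  rewrite normrM e1 mul1r ger0_norm ?(ltW t0)//; move: Bt; rewrite /B.
  have := ler_norm M; lra.
have bigB : psi (x + e * B) = 0.
  apply: hM.
  have : `|e * B| <= `|x + e * B| + `|x|.
    by rewrite -[X in `|X| <= _](addKr x) (le_trans (ler_normD _ _))// normrN addrC.
  have B0 : 0 <= B by rewrite (le_trans ler01)// ltW.
  rewrite normrM e1 mul1r ger0_norm// /B.
  have := ler_norm M; lra.
pose h t := psi (x + e * t); pose dh t := derive1 psi (x + e * t).
have dhE (t : R) : isd t h (e * dh t) by exact (is_derive_affine x e t spsi).
have ch (t : R) : {for t, continuous h}.
  exact (smooth_continuous (smooth_affine x e spsi) t).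
have cdh (t : R) : {for t, continuous dh}.
  exact (smooth_continuous (smooth_affine x e spsi') t).
pose dH t := (sigma - 1) * (pw (sigma - 2) t * h t) + e * (pw (sigma - 1) t * dh t).
have HdH (t : R) : 0 < t -> isd t (fun t => pw (sigma - 1) t * h t) (dH t).
  move=> t0; apply: (is_derive_eq (is_deriveM (is_derive_pw (sigma - 1) t0) (dhE t))).
  by rewrite /GRing.scale/= /dH (_ : sigma - 1 - 1 = sigma - 2); [ring|ring].
have c2 (t : R) : 0 < t -> {for t, continuous (fun t => pw (sigma - 2) t * h t)}.
  by move=> t0; apply: continuousM; [exact: continuous_pw|exact: ch].
have c1 (t : R) : 0 < t -> {for t, continuous (fun t => pw (sigma - 1) t * dh t)}.
  by move=> t0; apply: continuousM; [exact: continuous_pw|exact: cdh].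
have cdH (t : R) : 0 < t -> {for t, continuous dH}.
  move=> t0; apply: continuousD; apply: continuousM; try exact: cst_continuous.
    exact: c2.
  exact: c1.
have FT := FTC_pos ltr01 B1 HdH cdH.
have i2 : mu.-integrable `[1, B] (EFin \o (fun t => pw (sigma - 2) t * h t)).
  apply: continuous_compact_integrable; first exact: segment_compact.
  exact: within_continuous_pos.
have i1 : mu.-integrable `[1, B] (EFin \o (fun t => pw (sigma - 1) t * dh t)).
  apply: continuous_compact_integrable; first exact: segment_compact.
  exact: within_continuous_pos.
have RFT : (sigma - 1) * \int[mu]_(t in `[1, B]) (pw (sigma - 2) t * h t) +
    e * \int[mu]_(t in `[1, B]) (pw (sigma - 1) t * dh t) = - psi (x + e).
  have := @integrableZl _ _ R mu `[1, B] _ (sigma - 1) _ i2 => /(_ (measurable_itv _)) i2'.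
  have := @integrableZl _ _ R mu `[1, B] _ e _ i1 => /(_ (measurable_itv _)) i1'.
  rewrite -!RintegralZl// -RintegralD//.
  rewrite /Rintegral FT /= /pw powR1 mul1r /h mulr1.
  by rewrite bigB mulr0 sub0r.
have kE (r : R) (g : R -> R) : (forall t, B < t -> g t = 0) ->
    mu.-integrable `[1, B] (EFin \o (fun t => pw r t * g t)) ->
    \int[mu]_t ((pw r \_ (`]1, +oo[ : set R)) t * g t) =
    \int[mu]_(t in `[1, B]) (pw r t * g t).
  move=> g0 ig; rewrite -Rintegral_itv_obnd_cbnd; last first.
    apply: (integrableS _ _ _ ig) => //.
    by move=> t /=; rewrite !in_itv/= => /andP[/ltW -> ->].
  rewrite [RHS]Rintegral_mkcond; apply: eq_Rintegral => t _; rewrite !patchE.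
  have [tB|tB] := leP t B.
    rewrite (_ : (t \in `]1, B]%classic) = (t \in `]1, +oo[%classic)).
      by case: ifP; rewrite ?mul0r.
    by apply/idP/idP; rewrite !inE/= !in_itv/= tB !andbT.
  by rewrite g0// !mulr0; case: ifP.
have dh0 t : B < t -> dh t = 0.
  by move=> /big; exact: (derive1n_supp 1 hM).
have h0 t : B < t -> h t = 0 by move=> /big/ltW; exact: hM.
rewrite -[LHS]/(\int[mu]_t ((pw (sigma - 1) \_ (`]1, +oo[ : set R)) t * dh t)).
rewrite -[conv e k2 psi x]/(\int[mu]_t ((pw (sigma - 2) \_ (`]1, +oo[ : set R)) t * h t)).
rewrite !kE//.
set I1 := \int[mu]_(t in _) (pw (sigma - 1) _ * _) in RFT *.
set I2 := \int[mu]_(t in _) (pw (sigma - 2) _ * _) in RFT *.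
have -> : I1 = e * (e * I1) by rewrite mulrA ee mul1r.
rewrite (_ : e * I1 = - psi (x + e) - (sigma - 1) * I2); first by ring.
by rewrite -RFT addrAC subrr add0r.
Qed.

End Sigma.
End FracKernels.

(** * Fractional derivatives of test functions and the resulting weak estimate *)

Section FractionalDerivatives.
Variable R : realType.
Implicit Types (f g h phi psi : R -> R) (s : side).

Local Notation mu := (@lebesgue_measure R).

(** The fractional integral on side s samples f at the points x + [sgn s] t with t > 0. *)
Definition sgn s : R := if s is Minus then -1 else 1.

Lemma normr_sgn s : `|sgn s| = 1.
Proof. by case: s; rewrite ?normrN1 ?normr1. Qed.

Lemma sgnM s : sgn s * sgn s = 1.
Proof. by case: s; rewrite /= ?mulrNN mulr1. Qed.

Definition ker (sigma : R) := pw (sigma - 1) \_ (`]0, +oo[ : set R).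

(** The substitution t = [sgn s] (y - x) gives both sides one formula, so that the later arguments
    treat them together. *)
Lemma frac_intE s (sigma : R) f : measurable_fun setT f ->
  frac_int s sigma f = (fun x => (Gamma sigma)^-1 * conv (sgn s) (ker sigma) f x).
Proof.
move=> mf; suff H (x : R) : conv (sgn s) (ker sigma) f x =
    \int[mu]_(y in [set y | 0 < sgn s * (y - x)]) (f y / (sgn s * (y - x)) `^ (1 - sigma)).
  have congr_int (D E : set R) (g h : R -> R) : D = E -> g = h ->
      (Gamma sigma)^-1 * \int[mu]_(y in D) g y = (Gamma sigma)^-1 * \int[mu]_(y in E) h y.
    by move=> -> ->.
  apply/funext => x; rewrite H; case: (s); apply: congr_int.
  - by apply/seteqP; split=> y; rewrite /= in_itv/= mulN1r opprB subr_gt0.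
  - by apply/funext => y; rewrite /= mulN1r opprB.
  - by apply/seteqP; split=> y; rewrite /= in_itv/= andbT mul1r subr_gt0.
  - by apply/funext => y; rewrite /= mul1r.
have mk : measurable_fun setT (ker sigma).
  apply/(measurable_restrictT _ _).1 => //; apply: measurable_funTS; exact: measurable_pw.
have mg : measurable_fun setT (fun t => ker sigma t * f (x + sgn s * t)).
  apply: measurable_funM => //; apply: (measurableT_comp mf); exact: measurable_affine.
rewrite /conv -(Rintegral_affine (- (sgn s * x)) (normr_sgn s) mg).
rewrite [RHS]Rintegral_mkcond; apply: eq_Rintegral => y _; rewrite patchE.
have -> : x + sgn s * (- (sgn s * x) + sgn s * y) = y.
  by rewrite mulrDr mulrN !mulrA sgnM !mul1r addrA subrr add0r.
have -> : - (sgn s * x) + sgn s * y = sgn s * (y - x) by ring.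
rewrite /ker patchE.
have -> : (sgn s * (y - x) \in `]0, +oo[%classic) = (y \in [set y | 0 < sgn s * (y - x)]).
  by apply/idP/idP; rewrite !inE/= in_itv/= andbT.
by case: ifP => _; rewrite ?mul0r// mulrC -powRN opprB.
Qed.

Lemma kerE sigma t : ker sigma t = k1 sigma t + k3 sigma t.
Proof.
rewrite /ker /k1 /k3 !patchE.
rewrite (_ : (t \in `]0, +oo[%classic) = (0 < t)); last first.
  by apply/idP/idP; rewrite !inE/= in_itv/= andbT.
rewrite (_ : (t \in `]0, 1]%classic) = (0 < t <= 1)); last first.
  by apply/idP/idP; rewrite !inE/= in_itv/=.
rewrite (_ : (t \in `]1, +oo[%classic) = (1 < t)); last first.
  by apply/idP/idP; rewrite !inE/= in_itv/= andbT.
case: (ltP 1 t) => t1; first by rewrite (lt_trans ltr01 t1)/= add0r.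
by rewrite andbT addr0.
Qed.

Lemma derive1nZ n (c : R) f : smooth f -> derive1n n (c *: f) = c *: derive1n n f.
Proof.
move=> sf; have := derive1n_lin n (c - 1) sf sf.
by rewrite !scalerBl !scale1r !subrK.
Qed.

Section NonIntegerOrder.
Variable a : R.
Hypothesis a0 : 0 < a.
Hypothesis aN : a != (Num.truncn a)%:R.

Let m := Num.truncn a.
Let sigma := m.+1%:R - a.

Let sigma01 : 0 < sigma < 1.
Proof.
have /andP[h1 h2] := truncn_itv (ltW a0).
have h3 : m%:R < a by rewrite lt_neqAle eq_sym aN.
by rewrite /sigma subr_gt0 h2/= ltrBlDr -nat1r ltrD2l.
Qed.

Let kappa s : R := (if s is Plus then (-1) ^+ m.+1 else 1) * (Gamma sigma)^-1.

(** All m+1 derivatives fall on phi, since [ker] is locally integrable. The part k1 keeps them; on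
    k3, [conv_k3] gives one back. The leading [1 *:] provides the shape expected by [good_lin]. *)
Lemma frac_derivE s phi : Cinfty0 phi ->
  frac_deriv s a phi = kappa s *: (1 *: conv (sgn s) (k1 sigma) (derive1n m.+1 phi) +
    ((- sgn s) *: (fun x => derive1n m phi (x + sgn s)) +
     (sgn s * (1 - sigma)) *: conv (sgn s) (k2 sigma) (derive1n m phi))).
Proof.
move=> cphi; have e1 := normr_sgn s.
have l1 := locally_integrable_k1 sigma01; have l3 := locally_integrable_k3 sigma01.
have lk : locally_integrable setT (ker sigma).
  rewrite (_ : ker sigma = k1 sigma \+ k3 sigma); first exact: locally_integrableD.
  by apply/funext => t; rewrite kerE.
have H : derive1n m.+1 (frac_int s sigma phi) =
    (Gamma sigma)^-1 *: conv (sgn s) (ker sigma) (derive1n m.+1 phi).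
  rewrite frac_intE; last exact (smooth_measurable (Cinfty0_smooth cphi)).
  by rewrite -(derive1n_conv e1 lk)// -derive1nZ//; exact (smooth_conv e1 lk cphi).
have K (x : R) : conv (sgn s) (ker sigma) (derive1n m.+1 phi) x =
    conv (sgn s) (k1 sigma) (derive1n m.+1 phi) x +
    conv (sgn s) (k3 sigma) (derive1n m.+1 phi) x.
  have c' := Cinfty0_derive1n m.+1 cphi.
  rewrite /conv -RintegralD//; [|exact (integrable_conv_kernel e1 l1 x c')|
    exact (integrable_conv_kernel e1 l3 x c')].
  by apply: eq_Rintegral => t _; rewrite kerE mulrDl.
have K3 := conv_k3 sigma e1 (Cinfty0_derive1n m cphi).
rewrite /frac_deriv (negbTE aN) -/m -/sigma.
transitivity (kappa s *: conv (sgn s) (ker sigma) (derive1n m.+1 phi)).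
  rewrite /kappa; case: s H {e1 K K3} => H; last first.
    by apply/funext => x; rewrite H; exact: mulrA.
  by rewrite mul1r -H.
rewrite scale1r; congr (_ *: _); apply/funext => x.
by rewrite K [X in _ + X = _](congr1 (fun f => f x) K3).
Qed.

Lemma admissible_frac_deriv_nonint s : admissible (frac_deriv s a).
Proof.
split=> [phi cphi|phi c cphi].
  rewrite frac_derivE//; have g' := good_Cinfty0 (Cinfty0_derive1n m.+1 cphi).
  have g := good_Cinfty0 (Cinfty0_derive1n m cphi).
  apply/goodZ/good_lin; first exact (good_conv _ (integrable_k1 sigma01) g').
  apply: good_lin; first exact: good_shift.
  exact (goodZ _ (good_conv _ (integrable_k2 sigma01) g)).
have cc : Cinfty0 (fun y => phi (c + 1 * y)) by apply: Cinfty0_affine; rewrite ?normr1.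
have sphi := Cinfty0_smooth cphi.
have E n : derive1n n (fun y => phi (c + 1 * y)) = (fun y => derive1n n phi (c + 1 * y)).
  by rewrite derive1n_affine//; apply/funext => x; rewrite expr1n mul1r.
have C (k f : R -> R) (e : R) : conv e k (fun y => f (c + 1 * y)) =
    (fun x => conv e k f (c + 1 * x)).
  apply/funext => x; apply: eq_Rintegral => t _; congr (_ * f _); ring.
rewrite !frac_derivE// !E !C.
rewrite (_ : (fun x => derive1n m phi (c + 1 * (x + sgn s))) =
  (fun x => derive1n m phi (c + 1 * x + sgn s)))//.
by apply/funext => x; rewrite mulrDr addrA (mul1r (sgn s)).
Qed.

(** The constant is chosen before h. This uniformity lets functions whose derivatives of orders m
    and m+1 tend to 0 have weak fractional derivatives tending to 0. *)
Lemma weak_frac_bound_nonint s p : 1 <= p -> exists2 C : R, 0 <= C &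
  forall h w1 w2, h \in Lfun mu p%:E -> w1 \in Lfun mu p%:E -> w2 \in Lfun mu p%:E ->
    is_weak_deriv m h w1 -> is_weak_deriv m.+1 h w2 ->
    exists2 v, v \in Lfun mu p%:E &
      is_weak_frac_deriv s a h v /\ nm p v <= C * (nm p w1 + nm p w2).
Proof.
move=> p1; set e := sgn (opp_side s).
have e1 : `|e| = 1 by exact: normr_sgn.
have i1 := integrable_k1 sigma01; have i2 := integrable_k2 sigma01.
have yg (k : R -> R) : mu.-integrable setT (EFin \o k) -> exists2 K : R, 0 <= K &
    forall f, f \in Lfun mu p%:E -> conv (- e) k f \in Lfun mu p%:E /\
      nm p (conv (- e) k f) <= K * nm p f.
  move=> ik; exists (fine (\int[mu]_t `|k t|%:E)%E); first by rewrite fine_ge0// integral_ge0.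
  by move=> f fp; exact: young.
have [K1 K10 y1] := yg _ i1; have [K2 K20 y2] := yg _ i2.
have [ka kaE] : exists ka, kappa (opp_side s) = ka by exists (kappa (opp_side s)).
(* The definition contributes (-1)^m, and moving the derivatives onto h contributes (-1)^(m+1) for
   the k1 term. For the other two terms the signs are both (-1)^m and cancel. *)
pose cA := (-1) ^+ m * ka * (-1) ^+ m.+1.
pose cB := ka * - e.
pose cC := ka * (e * (1 - sigma)).
exists (`|cA| * K1 + (`|cB| + `|cC| * K2)).
  by rewrite addr_ge0 ?(mulr_ge0 (normr_ge0 _))// addr_ge0 ?(mulr_ge0 (normr_ge0 _)).
move=> h w1 w2 hp w1p w2p H1 H2.
have [A0p _] := y1 _ hp.
have [Ap nA] := y1 _ w2p.
have [Bp nB] := Lp_shift p1 (- e) w1p.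
have [C0p _] := y2 _ hp.
have [Cp nC] := y2 _ w1p.
set A := conv (- e) (k1 sigma) w2 in Ap nA.
set B := (fun x => w1 (x + - e)) in Bp nB.
set C := conv (- e) (k2 sigma) w1 in Cp nC.
have vp : cA *: A + (cB *: B + cC *: C) \in Lfun mu p%:E.
  by apply: Lp_lin => //; apply: Lp_lin => //; exact: LpZ.
exists (cA *: A + (cB *: B + cC *: C)) => //; split; last first.
  apply: (le_trans (nmD p1 (LpZ p1 cA Ap) (LpD p1 (LpZ p1 cB Bp) (LpZ p1 cC Cp)))).
  have h1 := nmD p1 (LpZ p1 cB Bp) (LpZ p1 cC Cp).
  rewrite (nmZ p1 _ Bp) nB (nmZ p1 _ Cp) in h1.
  rewrite (nmZ p1 _ Ap) !mulrDl.
  have n1 := nm_ge0 p w1; have n2 := nm_ge0 p w2.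
  apply: lerD; last (apply: (le_trans h1); apply: lerD).
  - rewrite -mulrA; apply: (ler_wpM2l (normr_ge0 cA)).
    by apply: (le_trans nA); apply: (ler_wpM2l K10); rewrite lerDr.
  - by apply: (ler_wpM2l (normr_ge0 cB)); rewrite lerDl.
  - rewrite -mulrA; apply: (ler_wpM2l (normr_ge0 cC)).
    by apply: (le_trans nC); apply: (ler_wpM2l K20); rewrite lerDl.
split; first exact (Lp_locally_integrable p1 vp).
move=> phi cphi.
have gphi := good_Cinfty0 cphi.
have gm := good_Cinfty0 (Cinfty0_derive1n m cphi).
have gm1 := good_Cinfty0 (Cinfty0_derive1n m.+1 cphi).
have ZR (c : R) (g : R -> R) : good g ->
    \int[mu]_x (h x * (c *: g) x) = c * \int[mu]_x (h x * g x).
  move=> gg; rewrite -RintegralZl//; last exact (pairing_integrable p1 hp gg).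
  by apply: eq_Rintegral => x _; rewrite [LHS]mulrCA.
have DR (g1 g2 : R -> R) : good g1 -> good g2 ->
    \int[mu]_x (h x * (g1 + g2) x) = \int[mu]_x (h x * g1 x) + \int[mu]_x (h x * g2 x).
  move=> gg1 gg2; rewrite -RintegralD//; first last.
  - exact (pairing_integrable p1 hp gg2).
  - exact (pairing_integrable p1 hp gg1).
  by apply: eq_Rintegral => x _; rewrite -mulrDr.
have ZL (c : R) (w : R -> R) : w \in Lfun mu p%:E ->
    \int[mu]_x ((c *: w) x * phi x) = c * \int[mu]_x (w x * phi x).
  move=> wp; rewrite -RintegralZl//; last exact (pairing_integrable p1 wp gphi).
  by apply: eq_Rintegral => x _; rewrite [RHS]mulrA.
have gA : good (conv e (k1 sigma) (derive1n m.+1 phi)) by exact (good_conv e i1 gm1).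
have gB : good (fun x => derive1n m phi (x + e)) by exact: good_shift.
have gC : good (conv e (k2 sigma) (derive1n m phi)) by exact (good_conv e i2 gm).
have mm (n : nat) : (-1) ^+ n * (-1) ^+ n = 1 :> R by rewrite -expr2 sqrr_sign.
have EA : \int[mu]_x (A x * phi x) =
    (-1) ^+ m.+1 * \int[mu]_x (h x * conv e (k1 sigma) (derive1n m.+1 phi) x).
  have [_ /(_ _ cphi) ->] := is_weak_conv p1 (- e) (admissible_derive1n R m.+1) i1 hp w2p H2.
  by rewrite (conv_adjoint (- e) p1 i1 hp gm1) opprK.
have EC : \int[mu]_x (C x * phi x) =
    (-1) ^+ m * \int[mu]_x (h x * conv e (k2 sigma) (derive1n m phi) x).
  have [_ /(_ _ cphi) ->] := is_weak_conv p1 (- e) (admissible_derive1n R m) i2 hp w1p H1.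
  by rewrite (conv_adjoint (- e) p1 i2 hp gm) opprK.
have EB : \int[mu]_x (B x * phi x) =
    (-1) ^+ m * \int[mu]_x (h x * derive1n m phi (x + e)).
  have cs : Cinfty0 (fun y => phi (e + 1 * y)) by apply: Cinfty0_affine; rewrite ?normr1.
  have [_ /(_ _ cs)] := H1.
  rewrite derive1n_affine; last exact (Cinfty0_smooth cphi).
  have -> : \int[mu]_x (w1 x * phi (e + 1 * x)) = \int[mu]_x (B x * phi x).
    have mg : measurable_fun setT (fun x => B x * phi x).
      by apply: measurable_funM; [exact: Lp_measurable Bp|case: gphi].
    rewrite -(Rintegral_affine e (normr1 R) mg); apply: eq_Rintegral => x _.
    by rewrite /B mul1r (addrC e) addrK.
  move=> ->; congr (_ * _); apply: eq_Rintegral => x _.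
  by rewrite expr1n !mul1r (addrC e).
rewrite (pairing_lin p1 cA Ap (LpD p1 (LpZ p1 cB Bp) (LpZ p1 cC Cp)) gphi).
rewrite (pairing_lin p1 cB Bp (LpZ p1 cC Cp) gphi) (ZL _ _ Cp) EA EB EC.
rewrite (frac_derivE (opp_side s) cphi) -/e kaE.
have gBC := goodD (goodZ (- e) gB) (goodZ (e * (1 - sigma)) gC).
rewrite (ZR _ _ (goodD (goodZ 1 gA) gBC)) (DR _ _ (goodZ 1 gA) gBC) (ZR _ _ gA).
rewrite (DR _ _ (goodZ _ gB) (goodZ _ gC)) (ZR _ _ gB) (ZR _ _ gC).
set IA := \int[mu]_x _; set IB := \int[mu]_x _; set IC := \int[mu]_x _.
have -> : cA * ((-1) ^+ m.+1 * IA) = (-1) ^+ m * ka * IA.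
  by rewrite /cA mulrA -(mulrA _ ((-1) ^+ m.+1)) mm mulr1.
rewrite /cB /cC; ring.
Qed.

End NonIntegerOrder.

Lemma admissible_frac_deriv s (a : R) : 0 < a -> admissible (frac_deriv s a).
Proof.
move=> a0; have [aN|aN] := eqVneq a (Num.truncn a)%:R.
  rewrite (_ : frac_deriv s a = derive1n (Num.truncn a)); first exact: admissible_derive1n.
  by apply/funext => phi; rewrite /frac_deriv -aN eqxx.
exact: admissible_frac_deriv_nonint.
Qed.

(* The formula of [frac_derivE], with the convolution kernels moved to the other
   side of the pairing. *)
Lemma weak_frac_bound s (a p : R) : 0 < a -> 1 <= p -> exists2 C : R, 0 <= C &
  forall h w1 w2, h \in Lfun mu p%:E -> w1 \in Lfun mu p%:E -> w2 \in Lfun mu p%:E ->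
    is_weak_deriv (Num.truncn a) h w1 -> is_weak_deriv (Num.truncn a).+1 h w2 ->
    exists2 v, v \in Lfun mu p%:E &
      is_weak_frac_deriv s a h v /\ nm p v <= C * (nm p w1 + nm p w2).
Proof.
move=> a0 p1; have [aN|aN] := eqVneq a (Num.truncn a)%:R; last exact: weak_frac_bound_nonint.
exists 1 => // h w1 w2 hp w1p w2p H1 H2; exists w1 => //; split.
  rewrite /is_weak_frac_deriv (_ : frac_deriv _ a = derive1n (Num.truncn a))//.
  by apply/funext => phi; rewrite /frac_deriv -aN eqxx.
by rewrite mul1r lerDl nm_ge0.
Qed.

End FractionalDerivatives.

(** * Minkowski's inequality for finite sums *)

Section FiniteMinkowski.
Variable R : realType.

(** Minkowski's inequality for the counting measure on nat, applied to the sequences extended by 0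
    from index n on. *)
Lemma finite_minkowski (p : R) (n : nat) (a b : nat -> R) : 1 <= p ->
  (forall j, 0 <= a j) -> (forall j, 0 <= b j) ->
  (\sum_(0 <= j < n) (a j + b j) `^ p) `^ p^-1 <=
  (\sum_(0 <= j < n) a j `^ p) `^ p^-1 + (\sum_(0 <= j < n) b j `^ p) `^ p^-1.
Proof.
move=> p1 a0 b0; have p0 : 0 < p by rewrite (lt_le_trans _ p1).
pose cut (c : nat -> R) j := if (j < n)%N then c j else 0.
have N (c : nat -> R) : (forall j, 0 <= c j) ->
    ('N[@counting nat R]_(p%:E)[EFin \o cut c] = ((\sum_(0 <= j < n) c j `^ p) `^ p^-1)%:E)%E.
  move=> c0; rewrite Lnorm_counting//.
  rewrite (nneseries_split 0 n) ?add0n; last by move=> k _; exact: poweR_ge0.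
  rewrite [X in (_ + X)%E]eseries0 ?adde0; last first.
    move=> k nk _ /=; by rewrite /cut ltnNge nk/= normr0 powR0// gt_eqF.
  rewrite -poweR_EFin -sumEFin; congr (_ `^ _)%E.
  rewrite [LHS]big_nat [RHS]big_nat; apply: eq_bigr => j /andP[_ jn].
  by rewrite /= /cut jn ger0_norm// poweR_EFin.
have h : ('N[@counting nat R]_(p%:E)[EFin \o cut (fun j => (a j + b j)%R)] <=
    'N[@counting nat R]_(p%:E)[EFin \o cut a] + 'N[@counting nat R]_(p%:E)[EFin \o cut b])%E.
  rewrite (_ : cut (fun j => a j + b j) = cut a \+ cut b); first exact: minkowski_EFin.
  by apply/funext => j; rewrite /cut/=; case: ifP => //; rewrite addr0.
rewrite (N _ a0) (N _ b0) N in h; last by move=> j; rewrite addr_ge0.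
by rewrite -lee_fin EFinD.
Qed.

End FiniteMinkowski.

(** * The norm through jets; completeness of the fractional Sobolev space *)

Section Jets.
Variables (R : realType) (s : side) (a p : R).
Hypothesis a0 : 0 < a.
Hypothesis p1 : 1 <= p.
Implicit Types (u f g h : R -> R) (v w : nat -> R -> R).

Local Notation mu := (@lebesgue_measure R).
Local Notation Lp := (Lfun mu p%:E).
Local Notation W := (frac_Sobolev s a p).
Local Notation N := (frac_Sobolev_norm s a p).

Let m := Num.truncn a.
Let p0 : 0 < p. Proof. by rewrite (lt_le_trans _ p1). Qed.

(** The operator acting on test functions for the j-th entry. The matching sign exponent is
    [minn j m]: j for ordinary derivatives, and the integer part m of a for the last entry. *)
Definition jet_op j : (R -> R) -> R -> R :=
  if (j <= m)%N then derive1n j else frac_deriv (opp_side s) a.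

(* A jet of [u] lists [u], its weak derivatives of orders 1, ..., m, and, at
   the index m+1, its weak fractional derivative. *)
Definition is_jet u v := v 0 = u /\
  forall j, (j <= m.+1)%N -> v j \in Lp /\ is_weak (minn j m) (jet_op j) u (v j).

Definition jet u j : R -> R :=
  if j == 0 then u else if (j <= m)%N then weak_deriv j u else weak_frac_deriv s a u.

Definition jet_norm v : R := (\sum_(0 <= j < m.+2) nm p (v j) `^ p) `^ p^-1.

Lemma admissible_jet_op j : admissible (jet_op j).
Proof.
by rewrite /jet_op; case: ifP => _; [exact: admissible_derive1n|exact: admissible_frac_deriv].
Qed.

Lemma jet_Lp u v j : is_jet u v -> (j <= m.+1)%N -> v j \in Lp.
Proof. by move=> [_ h] /h[]. Qed.

Lemma jet_weak u v j : is_jet u v -> (j <= m.+1)%N ->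
  is_weak (minn j m) (jet_op j) u (v j).
Proof. by move=> [_ h] /h[]. Qed.

Lemma jet_Lp0 u v : is_jet u v -> u \in Lp.
Proof. by move=> h; have := jet_Lp h (leq0n _); rewrite h.1. Qed.

(** The picked representative is a priori only locally integrable; it lies in L^p because it equals
    f almost everywhere. *)
Lemma is_weak_xget k (T : (R -> R) -> R -> R) u f : f \in Lp -> is_weak k T u f ->
  xget (cst 0) (is_weak k T u) \in Lp /\ is_weak k T u (xget (cst 0) (is_weak k T u)).
Proof.
move=> fp H; set g := xget _ _.
have Hg : is_weak k T u g by apply: xgetPex; exists f.
split => //; apply: (ae_Lp p1 _ fp (is_weak_unique Hg H)).
by have [[]] := Hg.
Qed.

Lemma is_weak0 u : u \in Lp -> is_weak 0 (derive1n 0) u u.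
Proof.
by move=> up; split=> [|phi _]; [exact: (Lp_locally_integrable p1)|rewrite expr0 mul1r].
Qed.

Lemma jetP u : W u -> is_jet u (jet u).
Proof.
move=> [[up H] [f fp Hf]]; split=> // j jm; rewrite /jet /jet_op.
case: j jm => [|j] jm; first by rewrite min0n; split=> //; exact: is_weak0.
case: ifPn => [jm'|]; last first.
  by rewrite -ltnNge => h; rewrite (minn_idPr (ltnW h)); exact: (is_weak_xget fp).
by have [g gp Hg] := H j.+1 jm'; rewrite (minn_idPl jm'); exact: (is_weak_xget gp).
Qed.

Lemma is_jet_Sobolev u v : is_jet u v -> W u.
Proof.
move=> jv; split; first split.
- exact: jet_Lp0 jv.
- move=> j /andP[j1 jm]; have jm' := leq_trans jm (leqnSn m).
  exists (v j); first exact: jet_Lp jv jm'.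
  by have := jet_weak jv jm'; rewrite (minn_idPl jm) /jet_op jm.
- exists (v m.+1); first exact: (jet_Lp jv).
  by have := jet_weak jv (leqnn _); rewrite (minn_idPr (leqnSn m)) /jet_op ltnn.
Qed.

Lemma is_jet_nm u v w j : is_jet u v -> is_jet u w -> (j <= m.+1)%N ->
  nm p (v j) = nm p (w j).
Proof.
move=> jv jw jm.
apply: ae_nm; [exact: Lp_measurable (jet_Lp jv jm)|exact: Lp_measurable (jet_Lp jw jm)|].
exact: (is_weak_unique (jet_weak jv jm) (jet_weak jw jm)).
Qed.

Lemma jet_norm_ge0 v : 0 <= jet_norm v. Proof. exact: powR_ge0. Qed.

(** Any jet computes the norm, by uniqueness almost everywhere. The inner power 1/p cancels the
    outer p, leaving a single sum over m+2 entries. *)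
Lemma frac_Sobolev_normE u v : is_jet u v -> N u = (jet_norm v)%:E.
Proof.
move=> jv; have ju := jetP (is_jet_Sobolev jv).
have -> : jet_norm v = jet_norm (jet u).
  rewrite /jet_norm; congr (_ `^ _); rewrite [LHS]big_nat [RHS]big_nat.
  apply: eq_bigr => j /andP[_ jm].
  by rewrite (is_jet_nm jv ju jm).
have E j : (j <= m.+1)%N -> (Lpnorm p (jet u j) `^ p)%E = (nm p (jet u j) `^ p)%:E.
  by move=> jm; rewrite (LpnormEnm p1 (jet_Lp ju jm)) poweR_EFin.
have S : Sobolev_norm m p u = ((\sum_(0 <= j < m.+1) nm p (jet u j) `^ p) `^ p^-1)%:E.
  rewrite /Sobolev_norm -poweR_EFin -sumEFin; congr (_ `^ _)%E.
  rewrite [RHS]big_nat_recl//; congr (_ + _)%E; first exact: (E 0).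
  rewrite big_add1/= big_nat [RHS]big_nat; apply: eq_bigr => j /andP[_ jm].
  by rewrite -E ?(leq_trans jm)// /jet/= jm.
rewrite /frac_Sobolev_norm -/m S poweR_EFin -powRrM mulVf ?gt_eqF// powRr1; last first.
  by apply: sumr_ge0 => j _; exact: powR_ge0.
have := E _ (leqnn m.+1); rewrite {1}/jet/= ltnn => ->.
by rewrite -EFinD poweR_EFin /jet_norm [in RHS]big_nat_recr.
Qed.

Lemma is_jet_lin (c : R) u u' v v' : is_jet u v -> is_jet u' v' ->
  is_jet (c *: u + u') (fun j => c *: v j + v' j).
Proof.
move=> jv jv'; split; first by rewrite jv.1 jv'.1.
move=> j jm; split; first by apply: (Lp_lin p1); [exact: jet_Lp jv jm|exact: jet_Lp jv' jm].
apply: (is_weak_lin p1) (jet_weak jv jm) (jet_weak jv' jm).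
- exact: admissible_jet_op.
- exact: jet_Lp0 jv.
- exact: jet_Lp jv jm.
- exact: jet_Lp0 jv'.
- exact: jet_Lp jv' jm.
Qed.

Lemma is_jet0 : is_jet 0 (fun=> 0).
Proof.
split=> // j jm; split; first exact: (Lp0 p1).
split; first exact: (Lp_locally_integrable p1 (Lp0 p1)).
move=> phi _; transitivity (0 : R).
  by under eq_Rintegral do rewrite mul0r; rewrite /Rintegral integral0.
by under eq_Rintegral do rewrite mul0r; rewrite /Rintegral integral0 mulr0.
Qed.

Lemma le_nm_jet v j : (j <= m.+1)%N -> nm p (v j) <= jet_norm v.
Proof.
move=> jm; rewrite /jet_norm -{1}[nm p (v j)](powRr1 (nm_ge0 p _)) -(mulfV (lt0r_neq0 p0)) powRrM.
apply: ge0_ler_powR; rewrite ?nnegrE ?invr_ge0 ?(ltW p0)// ?powR_ge0//.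
  by apply: sumr_ge0 => i _; exact: powR_ge0.
rewrite (@bigD1_seq _ _ _ _ _ j) ?iota_uniq ?mem_index_iota//= lerDl.
by apply: sumr_ge0 => i _; exact: powR_ge0.
Qed.

Lemma cvg_jet_norm (w : nat -> nat -> R -> R) :
  (forall j, (j < m.+2)%N -> nm p (w n j) @[n --> \oo] --> 0) ->
  jet_norm (w n) @[n --> \oo] --> 0.
Proof.
move=> H; have pV : 0 < p^-1 by rewrite invr_gt0.
have -> : (0 : R) = 0 `^ p^-1 by rewrite powR0// gt_eqF.
apply: (cvg_powR pV) => [n|]; first by apply: sumr_ge0 => i _; exact: powR_ge0.
elim: m.+2 H => [_|k IHk H]; first by under eq_fun do rewrite big_nil; exact: cvg_cst.
under eq_fun do rewrite big_nat_recr//=.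
rewrite (_ : nbhs 0 = nbhs (0 + 0 : R)); last by rewrite addr0.
apply: cvgD; first by apply: IHk => j jk; exact: H (leqW jk).
rewrite -(powR0 (lt0r_neq0 p0)); apply: (cvg_powR p0) => [n|]; first exact: nm_ge0.
exact: H.
Qed.

Lemma frac_Sobolev0 : W 0.
Proof. exact: is_jet_Sobolev is_jet0. Qed.

Lemma frac_Sobolev_lin (c : R) u u' : W u -> W u' -> W (c *: u + u').
Proof. by move=> /jetP ju /jetP ju'; exact: is_jet_Sobolev (is_jet_lin c ju ju'). Qed.

Lemma frac_Sobolev_norm_ge0 u : W u -> (0 <= N u)%E.
Proof. by move=> /jetP/frac_Sobolev_normE ->; rewrite lee_fin jet_norm_ge0. Qed.

Lemma frac_Sobolev_norm_fin u : W u -> N u \is a fin_num.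
Proof. by move=> /jetP/frac_Sobolev_normE ->. Qed.

Lemma frac_Sobolev_normD u u' : W u -> W u' -> (N (u + u')%R <= N u + N u')%E.
Proof.
move=> /jetP ju /jetP ju'; have := is_jet_lin 1 ju ju'; rewrite scale1r => jD.
rewrite (frac_Sobolev_normE ju) (frac_Sobolev_normE ju') (frac_Sobolev_normE jD).
rewrite -EFinD lee_fin; apply: le_trans (finite_minkowski m.+2 p1 _ _); last 2 first.
- by move=> j; exact: nm_ge0.
- by move=> j; exact: nm_ge0.
apply: ge0_ler_powR; rewrite ?nnegrE ?invr_ge0 ?(ltW p0)//.
- by apply: sumr_ge0 => i _; exact: powR_ge0.
- by apply: sumr_ge0 => i _; exact: powR_ge0.
rewrite big_nat [leRHS]big_nat; apply: ler_sum => j /andP[_ jm].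
apply: ge0_ler_powR; rewrite ?nnegrE ?(ltW p0) ?nm_ge0 ?addr_ge0 ?nm_ge0//.
by rewrite scale1r; apply: (nmD p1); [exact: jet_Lp ju jm|exact: jet_Lp ju' jm].
Qed.

Lemma frac_Sobolev_normZ c u : W u -> N (c *: u) = (`|c|%:E * N u)%E.
Proof.
move=> /jetP ju; have := is_jet_lin c ju is_jet0; rewrite addr0 => jZ.
rewrite (frac_Sobolev_normE ju) (frac_Sobolev_normE jZ) -EFinM; congr _%:E.
rewrite /jet_norm -{1}[`|c|](powRr1 (normr_ge0 c)) -(mulfV (lt0r_neq0 p0)) powRrM.
rewrite -powRM ?powR_ge0//; last by apply: sumr_ge0 => i _; exact: powR_ge0.
congr (_ `^ _); rewrite big_distrr/= big_nat [RHS]big_nat; apply: eq_bigr => j /andP[_ jm].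
by rewrite addr0 (nmZ p1 _ (jet_Lp ju jm)) powRM// nm_ge0.
Qed.

Lemma cvg_frac_Sobolev_norm u v (U : nat -> R -> R) (V : nat -> nat -> R -> R) :
  is_jet u v -> (forall n, is_jet (U n) (V n)) ->
  (forall j, (j <= m.+1)%N -> nm p (V n j - v j) @[n --> \oo] --> 0) ->
  fine (N (U n - u)) @[n --> \oo] --> 0.
Proof.
move=> jv jV H.
have J n : is_jet (U n - u) (fun j => V n j - v j).
  have := is_jet_lin (-1) jv (jV n); rewrite scaleN1r addrC.
  by under eq_fun do rewrite scaleN1r addrC.
under eq_fun do rewrite (frac_Sobolev_normE (J _))/=.
exact: cvg_jet_norm.
Qed.

(** Each entry of the jets is Cauchy in L^p, and by [is_weak_lim] the limits of the entries form a
    jet of the limit of the functions. *)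
Lemma frac_Sobolev_complete (x : nat -> R -> R) : @cauchy_seq R (frac_W s a p) x ->
  exists2 y, W y & fine (N (x n - y)) @[n --> \oo] --> 0.
Proof.
move=> [Wx cx]; have J n := jetP (Wx n).
have /choice[f Hf] : forall j, exists f : R -> R, (j <= m.+1)%N ->
    f \in Lp /\ nm p (jet (x n) j - f) @[n --> \oo] --> 0.
  move=> j; have [jm|] := leqP j m.+1; last by exists 0.
  have [||f fp hf] := @Lp_complete R p p1 (fun n => jet (x n) j); last by exists f.
    by move=> n; exact: jet_Lp jm.
  move=> e /cx[K HK]; exists K => i k Ki Kk.
  have Jik := is_jet_lin (-1) (J k) (J i).
  have := HK i k Ki Kk.
  rewrite -[X in (nrm _ X < _)%E]addrC -scaleN1r [nrm _ _](frac_Sobolev_normE Jik) lte_fin.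
  apply: le_lt_trans; apply: le_trans (le_nm_jet _ jm).
  by rewrite scaleN1r addrC.
have jf : is_jet (f 0) f.
  split=> // j jm; have [fp hf] := Hf j jm; split => //.
  have [f0p hf0] := Hf 0 (leq0n _).
  apply: (is_weak_lim p1 (admissible_jet_op j)) hf0 hf _ => //.
  - by move=> i; exact: jet_Lp (J i) (leq0n _).
  - by move=> i; exact: jet_Lp (J i) jm.
  - by move=> i; exact: jet_weak (J i) jm.
exists (f 0); first exact: is_jet_Sobolev jf.
apply: (cvg_frac_Sobolev_norm jf J) => j jm.
by have [] := Hf j jm.
Qed.

End Jets.

(** * Density of test functions by mollification and cutoff *)

Section Density.
Variables (R : realType) (s : side) (a p : R).
Hypothesis a0 : 0 < a.
Hypothesis p1 : 1 <= p.
Implicit Types (u f g h : R -> R) (G : nat -> R -> R).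

Local Notation mu := (@lebesgue_measure R).
Local Notation Lp := (Lfun mu p%:E).
Local Notation W := (frac_Sobolev s a p).
Local Notation N := (frac_Sobolev_norm s a p).

Let m := Num.truncn a.
Let p0 : 0 < p. Proof. by rewrite (lt_le_trans _ p1). Qed.

Definition smooth_Lp f := smooth f /\ forall j, derive1n j f \in Lp.

(** If |g| <= M then |g|^p <= M^(p-1) |g|. *)
Lemma good_Lp g : good g -> g \in Lp.
Proof.
move=> gg; have [mg ig [M hM]] := gg; have [K K0 hK] := good_norm gg.
apply/(mem_LfunP _ p0); split => //.
have M0 : 0 <= M by apply: le_trans (hM 0).
apply: (@le_lt_trans _ _ (\int[mu]_x ((M `^ (p - 1))%:E * `|g x|%:E))%E).
  apply: ge0_le_integral => //.
  - exact: measurable_ipow.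
  - apply/measurable_EFinP; apply: (@measurable_funM _ _ _ _ (cst (M `^ (p - 1)))) => //.
    exact: measurableT_comp.
  - move=> x _; rewrite -EFinM lee_fin -(mulr_powRB1 (normr_ge0 _) p0) mulrC.
    by rewrite ler_wpM2r// ge0_ler_powR ?nnegrE// subr_ge0.
rewrite ge0_integralZl//; first by rewrite hK -EFinM ltry.
  by apply/measurable_EFinP; exact: measurableT_comp.
by rewrite lee_fin powR_ge0.
Qed.

Lemma Cinfty0_smooth_Lp f : Cinfty0 f -> smooth_Lp f.
Proof.
move=> cf; split=> [|j]; first exact (Cinfty0_smooth cf).
by apply/good_Lp/good_Cinfty0; exact: Cinfty0_derive1n.
Qed.

Lemma smooth_Lp_derive1 f : smooth_Lp f -> smooth_Lp (derive1 f).
Proof.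
move=> [sf Hf]; split=> [|j]; first exact (smooth_derive1 sf).
by rewrite -derive1Sn; exact: Hf.
Qed.

Lemma smooth_Lp_weak_deriv f j : smooth_Lp f -> is_weak_deriv j f (derive1n j f).
Proof.
move=> [sf Hf]; split; first exact: Lp_locally_integrable (Hf j).
by move=> phi cphi; exact: by_partsn.
Qed.

(** One C serves all f, so that it can be applied along a sequence of functions. *)
Lemma smooth_jet : exists2 C : R, 0 <= C & forall f, smooth_Lp f ->
  exists2 v, is_jet s a p f v & (forall j, (j <= m)%N -> v j = derive1n j f) /\
    nm p (v m.+1) <= C * (nm p (derive1n m f) + nm p (derive1n m.+1 f)).
Proof.
have [C C0 HC] := weak_frac_bound s a0 p1; exists C => // f sf; have [_ fp] := sf.
have [v vp [wv nv]] := HC f _ _ (fp 0) (fp m) (fp m.+1) (smooth_Lp_weak_deriv m sf)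
  (smooth_Lp_weak_deriv m.+1 sf).
exists (fun j => if (j <= m)%N then derive1n j f else v); last first.
  by split=> [j ->//|]; rewrite ltnn.
split=> // j jm; rewrite /jet_op -/m; case: ifPn => [jm'|].
  by rewrite (minn_idPl jm'); split; [exact: fp|exact: smooth_Lp_weak_deriv].
by rewrite -ltnNge => /ltnW/minn_idPr ->.
Qed.

(** An abstraction of 1 - chi_n that is stable under derivation, which lets the product rule be
    iterated without binomial sums. *)
Definition escaping G := (forall n, smooth (G n)) /\
  (forall n (x : R), `|x| < n.+1%:R -> G n x = 0) /\
  (forall j, exists2 C : R, 0 <= C & forall n x, `|derive1n j (G n) x| <= C).

Lemma escaping_derive1 G : escaping G -> escaping (fun n => derive1 (G n)).
Proof.
move=> [sG [G0 bG]]; split; first by move=> n; exact (smooth_derive1 (sG n)).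
split=> [n x xn|j].
  rewrite derive1E.
  transitivity ('D_1 (cst 0 : R -> R) x); last by rewrite derive_cst.
  apply: near_eq_derive.
  have : \forall y \near x, `|y| < n.+1%:R.
    by have /cvgr_lt/(_ _ xn) := @norm_continuous _ R x.
  by apply: filterS => y /G0.
by have [C C0 hC] := bG j.+1; exists C => // n x; rewrite -derive1Sn.
Qed.

(** Induction on j for all f and G at once: (G f)' = G' f + G f', where G' is again escaping and f'
    again smooth with all derivatives in L^p. For j = 0, G f is bounded by a multiple of a tail of
    f. *)
Lemma escaping_mul_cvg0 f : smooth_Lp f -> forall j G, escaping G ->
  (forall n, derive1n j (fun x => G n x * f x) \in Lp) /\
  nm p (derive1n j (fun x => G n x * f x)) @[n --> \oo] --> 0.
Proof.
move=> sf j; elim: j f sf => [|j IHj] f sf G HG; have [sG [G0 bG]] := HG; have [ssf fp] := sf.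
  have f0p := fp 0; have mf := Lp_measurable p1 f0p.
  have [C C0 hC] := bG 0.
  (* Truncations tend to f pointwise and are dominated by f, so the tails [H n - f] tend to 0 in L^p
     by [cvg_Lp_of_ae]. *)
  pose H n := f \_ (`]- n.+1%:R, n.+1%:R[ : set R).
  have mH n : measurable_fun setT (H n).
    by apply/(measurable_restrictT _ _).1 => //; exact: measurable_funTS.
  have leH n x : `|H n x| <= `|f x| by rewrite /H patchE; case: ifP => //; rewrite normr0.
  have Hp n : H n \in Lp /\ nm p (H n) <= nm p f by exact: (le_Lp p1 (mH n) f0p (leH n)).
  have HE n (x : R) : `|x| < n.+1%:R -> H n x = f x.
    by move=> xn; rewrite /H patchE mem_set//= in_itv/= -ltr_norml.
  have H0 n (x : R) : n.+1%:R <= `|x| -> H n x = 0.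
    by move=> xn; rewrite /H patchE memNset//= in_itv/= -ltr_norml => /lt_geF; rewrite xn.
  have cvH : nm p (H n - f) @[n --> \oo] --> 0.
    apply: cvg_Lp_of_ae => //; [by move=> n; have [] := Hp n| |by move=> n; have [] := Hp n].
    apply: aeW => x; apply/cvgrPdist_lt => e e0; exists (Num.truncn `|x|) => // n /= xn.
    rewrite HE ?subrr ?normr0//; have /andP[_ h] := truncn_itv (normr_ge0 x).
    by apply: (lt_le_trans h); rewrite ler_nat.
  have le n : (fun x => G n x * f x) \in Lp /\
      nm p (fun x => G n x * f x) <= nm p (C *: (H n - f)).
    apply: (le_Lp p1).
    - by apply: measurable_funM => //; exact (smooth_measurable (sG n)).
    - by apply: (LpZ p1); apply: (LpB p1) => //; have [] := Hp n.
    - move=> x; have [xn|xn] := ltP `|x| n.+1%:R; first by rewrite G0// mul0r normr0.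
      rewrite -[(_ *: _) x]/(C * (H n x - f x)) H0// sub0r mulrN normrN !normrM (ger0_norm C0).
      by rewrite ler_wpM2r//; exact: hC.
  split=> [n|]; first by have [] := le n.
  apply: (@squeeze_cvgr _ _ _ _ (cst 0) (fun n => C * nm p (H n - f))).
  - apply: nearW => n; rewrite nm_ge0/=; have [_ h] := le n.
    by rewrite (le_trans h)// nmZ ?ger0_norm//; apply: (LpB p1) => //; have [] := Hp n.
  - exact: cvg_cst.
  - by rewrite -(mulr0 C); apply: cvgM => //; exact: cvg_cst.
have [p' c'] := IHj f sf _ (escaping_derive1 HG).
have [p'' c''] := IHj _ (smooth_Lp_derive1 sf) G HG.
have E n : derive1n j.+1 (fun x => G n x * f x) =
    derive1n j (fun x => derive1 (G n) x * f x) + derive1n j (fun x => G n x * derive1 f x).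
  rewrite derive1Sn derive1M// -[RHS]scale1r scalerDr.
  have := derive1n_lin j 1 (smoothM (smooth_derive1 (sG n)) ssf)
    (smoothM (sG n) (smooth_derive1 ssf)).
  by rewrite !scale1r.
split=> [n|]; first by rewrite E; apply: (LpD p1).
under eq_fun do rewrite E.
apply: (@squeeze_cvgr _ _ _ _ (cst 0) (fun n =>
  nm p (derive1n j (fun x => derive1 (G n) x * f x)) +
  nm p (derive1n j (fun x => G n x * derive1 f x)))).
- by apply: nearW => n; rewrite nm_ge0/=; exact: (nmD p1).
- exact: cvg_cst.
- by rewrite -(addr0 0); apply: cvgD.
Qed.

(** The cutoff is chi(x / (n+1)). Its j-th derivative carries the factor (n+1)^-j <= 1, which makes
    the bounds uniform in n. *)
Lemma cutoff_family : exists chi : nat -> R -> R,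
  (forall n f, smooth f -> Cinfty0 (fun x => chi n x * f x)) /\
  escaping (fun n x => 1 - chi n x).
Proof.
have [chi [schi chi01 chi1 chi0]] := cutoff_exists R.
pose c n x := chi (0 + n.+1%:R^-1 * x).
have nV n : 0 < n.+1%:R^-1 :> R by rewrite invr_gt0.
have sc n : smooth (c n) by exact (smooth_affine 0 n.+1%:R^-1 schi).
exists c; split.
  move=> n f sf; apply/Cinfty0P; split; first exact (smoothM (sc n) sf).
  exists (n.+1%:R * 2) => x xn; rewrite /c chi0 ?mul0r// add0r normrM (gtr0_norm (nV n)).
  by rewrite ler_pdivlMl.
have cchi : Cinfty0 chi by apply/Cinfty0P; split => //; exists 2.
have E n : (fun x => 1 - c n x) = (-1) *: c n + cst 1.
  by apply/funext => x; rewrite -[RHS]/(-1 * c n x + 1) mulN1r addrC.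
split; first by move=> n; rewrite E; exact (smooth_lin (-1) (sc n) (smooth_cst 1)).
split=> [n x xn|j].
  rewrite /c chi1 ?subrr// add0r normrM (gtr0_norm (nV n)) ler_pdivrMl// mulr1.
  exact: ltW.
have [C C0 hC] := Cinfty0_bounded (Cinfty0_derive1n j cchi).
have [D D0 hD] : exists2 D : R, 0 <= D & forall x, `|derive1n j (cst 1 : R -> R) x| <= D.
  exists 1 => // x; case: (j) => [|k]; first by rewrite /= normr1.
  suff -> : derive1n k.+1 (cst 1 : R -> R) = cst 0 by rewrite normr0.
  elim: k => [|k IHk]; first by apply/funext => y; exact: derive1_cst.
  rewrite -[LHS]/(derive1 (derive1n k.+1 _)) IHk; apply/funext => y; exact: derive1_cst.
exists (C + D) => [|n x]; first exact: addr_ge0.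
rewrite E derive1n_lin; [|exact (sc n)|exact (smooth_cst 1)].
rewrite (le_trans (ler_normD _ _))// lerD//.
rewrite -[(_ *: _) x]/(-1 * _) mulN1r normrN /c derive1n_affine// normrM.
rewrite -[leRHS]mul1r ler_pM// normrX exprn_ile1// (gtr0_norm (nV n)).
by rewrite invf_le1// ler1n.
Qed.

Lemma Cinfty0_sub_frac_Sobolev : @Cinfty0 R `<=` W.
Proof.
move=> f /Cinfty0_smooth_Lp sf; have [C _ /(_ _ sf)[v jv _]] := smooth_jet.
exact: is_jet_Sobolev jv.
Qed.

Lemma smooth_Lp_approx f (e : R) : smooth_Lp f -> 0 < e ->
  W f /\ exists2 g, Cinfty0 g & (N (f - g)%R < e%:E)%E.
Proof.
move=> sf e0; have [C C0 HC] := smooth_jet; have [v jv _] := HC f sf.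
have Wf := is_jet_Sobolev jv; split => //.
have [chi [cchi Hchi]] := cutoff_family.
pose U n x := (1 - chi n x) * f x.
have HU j := escaping_mul_cvg0 sf j Hchi.
have sU n : smooth_Lp (U n).
  have [sG _] := Hchi; split; first exact (smoothM (sG n) sf.1).
  by move=> j; exact ((HU j).1 n).
have /choice[V HV] : forall n, exists v, is_jet s a p (U n) v /\
    ((forall j, (j <= m)%N -> v j = derive1n j (U n)) /\
    nm p (v m.+1) <= C * (nm p (derive1n m (U n)) + nm p (derive1n m.+1 (U n)))).
  by move=> n; have [w jw Hw] := HC _ (sU n); exists w.
have cv : fine (N (U n - 0)) @[n --> \oo] --> 0.
  apply: (cvg_frac_Sobolev_norm a0 p1 (is_jet0 s a p1) (fun n => (HV n).1)) => j jm.
  under eq_fun do rewrite subr0.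
  have [jm'|] := leqP j m.
    under eq_fun do rewrite (HV _).2.1//.
    by have [] := HU j.
  move=> mj; have -> : j = m.+1 by apply/eqP; rewrite eqn_leq jm.
  (* The fractional entry of (1 - chi_n) f is controlled by the derivatives of orders m and m+1 of
     that product, which tend to 0. *)
  apply: (@squeeze_cvgr _ _ _ _ (cst 0) (fun n =>
     C * (nm p (derive1n m (U n)) + nm p (derive1n m.+1 (U n))))).
  - by apply: nearW => n; rewrite nm_ge0/=; exact: (HV n).2.2.
  - exact: cvg_cst.
  - rewrite -(mulr0 C) -(addr0 0); apply: cvgM; first exact: cvg_cst.
    by apply: cvgD; [have [] := HU m|have [] := HU m.+1].
have /cvgr0Pnorm_lt/(_ _ e0)[n _ /(_ n (leqnn n))/= hn] := cv.
rewrite subr0 in hn.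
have WU := is_jet_Sobolev (HV n).1.
exists (fun x => chi n x * f x); first exact: cchi sf.1.
have -> : f - (fun x => chi n x * f x) = U n - 0.
  by apply/funext => x; rewrite /U subr0 mulrBl mul1r.
rewrite subr0 -[N (U n)]fineK ?(frac_Sobolev_norm_fin p1)// lte_fin.
by apply: le_lt_trans hn; exact: ler_norm.
Qed.

Lemma dense_Cinfty0 : @dense_in R (frac_W s a p) (@Cinfty0 R).
Proof.
split; first exact: Cinfty0_sub_frac_Sobolev.
move=> u Wu e e0; have ju := jetP p1 Wu; set v := jet s a u in ju.
have [eta Heta] := mollifiers_exist R.
pose U n := conv (-1) u (eta n); pose V n j := conv (-1) (v j) (eta n).
have up := jet_Lp0 ju.
(* Mollification commutes with each weak derivative, so the mollified entries form a jet of the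
   mollified function. *)
have jU n : is_jet s a p (U n) (V n).
  split=> [|j jm]; first by rewrite /V ju.1.
  split; first by have [] := mollify_Lp p1 Heta n (jet_Lp ju jm).
  exact (mollify_weak p1 Heta n (admissible_jet_op s a0 j) up (jet_Lp ju jm) (jet_weak ju jm)).
have cv : fine (N (U n - u)) @[n --> \oo] --> 0.
  apply: (cvg_frac_Sobolev_norm a0 p1 ju jU) => j jm.
  exact (mollify_cvg p1 Heta (jet_Lp ju jm)).
have e20 : 0 < e / 2 by rewrite divr_gt0.
have /cvgr0Pnorm_lt/(_ _ e20)[n _ /(_ n (leqnn n))/= hn] := cv.
have sU : smooth_Lp (U n).
  split; first exact (mollify_smooth p1 Heta up).
  by move=> j; exact: (mollify_derive1n_Lp p1 Heta).
have [WU [g cg hg]] := smooth_Lp_approx sU e20.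
exists g => //; have Wg := Cinfty0_sub_frac_Sobolev cg.
have WB f h : W f -> W h -> W (f - h).
  by move=> Wf Wh; rewrite addrC -scaleN1r; exact: frac_Sobolev_lin.
have -> : u - g = (-1) *: (U n - u) + (U n - g).
  by rewrite scaleN1r opprB addrA subrK.
have WUu := WB _ _ WU Wu; have WUg := WB _ _ WU Wg.
have WN : W ((-1) *: (U n - u)).
  rewrite -[X in W X]addr0; apply: frac_Sobolev_lin => //; exact: frac_Sobolev0.
apply: (le_lt_trans (frac_Sobolev_normD a0 p1 WN WUg)).
rewrite (frac_Sobolev_normZ a0 p1 _ WUu) normrN1 mul1e [e]splitr EFinD.
apply: lteD => //; rewrite -[N (_ - u)]fineK ?(frac_Sobolev_norm_fin p1)// lte_fin.
by apply: le_lt_trans hn; exact: ler_norm.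
Qed.

End Density.

(** * Identification of the completions with the space *)

Lemma Cinfty0_side_lin (R : realType) s (c : R) (f g : R -> R) :
  Cinfty0_side s f -> Cinfty0_side s g -> Cinfty0_side s (c *: f + g).
Proof.
case: s => -[sf [x hx]] [sg [y hy]]; split; try exact (smooth_lin c sf sg).
  exists (Num.max x y) => z; rewrite gt_max => /andP[xz yz].
  by rewrite -[LHS]/(c * f z + g z) hx// hy// mulr0 addr0.
exists (Num.min x y) => z; rewrite lt_min => /andP[xz yz].
by rewrite -[LHS]/(c * f z + g z) hx// hy// mulr0 addr0.
Qed.

Lemma same_space_sub (R : realType) (V : Type) (A B : set V) (S T : nspace R)
    (i : V -> S) (j : V -> T) : A `<=` B -> same_space B i j -> same_space A i j.
Proof. by move=> AB [J [? ? ? ? H]]; exists J; split => // f /AB; exact: H. Qed.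

Theorem theorem5p3 (R : realType) (s : side) (a p : R) (ha : 0 < a)
    (hp : 1 <= p) :
  let W := frac_W s a p in
  let Wbar := frac_Wbar s a p in
  let Wbar0 := frac_Wbar0 s a p in
  [/\ @dense_in R W (@Cinfty0 R),
      @same_space R (R -> R) (@Cinfty0_side R s `&` frac_Sobolev s a p)
        Wbar Wbar0 (fun f => cst f) (fun f => cst f),
      @same_space R (R -> R) (@Cinfty0_side R s `&` frac_Sobolev s a p)
        Wbar0 W (fun f => cst f) (fun f => f) &
      @same_space R (R -> R) (@Cinfty R `&` frac_Sobolev s a p)
        Wbar W (fun f => cst f) (fun f => f)].
Proof.
move=> W Wbar Wbar0.
have D := dense_Cinfty0 s ha hp.
have DA (A : set (R -> R)) : @Cinfty0 R `<=` A ->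
    @dense_in R W (A `&` frac_Sobolev s a p).
  move=> cA; split=> [f []//|f Wf e e0]; have [g cg hg] := D.2 f Wf e e0.
  by exists g => //; split; [exact: cA|exact: Cinfty0_sub_frac_Sobolev].
have Lin (A : set (R -> R)) : (forall (c : R) f g, A f -> A g -> A (c *: f + g)) ->
    forall (c : R) f g, (A `&` frac_Sobolev s a p) f -> (A `&` frac_Sobolev s a p) g ->
    (A `&` frac_Sobolev s a p) (c *: f + g).
  move=> HA c f g [Af Wf] [Ag Wg]; split; first exact: HA.
  exact: frac_Sobolev_lin.
have L1 := Lin (@Cinfty R) (fun c f g sf sg => smooth_lin c sf sg).
have L2 := Lin (@Cinfty0_side R s) (@Cinfty0_side_lin R s).
have D1 := DA (@Cinfty R) (@Cinfty0_smooth R).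
have D2 := DA (@Cinfty0_side R s) (@Cinfty0_side_of R s).
have sideW : @Cinfty0_side R s `<=` @Cinfty R by case: (s) => f [].
have A0 := frac_Sobolev0 s a hp.
have A1 := frac_Sobolev_lin (s := s) ha hp.
have A2 := frac_Sobolev_norm_ge0 (s := s) (a := a) hp.
have A3 := frac_Sobolev_norm_fin (s := s) (a := a) hp.
have A4 := frac_Sobolev_normD (s := s) ha hp.
have A5 := frac_Sobolev_normZ (s := s) ha hp.
have A6 := frac_Sobolev_complete (s := s) ha hp.
split => //.
(* The general lemma gives the identity on the intersection of the two subspaces; one-sided
   functions being smooth, that intersection contains the set required. *)
- apply: (@same_space_sub _ _ _ ((@Cinfty R `&` frac_Sobolev s a p) `&`
    (@Cinfty0_side R s `&` frac_Sobolev s a p))).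
    by move=> f [cf Wf]; split=> //; split=> //; exact: sideW.
  exact (completions_dense_same_space A0 A1 A2 A3 A4 A5
    (@subIsetr _ _ _) (@subIsetr _ _ _) L1 L2 D1 D2).
- by apply: (completion_dense_same_space A0 A1 A2 A3 A4 A5 A6) => // f [].
- by apply: (completion_dense_same_space A0 A1 A2 A3 A4 A5 A6) => // f [].
Qed.
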